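(* Let $Q$ be a non-elementary, torsion free, lacunary hyperbolic group all of whose maximal subgroups are isomorphic to a fixed nontrivial rank one group, and let $Q_m<Q$ be a maximal subgroup. Let $N\rtimes Q\in\mathcal{R}ip(Q)$, and put $\mathcal M_m:=\mathcal L(N\rtimes Q_m)\subset\mathcal M:=\mathcal L(N\rtimes Q)$. Then $\mathcal M_m$ is a maximal von Neumann subalgebra of $\mathcal M$. In particular, when $N\rtimes Q\in\mathcal{R}ip_T(Q)$, then $\mathcal M_m$ is a non-property (T) maximal von Neumann subalgebra of the property (T) von Neumann algebra $\mathcal M$.
   Context: All groups are countable and discrete; $\mathcal L(G)$ is the group von Neumann algebra of $G$. A group is called rank one if it is isomorphic to a subgroup of $(\mathbb Q,+)$. A von Neumann subalgebra $\mathcal N\subset\mathcal M$ is maximal if there is no von Neumann algebra $\mathcal P$ with $\mathcal N\subsetneq\mathcal P\subsetneq\mathcal M$. Property (T) for von Neumann algebras is in the sense of Connes–Jones. A finitely generated group is lacunary hyperbolic if it is the direct limit of a sequence of epimorphisms $\eta_i:G_i\to G_{i+1}$ of hyperbolic groups, where $G_i$ is generated by a finite set $S_i$, $\eta_i(S_i)=S_{i+1}$, $G_i$ is $\delta_i$-hyperbolic with respect to $S_i$, and $\delta_i=o(r_{S_i}(\eta_i))$, where $r_{S_i}(\eta_i)$ is the largest radius of a ball centered at the identity in the Cayley graph of $G_i$ with respect to $S_i$ on which $\eta_i$ is injective. Elementary means virtually cyclic. For a finitely generated torsion free group $Q$, $\mathcal{R}ip(Q)$ denotes the class of all semidirect products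 $G=N\rtimes_\sigma Q$ such that: (1) $N$ is isomorphic to a quotient of some torsion free, non-elementary hyperbolic group with property (T); (2) $Q$ is a proper subgroup of $G$ and $G$ is hyperbolic relative to $\{Q\}$; (3) $G$ is torsion free; (4) the canonical map $Q\to\mathrm{Out}(N)$ is injective with finite index image. When $Q$ moreover has property (T), this class is denoted $\mathcal{R}ip_T(Q)$. *)

(* Defs.v *)
From HB Require Import structures.
From mathcomp Require Import all_boot all_order all_algebra.
From mathcomp Require Import all_classical all_reals all_analysis.
From mathcomp Require Import complex ring lra.

Set Implicit Arguments.
Unset Strict Implicit.
Unset Printing Implicit Defensive.

Import Order.TTheory GRing.Theory Num.Theory Num.Def numFieldNormedType.Exports.
Local Open Scope classical_set_scope.
Local Open Scope ring_scope.

(** * Discrete groups *)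

(* Groups are MathComp's (possibly infinite) [groupType]; subgroups, and
   generating sets, are classical sets. *)

Definition is_subgroup (G : groupType) (H : set G) : Prop :=
  [/\ H 1%g, forall x y, H x -> H y -> H (x * y)%g & forall x, H x -> H x^-1%g].

Definition maximal_subgroup (G : groupType) (H : set G) : Prop :=
  [/\ is_subgroup H, H <> setT &
      forall K : set G, is_subgroup K -> H `<=` K -> K = H \/ K = setT].

Definition subgroup_isog (G C : groupType) (H : set G) : Prop :=
  exists f : {multiplicative C -> G}, injective f /\ range f = H.

Definition rank_one (C : groupType) : Prop :=
  exists f : C -> rat, {morph f : x y / (x * y)%g >-> x + y} /\ injective f.

Definition nontrivial (G : groupType) : Prop := exists x : G, x <> 1%g.

Definition torsion_free (G : groupType) : Prop :=
  forall (x : G) (n : nat), (0 < n)%N -> (x ^+ n)%g = 1%g -> x = 1%g.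

Definition finite_index (G : groupType) (H : set G) : Prop :=
  exists s : seq G, forall x, exists2 y, y \in s & H (y^-1 * x)%g.

Definition cyclic_subgroup (G : groupType) (g : G) : set G :=
  [set x | exists n : nat, x = (g ^+ n)%g \/ x = (g ^- n)%g].

Definition elementary (G : groupType) : Prop :=
  exists g : G, finite_index (cyclic_subgroup g).

(* Ball of radius [n] about 1 in the Cayley graph of [G] with respect to [S]. *)
Definition word_ball (G : groupType) (S : set G) (n : nat) : set G :=
  [set g | exists w : seq G, [/\ (size w <= n)%N,
     forall s, s \in w -> S s \/ S s^-1%g & g = (\prod_(s <- w) s)%g]].

Definition generates (G : groupType) (S : set G) : Prop :=
  forall g : G, exists n, word_ball S n g.

Definition finitely_generated (G : groupType) : Prop :=
  exists S : set G, finite_set S /\ generates S.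

(* [x] and [y] are at distance exactly [n] in the word metric. *)
Definition word_dist (G : groupType) (S : set G) (x y : G) (n : nat) : Prop :=
  word_ball S n (x^-1 * y)%g /\
  forall m, (m < n)%N -> ~ word_ball S m (x^-1 * y)%g.

(* [p 0, ..., p n] are the successive vertices of a geodesic from [x] to [y]. *)
Definition geodesic (G : groupType) (S : set G) (x y : G) (n : nat)
    (p : nat -> G) : Prop :=
  [/\ p 0%N = x, p n = y &
      forall i j, (i <= j)%N -> (j <= n)%N -> word_dist S (p i) (p j) (j - i)].

(* Rips' condition: the triangles of the Cayley graph are [delta]-slim. *)
Definition hyperbolic_wrt (R : realType) (G : groupType) (S : set G)
    (delta : R) : Prop :=
  forall (x y z : G) (n m k : nat) (p q r : nat -> G),
    geodesic S x y n p -> geodesic S y z m q -> geodesic S x z k r ->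
    forall i, (i <= n)%N -> exists (v : G) (d : nat),
      [/\ d%:R <= delta, word_ball S d ((p i)^-1 * v)%g &
          (exists2 j, (j <= m)%N & v = q j) \/ (exists2 j, (j <= k)%N & v = r j)].

Definition hyperbolic (R : realType) (G : groupType) : Prop :=
  exists (S : set G) (delta : R),
    [/\ finite_set S, generates S & hyperbolic_wrt S delta].

(* The radius is [+oo] when [eta] is injective. *)
Definition injectivity_radius (R : realType) (G H : groupType) (S : set G)
    (eta : G -> H) : \bar R :=
  ereal_sup [set n%:R%:E | n in [set n : nat | set_inj (word_ball S n) eta]].

Fixpoint iter_maps (G : nat -> groupType)
    (eta : forall i, {multiplicative G i -> G i.+1}) (i j : nat) :
    G i -> G (j + i)%N :=
  match j with
  | 0%N => fun x => x
  | j'.+1 => fun x => eta (j' + i)%N (iter_maps eta j' x)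
  end.

(* [Q], with the maps [phi i], is the direct limit of the sequence: the union
   of the images of the [phi i] is [Q], and [phi i] kills exactly what is
   killed at some later stage. *)
Definition is_direct_limit (G : nat -> groupType)
    (eta : forall i, {multiplicative G i -> G i.+1}) (Q : groupType)
    (phi : forall i, {multiplicative G i -> Q}) : Prop :=
  [/\ forall i x, phi i.+1 (eta i x) = phi i x,
      forall y : Q, exists i x, phi i x = y &
      forall i x, phi i x = 1%g -> exists j, iter_maps eta j x = 1%g].

Definition lacunary_hyperbolic (R : realType) (Q : groupType) : Prop :=
  finitely_generated Q /\
  exists (G : nat -> groupType) (eta : forall i, {multiplicative G i -> G i.+1})
    (phi : forall i, {multiplicative G i -> Q}) (S : forall i, set (G i))
    (delta : nat -> R),
    [/\ is_direct_limit eta phi,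
        forall i, range (eta i) = setT /\ eta i @` S i = S i.+1,
        forall i, finite_set (S i) /\ generates (S i),
        forall i, hyperbolic_wrt (S i) (delta i) &
        forall eps : R, 0 < eps -> exists i0, forall i, (i0 <= i)%N ->
          ((delta i)%:E <= eps%:E * injectivity_radius R (S i) (eta i))%E].

(** ** Relative hyperbolicity (Osin) *)

(* Words representing elements of the free product F(X) * H: [inl (x, false)]
   is the letter x of X, [inl (x, true)] its formal inverse, and [inr h] the
   letter h of H; the alphabets X and H are disjoint even if they meet in G. *)
Definition rletter (G : groupType) : Type := ((G * bool) + G)%type.

Definition rword (G : groupType) : Type := seq (rletter G).

Section RelativePresentations.
Variables (G : groupType) (X H : set G).

Definition letter_inv (l : rletter G) : rletter G :=
  match l with
  | inl (x, b) => inl (x, ~~ b)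
  | inr h => inr h^-1%g
  end.

Definition word_inv (w : rword G) : rword G := rev (map letter_inv w).

Definition letter_val (l : rletter G) : G :=
  match l with
  | inl (x, b) => if b then x^-1%g else x
  | inr h => h
  end.

Definition word_val (w : rword G) : G := (\prod_(l <- w) letter_val l)%g.

Definition in_alphabet (l : rletter G) : Prop :=
  match l with
  | inl (x, _) => X x
  | inr h => H h
  end.

Definition rword_over (w : rword G) : Prop := forall l, l \in w -> in_alphabet l.

(* Words over the alphabet (X u X^-1) u (H \ {1}) *)
Definition reduced_letters (w : rword G) : Prop :=
  rword_over w /\ (inr 1%g : rletter G) \notin w.

Inductive free_product_eq : rword G -> rword G -> Prop :=
| fpe_refl u : free_product_eq u u
| fpe_sym u v : free_product_eq u v -> free_product_eq v u
| fpe_trans u v w :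
    free_product_eq u v -> free_product_eq v w -> free_product_eq u w
| fpe_cat u u' v v' : free_product_eq u u' -> free_product_eq v v' ->
    free_product_eq (u ++ v) (u' ++ v')
| fpe_cancel x b : X x ->
    free_product_eq [:: inl (x, b); inl (x, ~~ b)] [::]
| fpe_mul h k : H h -> H k ->
    free_product_eq [:: inr h; inr k] [:: inr (h * k)%g]
| fpe_one : free_product_eq [:: inr 1%g] [::].

(* Products of [n] conjugates of relators or inverses of relators *)
Inductive relator_product (Rel : set (rword G)) : nat -> rword G -> Prop :=
| rp_nil : relator_product Rel 0 [::]
| rp_cons n f r w : rword_over f -> Rel r \/ Rel (word_inv r) ->
    relator_product Rel n w ->
    relator_product Rel n.+1 (word_inv f ++ r ++ f ++ w).

Definition rel_area_le (Rel : set (rword G)) (w : rword G) (n : nat) : Prop :=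
  exists k u, [/\ (k <= n)%N, relator_product Rel k u & free_product_eq w u].

End RelativePresentations.

(* [G] has a finite presentation relative to [H] whose relative Dehn function
   is bounded by a linear function. That the normal closure of the relators is
   the whole kernel of F(X) * H -> G is part of the last clause. *)
Definition hyperbolic_relative_to (G : groupType) (H : set G) : Prop :=
  exists (X : set G) (Rel : set (rword G)) (c : nat),
    [/\ finite_set X, finite_set Rel, generates (X `|` H),
        forall r, Rel r -> rword_over X H r /\ word_val r = 1%g &
        forall w, reduced_letters X H w -> word_val w = 1%g ->
          rel_area_le X H Rel w (c * size w)].

(** ** Semidirect products *)

Record group_action (Q N : groupType) := GroupAction {
  gact :> Q -> N -> N;
  gactM : forall q, {morph gact q : x y / (x * y)%g};
  gact1 : forall x, gact 1%g x = x;
  gactA : forall p q x, gact (p * q)%g x = gact p (gact q x)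
}.

Definition sdprod (Q N : groupType) (sigma : group_action Q N) : Type :=
  (N * Q)%type.

Section SemidirectProduct.
Variables (Q N : groupType) (sigma : group_action Q N).
Local Notation G := (sdprod sigma).

HB.instance Definition _ := Choice.copy G (N * Q)%type.

Definition sd_one : G := (1%g, 1%g).
Definition sd_mul (g h : G) : G := ((g.1 * sigma g.2 h.1)%g, (g.2 * h.2)%g).
Definition sd_inv (g : G) : G := (sigma g.2^-1%g g.1^-1%g, g.2^-1%g).

Lemma gact_one q : sigma q 1%g = 1%g.
Proof. by apply: (@mulgI _ (sigma q 1%g)); rewrite -gactM !mulg1. Qed.

Lemma sd_mulA : associative sd_mul.
Proof.
move=> [n p] [m q] [k r]; rewrite /sd_mul /=.
by rewrite gactM gactA !mulgA.
Qed.

Lemma sd_mul1 : left_id sd_one sd_mul.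
Proof. by move=> [n p]; rewrite /sd_mul /= gact1 !mul1g. Qed.

Lemma sd_mulr1 : right_id sd_one sd_mul.
Proof. by move=> [n p]; rewrite /sd_mul /= gact_one !mulg1. Qed.

Lemma sd_mulV : left_inverse sd_one sd_inv sd_mul.
Proof. by move=> [n p]; rewrite /sd_mul /sd_inv /= -gactM !mulVg gact_one. Qed.

Lemma sd_mulrV : right_inverse sd_one sd_inv sd_mul.
Proof.
by move=> [n p]; rewrite /sd_mul /sd_inv /= -gactA !mulgV gact1 mulgV.
Qed.

HB.instance Definition _ := isGroup.Build G
  sd_mulA sd_mul1 sd_mulr1 sd_mulV sd_mulrV.

(* The subgroup N x| K of N x| Q, for a subgroup K of Q *)
Definition sd_over (K : set Q) : set G := [set g | K g.2].

Definition sd_complement : set G := [set g | g.1 = 1%g].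

Definition is_automorphism (alpha : N -> N) : Prop :=
  {morph alpha : x y / (x * y)%g} /\ bijective alpha.

Definition out_injective : Prop :=
  forall q : Q, (exists n : N, forall x, sigma q x = (x ^ n)%g) -> q = 1%g.

(* The automorphisms sigma_q followed by an inner one form a subgroup of finite
   index in Aut(N). *)
Definition out_finite_index : Prop :=
  exists s : seq (N -> N), (forall beta, beta \in s -> is_automorphism beta) /\
    forall alpha, is_automorphism alpha -> exists2 beta, beta \in s &
      exists (q : Q) (n : N), forall x, alpha x = (sigma q (beta x) ^ n)%g.

End SemidirectProduct.

Arguments sd_over {Q N} sigma K.
Arguments sd_complement {Q N} sigma.
Arguments out_injective {Q N} sigma.
Arguments out_finite_index {Q N} sigma.

(** * Hilbert spaces and bounded operators *)

Section Hilbert.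
Variable R : realType.

Definition dot_norm (V : lmodType R[i]) (dot : {dot V for conjC}) (v : V) : R :=
  Num.sqrt (complex.Re (dot v v)).

Record hilbert := Hilbert {
  hspace :> lmodType R[i];
  hdot : {dot hspace for conjC};
  hcomplete : forall u : nat -> hspace,
    (forall eps : R, 0 < eps -> exists N, forall m n, (N <= m)%N -> (N <= n)%N ->
       dot_norm hdot (u m - u n) < eps) ->
    exists l, forall eps : R, 0 < eps -> exists N, forall n, (N <= n)%N ->
       dot_norm hdot (u n - l) < eps
}.

Definition hnorm (H : hilbert) (v : H) : R := dot_norm (hdot H) v.

Section Operators.
Variable H : hilbert.
Implicit Types (A D : set (H -> H)) (S T : H -> H).

Definition bounded_op T : Prop :=
  linear T /\ exists c : R, forall v, hnorm (T v) <= c * hnorm v.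

Definition is_adjoint T S : Prop :=
  forall u v, hdot H (T u) v = hdot H u (S v).

Definition commutant A : set (H -> H) :=
  [set T | bounded_op T /\ forall S, A S -> T \o S = S \o T].

Definition von_neumann_algebra A : Prop :=
  [/\ A `<=` bounded_op,
      forall T S, A T -> bounded_op S -> is_adjoint T S -> A S &
      commutant (commutant A) = A].

(* [N] is a maximal von Neumann subalgebra of [M]. *)
Definition maximal_vn_subalgebra (N M : set (H -> H)) : Prop :=
  [/\ von_neumann_algebra N, von_neumann_algebra M, N `<=` M &
      ~ exists P, [/\ von_neumann_algebra P, N `<` P & P `<` M]].

(* The order of [R[i]] makes [op_le T T'] say that T' - T is positive. *)
Definition op_le T T' : Prop := forall v, hdot H (T v) v <= hdot H (T' v) v.

Definition op_lub A D T : Prop :=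
  [/\ A T, forall S, D S -> op_le S T &
      forall T', A T' -> (forall S, D S -> op_le S T') -> op_le T T'].

Definition op_directed D : Prop :=
  D !=set0 /\ forall S T, D S -> D T -> exists2 T', D T' & op_le S T' /\ op_le T T'.

End Operators.

(** ** Property (T) *)

Definition unitary_rep (G : groupType) (H : hilbert) (pi : G -> H -> H) : Prop :=
  [/\ forall g, linear (pi g), forall v, pi 1%g v = v,
      forall g h v, pi (g * h)%g v = pi g (pi h v) &
      forall g u v, hdot H (pi g u) (pi g v) = hdot H u v].

Definition property_T_group (G : groupType) : Prop :=
  exists (F : set G) (eps : R), [/\ finite_set F, 0 < eps &
    forall (H : hilbert) (pi : G -> H -> H) (xi : H), unitary_rep pi ->
      hnorm xi = 1 -> (forall g, F g -> hnorm (pi g xi - xi) < eps) ->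
      exists2 eta : H, eta <> 0 & forall g, pi g eta = eta].

(* Both left and right actions of a von Neumann algebra are described by
   unital, *-preserving, normal linear maps into the bounded operators; normal
   maps are those preserving suprema of directed sets of self-adjoint
   elements. *)
Definition normal_star_map (H K : hilbert) (M : set (H -> H))
    (pi : (H -> H) -> (K -> K)) : Prop :=
  [/\ forall x, M x -> bounded_op (pi x),
      forall a x y, M x -> M y ->
        pi (fun v => a *: x v + y v) = (fun w => a *: pi x w + pi y w),
      pi id = id,
      forall x y, M x -> M y -> is_adjoint x y -> is_adjoint (pi x) (pi y) &
      forall (D : set (H -> H)) x, D `<=` M -> (forall y, D y -> is_adjoint y y) ->
        op_directed D -> op_lub M D x ->
        op_lub (@bounded_op K) (pi @` D) (pi x)].

Definition correspondence (H K : hilbert) (M : set (H -> H))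
    (l r : (H -> H) -> (K -> K)) : Prop :=
  [/\ normal_star_map M l, normal_star_map M r,
      forall x y, M x -> M y -> l (x \o y) = l x \o l y,
      forall x y, M x -> M y -> r (x \o y) = r y \o r x &
      forall x y, M x -> M y -> l x \o r y = r y \o l x].

(* Connes and Jones' property (T), in its form for II_1 factors: a
   correspondence with an almost central unit vector has a nonzero central
   vector. *)
Definition property_T_vn (H : hilbert) (M : set (H -> H)) : Prop :=
  exists (F : set (H -> H)) (eps : R), [/\ finite_set F, F `<=` M, 0 < eps &
    forall (K : hilbert) (l r : (H -> H) -> (K -> K)) (xi : K),
      correspondence M l r -> hnorm xi = 1 ->
      (forall x, F x -> hnorm (l x xi - r x xi) < eps) ->
      exists2 eta : K, eta <> 0 & forall x, M x -> l x eta = r x eta].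

(** * The classes Rip(Q) and Rip_T(Q) *)

(* The semidirect product of [N] by [Q] along [sigma] is in Rip(Q). *)
Definition rip (Q N : groupType) (sigma : group_action Q N) : Prop :=
  [/\ exists (Gamma : groupType) (f : {multiplicative Gamma -> N}),
        [/\ torsion_free Gamma, ~ elementary Gamma, hyperbolic R Gamma,
            property_T_group Gamma & range f = setT],
      sd_complement sigma <> setT /\ hyperbolic_relative_to (sd_complement sigma),
      torsion_free (sdprod sigma) &
      out_injective sigma /\ out_finite_index sigma].

Definition rip_T (Q N : groupType) (sigma : group_action Q N) : Prop :=
  rip sigma /\ property_T_group Q.

End Hilbert.

(** * The Hilbert space of square-summable functions *)

Section RealSum.
Variables (R : realType) (T : choiceType).
Implicit Types (a b p q : T -> R) (c : R).

Definition psum p : R := fine (\esum_(x in [set: T]) (p x)%:E).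

(* [rsum] is the unordered sum of an absolutely summable real family. *)
Definition rsummable a := (\esum_(x in [set: T]) `|a x|%:E < +oo)%E.

Definition rsum a : R :=
  psum (fun x => maxr (a x) 0) - psum (fun x => maxr (- a x) 0).

Lemma esum_le_seq p (M : R) : (forall s : seq T, uniq s -> \sum_(x <- s) p x <= M) ->
  (\esum_(x in [set: T]) (p x)%:E <= M%:E)%E.
Proof.
move=> H; apply: ge_ereal_sup => _ [A [fA _] <-].
by rewrite fsbig_finite//= sumEFin lee_fin H.
Qed.

Lemma esum_ge_seq p (s : seq T) : uniq s ->
  ((\sum_(x <- s) p x)%:E <= \esum_(x in [set: T]) (p x)%:E)%E.
Proof.
move=> us; apply: ereal_sup_ubound; exists [set` s] => //=.
by rewrite -sumEFin (fsbig_seq _ _ us); apply: eq_fsbigr.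
Qed.

Lemma esum_finP p : (forall x, 0 <= p x) ->
  (\esum_(x in [set: T]) (p x)%:E < +oo)%E ->
  \esum_(x in [set: T]) (p x)%:E = (psum p)%:E.
Proof.
move=> p0 ps; rewrite /psum fineK// ge0_fin_numE//.
by apply: esum_ge0 => x _; rewrite lee_fin.
Qed.

Lemma rsummable_le a b : (forall x, `|a x| <= `|b x|) -> rsummable b -> rsummable a.
Proof. by move=> ab; apply: le_lt_trans; apply: le_esum => x _; rewrite lee_fin. Qed.

Lemma rsummableD a b : rsummable a -> rsummable b -> rsummable (fun x => a x + b x).
Proof.
move=> sa sb; apply: le_lt_trans (lte_add_pinfty sa sb).
rewrite -esumD//; try by move=> x _; rewrite lee_fin.
by apply: le_esum => x _; rewrite -EFinD lee_fin ler_normD.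
Qed.

Lemma rsummableN a : rsummable a -> rsummable (fun x => - a x).
Proof. by apply: rsummable_le => x; rewrite normrN. Qed.

Lemma rsummable_pos p : (forall x, 0 <= p x) -> rsummable p ->
  \esum_(x in [set: T]) (p x)%:E = (psum p)%:E.
Proof.
move=> p0 ps; apply: esum_finP => //; apply: le_lt_trans ps.
by apply: le_esum => x _; rewrite lee_fin ler_norm.
Qed.

Lemma psumD p q : (forall x, 0 <= p x) -> (forall x, 0 <= q x) ->
  rsummable p -> rsummable q -> psum (fun x => p x + q x) = psum p + psum q.
Proof.
move=> p0 q0 ps qs; apply: EFin_inj.
rewrite EFinD -!rsummable_pos//; first last.
- exact: rsummableD.
- by move=> x; rewrite addr_ge0.
by rewrite -esumD//; move=> x _; rewrite lee_fin.
Qed.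

Lemma psumZ_le c p : 0 <= c -> (forall x, 0 <= p x) -> rsummable p ->
  (\esum_(x in [set: T]) (c * p x)%:E <= (c * psum p)%:E)%E.
Proof.
move=> c0 p0 ps; apply: esum_le_seq => s us; rewrite -mulr_sumr ler_wpM2l//.
by rewrite -lee_fin -rsummable_pos// esum_ge_seq.
Qed.

Lemma rsummableZ c a : rsummable a -> rsummable (fun x => c * a x).
Proof.
move=> sa; rewrite /rsummable; under eq_esum do rewrite normrM.
have sa' : rsummable (fun x => `|a x|) by apply: rsummable_le sa => x; rewrite normr_id.
by apply: le_lt_trans (psumZ_le (normr_ge0 c) _ sa') _; rewrite ?ltry.
Qed.

Lemma psumZ c p : 0 <= c -> (forall x, 0 <= p x) -> rsummable p ->
  psum (fun x => c * p x) = c * psum p.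
Proof.
move=> c0 p0 ps; apply/eqP; rewrite eq_le -!lee_fin.
have cp0 x : 0 <= c * p x by rewrite mulr_ge0.
have cps := rsummableZ c ps.
rewrite -rsummable_pos// psumZ_le//=.
move: c0; rewrite le_eqVlt => /predU1P[c0|c0].
  by rewrite -c0 mul0r; apply: esum_ge0 => x _; rewrite lee_fin mul0r.
rewrite rsummable_pos// lee_fin -ler_pdivlMl// -lee_fin.
apply: le_trans (psumZ_le _ _ cps) => //; last by rewrite invr_ge0 ltW.
by rewrite -rsummable_pos//; apply: le_esum => x _; rewrite mulKf ?gt_eqF.
Qed.

Lemma psum_ge0 p : (forall x, 0 <= p x) -> 0 <= psum p.
Proof. by move=> p0; apply: fine_ge0; apply: esum_ge0 => x _; rewrite lee_fin. Qed.

Lemma psum_ge_seq p s : (forall x, 0 <= p x) -> rsummable p -> uniq s ->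
  \sum_(x <- s) p x <= psum p.
Proof. by move=> p0 ps us; rewrite -lee_fin -rsummable_pos// esum_ge_seq. Qed.

Let pos a x := maxr (a x) 0.
Let pos_ge0 a x : 0 <= pos a x. Proof. by rewrite le_max lexx orbT. Qed.
Let pos_le a x : pos a x <= `|a x|.
Proof. by rewrite ge_max ler_norm normr_ge0. Qed.
Let pos_s a : rsummable a -> rsummable (pos a).
Proof. by move=> sa; apply: le_lt_trans sa; apply: le_esum => x _; rewrite lee_fin ger0_norm. Qed.
Let pos_sub a x : pos a x - pos (fun x => - a x) x = a x.
Proof. rewrite /pos; case: (leP (a x) 0) => ax; case: (leP (- a x) 0) => bx; lra. Qed.

Lemma rsumB p q : (forall x, 0 <= p x) -> (forall x, 0 <= q x) ->
  rsummable p -> rsummable q -> rsum (fun x => p x - q x) = psum p - psum q.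
Proof.
move=> p0 q0 ps qs; rewrite /rsum.
have sd : rsummable (fun x => p x - q x) by apply: rsummableD => //; exact: rsummableN.
set d := fun x => p x - q x.
suff : psum (pos d) + psum q = psum p + psum (pos (fun x => - d x)).
  by rewrite -/(pos d) -/(pos (fun x => - d x)) => h; lra.
rewrite -!psumD//; try by apply: pos_s => //; exact: rsummableN.
congr psum; apply/funext => x; have := pos_sub d x; rewrite {3}/d; lra.
Qed.

Lemma rsum_pos p : (forall x, 0 <= p x) -> rsummable p -> rsum p = psum p.
Proof.
move=> p0 ps.
have s0 : rsummable (fun _ : T => 0).
  by apply: rsummable_le ps => x; rewrite normr0.
have := rsumB p0 (fun _ => lexx 0) ps s0; under eq_fun do rewrite subr0.
have -> : psum (fun _ => 0) = 0 by rewrite /psum esum1.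
by rewrite subr0.
Qed.

Lemma rsumE a : rsummable a -> exists p q, [/\ (forall x, 0 <= p x),
  (forall x, 0 <= q x), rsummable p, rsummable q & a = (fun x => p x - q x)].
Proof.
move=> sa; exists (pos a), (pos (fun x => - a x)); split => //.
- exact: pos_s.
- by apply: pos_s; exact: rsummableN.
- by apply/funext => x; rewrite pos_sub.
Qed.

Lemma rsumD a b : rsummable a -> rsummable b ->
  rsum (fun x => a x + b x) = rsum a + rsum b.
Proof.
move=> /rsumE[p [q [p0 q0 ps qs ->]]] /rsumE[p' [q' [p'0 q'0 p's q's ->]]].
rewrite !rsumB//.
have -> : (fun x => p x - q x + (p' x - q' x)) =
  (fun x => (p x + p' x) - (q x + q' x)) by apply/funext => x; lra.
rewrite rsumB; try by (move=> x; rewrite addr_ge0) || exact: rsummableD.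
by rewrite !psumD//; lra.
Qed.

Lemma rsumN a : rsummable a -> rsum (fun x => - a x) = - rsum a.
Proof.
move=> /rsumE[p [q [p0 q0 ps qs ->]]].
have -> : (fun x => - (p x - q x)) = (fun x => q x - p x) by apply/funext => x; lra.
by rewrite !rsumB//; lra.
Qed.

Lemma rsumZ c a : rsummable a -> rsum (fun x => c * a x) = c * rsum a.
Proof.
wlog c0 : c / 0 <= c => [hw sa|].
  case: (leP 0 c) => [/hw->//|c0].
  have -> : (fun x => c * a x) = (fun x => - (- c * a x)) by apply/funext => x; lra.
  rewrite rsumN; last exact: rsummableZ.
  by rewrite hw//; lra.
move=> /rsumE[p [q [p0 q0 ps qs ->]]].
have -> : (fun x => c * (p x - q x)) = (fun x => c * p x - c * q x) by apply/funext => x; lra.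
rewrite !rsumB//; try by (move=> x; rewrite mulr_ge0) || exact: rsummableZ.
by rewrite !psumZ//; lra.
Qed.

End RealSum.

Section CSum.
Variable (R : realType).
Local Notation C := R[i].
Local Notation Re := complex.Re.
Local Notation Im := complex.Im.

Definition normsq (z : C) : R := Re z ^+ 2 + Im z ^+ 2.

Lemma normsq_ge0 z : 0 <= normsq z. Proof. by rewrite addr_ge0 ?sqr_ge0. Qed.

Section S.
Variable T : choiceType.

Definition csummable (z : T -> C) :=
  rsummable (fun x => Re (z x)) /\ rsummable (fun x => Im (z x)).

Definition csum (z : T -> C) : C :=
  (rsum (fun x => Re (z x)) +i* rsum (fun x => Im (z x)))%C.

Lemma csumD z w : csummable z -> csummable w ->
  csum (fun x => z x + w x) = csum z + csum w.
Proof.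
move=> [z1 z2] [w1 w2]; rewrite /csum.
rewrite (_ : (fun x => Re (z x + w x)) = (fun x => Re (z x) + Re (w x))); last first.
  by apply/funext => x; case: (z x) (w x) => [? ?] [? ?].
rewrite (_ : (fun x => Im (z x + w x)) = (fun x => Im (z x) + Im (w x))); last first.
  by apply/funext => x; case: (z x) (w x) => [? ?] [? ?].
by rewrite !rsumD.
Qed.

Lemma csumZ a z : csummable z -> csum (fun x => a * z x) = a * csum z.
Proof.
move=> [z1 z2]; case: a => a b; rewrite /csum.
rewrite (_ : (fun x => Re ((a +i* b)%C * z x)) =
   (fun x => a * Re (z x) + - b * Im (z x))); last first.
  by apply/funext => x; case: (z x) => [? ?] /=; rewrite mulNr.
rewrite (_ : (fun x => Im ((a +i* b)%C * z x)) =
   (fun x => a * Im (z x) + b * Re (z x))); last first.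
  by apply/funext => x; case: (z x) => [? ?] /=.
rewrite !rsumD ?rsumZ //; try exact: rsummableZ.
by rewrite mulNr; simpc.
Qed.

Lemma csum_conj z : csummable z -> csum (fun x => (z x)^*%C) = (csum z)^*%C.
Proof.
move=> [z1 z2]; rewrite /csum /=; congr (_ +i* _)%C.
  by congr rsum; apply/funext => x; case: (z x).
by rewrite -rsumN//; congr rsum; apply/funext => x; case: (z x).
Qed.
End S.

Section Ell2.
Variable G : choiceType.

Definition ell2_pred : {pred (G -> C)} :=
  mem [set f : G -> C | rsummable (fun x => normsq (f x))].

Record ell2 := Ell2 { ell2_fun :> G -> C; _ : ell2_fun \in ell2_pred }.

HB.instance Definition _ := [isSub for ell2_fun].
HB.instance Definition _ := [Choice of ell2 by <:].

Lemma ell2_submod_closed : submod_closed ell2_pred.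
Proof.
split.
  rewrite inE /= /rsummable esum1 ?ltry// => x _.
  by rewrite /normsq /= expr0n/= addr0 normr0.
move=> a f g; rewrite !inE /= => sf sg.
have := rsummableD (rsummableZ (2 * normsq a) sf) (rsummableZ 2 sg).
apply: rsummable_le => x; rewrite (ger0_norm (normsq_ge0 _)) [leRHS]ger0_norm; last first.
  apply: addr_ge0; apply: mulr_ge0; rewrite ?normsq_ge0//.
  by apply: mulr_ge0; rewrite ?normsq_ge0.
rewrite (_ : (a *: f + g) x = a * f x + g x)//.
case: a (f x) (g x) => [a b] [c d] [e h]; rewrite /normsq /=.
have := sqr_ge0 (a * c - b * d - e); have := sqr_ge0 (a * d + b * c - h); nra.
Qed.

HB.instance Definition _ := GRing.isSubmodClosed.Build _ _ ell2_pred
  ell2_submod_closed.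
HB.instance Definition _ := [SubChoice_isSubLmodule of ell2 by <:].

Lemma ell2_dot_summable (f g : ell2) : csummable (fun x => f x * conjC (g x)).
Proof.
have /[!inE]/= sf := valP f; have /[!inE]/= sg := valP g.
have s := rsummableD sf sg.
split; apply: rsummable_le s => x.
  rewrite [leRHS]ger0_norm; last by apply: addr_ge0; exact: normsq_ge0.
  rewrite /normsq ler_norml; case: (f x) (g x) => [a b] [c d] /=.
  have := sqr_ge0 (a - c); have := sqr_ge0 (b - d).
  have := sqr_ge0 (a + c); have := sqr_ge0 (b + d).
  by move=> *; apply/andP; split; nra.
rewrite [leRHS]ger0_norm; last by apply: addr_ge0; exact: normsq_ge0.
rewrite /normsq ler_norml; case: (f x) (g x) => [a b] [c d] /=.
have := sqr_ge0 (a - d); have := sqr_ge0 (b - c).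
have := sqr_ge0 (a + d); have := sqr_ge0 (b + c).
by move=> *; apply/andP; split; nra.
Qed.

Definition ell2_dot (f g : ell2) : C := csum (fun x => f x * conjC (g x)).

Lemma ell2_dotC f g : ell2_dot f g = (-1) ^+ false * conjC (ell2_dot g f).
Proof.
rewrite expr0 mul1r /ell2_dot -[conjC _]/(conjc _) -csum_conj; last exact: ell2_dot_summable.
congr csum; apply/funext => x /=; case: (f x) (g x) => [a b] [c d] /=; simpc.
by congr (_ +i* _)%C; ring.
Qed.

Lemma ell2_dotDl f f' g : ell2_dot (f + f') g = ell2_dot f g + ell2_dot f' g.
Proof.
rewrite /ell2_dot -csumD; try exact: ell2_dot_summable.
by congr csum; apply/funext => x; rewrite mulrDl.
Qed.

Lemma ell2_dotZl a f g : ell2_dot (a *: f) g = a * ell2_dot f g.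
Proof.
rewrite /ell2_dot -csumZ; try exact: ell2_dot_summable.
by congr csum; apply/funext => x; rewrite mulrA.
Qed.

Lemma ell2_zmodl g : zmod_morphism (ell2_dot ^~ g).
Proof.
by move=> f f'; rewrite -scaleN1r ell2_dotDl ell2_dotZl mulN1r.
Qed.

Lemma ell2_zmodr f : zmod_morphism (ell2_dot f).
Proof.
move=> g g'; rewrite ![ell2_dot f _]ell2_dotC !expr0 !mul1r.
by rewrite ell2_zmodl rmorphB.
Qed.

Lemma ell2_scalel g : scalable_for *%R (ell2_dot ^~ g).
Proof. by move=> a f; rewrite ell2_dotZl. Qed.

Lemma ell2_scaler f : scalable_for (conjC \; *%R) (ell2_dot f).
Proof.
by move=> a g; rewrite ![ell2_dot f _]ell2_dotC ell2_dotZl !expr0 !mul1r rmorphM.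
Qed.

HB.instance Definition _ := isBilinear.Build C ell2 ell2 C *%R (conjC \; *%R) ell2_dot
  ell2_zmodl ell2_zmodr ell2_scalel ell2_scaler.
HB.instance Definition _ := isHermitianSesquilinear.Build C ell2 false conjC ell2_dot
  ell2_dotC.

Lemma ell2_normE f : ell2_dot f f = (psum (fun x => normsq (f x)))%:C%C.
Proof.
have /[!inE]/= sf := valP f.
rewrite /ell2_dot /csum; congr (_ +i* _)%C.
  rewrite -rsum_pos//; last by move=> x; exact: normsq_ge0.
  congr rsum; apply/funext => x; rewrite /normsq; case: (f x) => a b /=.
  by ring.
rewrite (_ : (fun _ => _) = (fun _ => 0)).
  by rewrite rsum_pos// ?/psum ?/rsummable ?esum1// => x _; rewrite normr0.
by apply/funext => x; case: (f x) => a b /=; ring.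
Qed.

Lemma ell2_dot_gt0 f : f != 0 -> 0 < ell2_dot f f.
Proof.
move=> f0; rewrite ell2_normE ltcR.
have [x fx] : exists x, f x != 0.
  apply: contrapT => /forallNP h; move/eqP: f0; apply; apply: val_inj.
  by apply/funext => x; apply/eqP/negPn/negP; exact: h.
have /[!inE]/= sf := valP f.
apply: lt_le_trans (@psum_ge_seq _ _ _ [:: x] _ sf _) => //; last first.
  by move=> y; exact: normsq_ge0.
rewrite big_seq1 lt_neqAle normsq_ge0 andbT eq_sym.
apply: contra fx; rewrite /normsq; case: (f x) => a b /=.
by rewrite paddr_eq0 ?sqr_ge0// !sqrf_eq0 eq_complex.
Qed.

HB.instance Definition _ := isDotProduct.Build C ell2 ell2_dot ell2_dot_gt0.

Let nrm (f : ell2) := Num.sqrt (complex.Re (ell2_dot f f)).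

Lemma ell2_nrm_lt f eps : nrm f < eps -> psum (fun x => normsq (f x)) <= eps ^+ 2.
Proof.
have p0 : 0 <= psum (fun x => normsq (f x)) by apply: psum_ge0 => x; exact: normsq_ge0.
rewrite /nrm ell2_normE /= => h.
by rewrite -[leLHS]sqr_sqrtr// ler_sqr ?nnegrE ?sqrtr_ge0 ?ltW// (le_lt_trans _ h) ?sqrtr_ge0.
Qed.

Lemma cvg_real_cauchy (a : nat -> R) :
  (forall eps, 0 < eps -> exists N, forall n, (N <= n)%N -> `|a N - a n| < eps) ->
  exists l : R, a n @[n --> \oo] --> l.
Proof.
move=> H; apply/cvg_ex; apply/cauchy_cvgP; apply: cauchy_exP => eps /H[N hN].
exists (a N); exists N => // n /= Nn; rewrite /ball /=; exact: hN.
Qed.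

Lemma cvg_seq_sum (s : seq G) (a : G -> nat -> R) (l : G -> R) :
  (forall x, a x n @[n --> \oo] --> l x) ->
  (\sum_(x <- s) a x n) @[n --> \oo] --> \sum_(x <- s) l x.
Proof.
move=> H; elim: s => [|x s IH].
  rewrite big_nil; under eq_fun do rewrite big_nil; exact: cvg_cst.
rewrite big_cons; under eq_fun do rewrite big_cons; exact: cvgD.
Qed.

Lemma ell2_complete (u : nat -> ell2) :
  (forall eps : R, 0 < eps -> exists N, forall m n, (N <= m)%N -> (N <= n)%N ->
     nrm (u m - u n) < eps) ->
  exists l, forall eps : R, 0 < eps -> exists N, forall n, (N <= n)%N ->
     nrm (u n - l) < eps.
Proof.
move=> H.
have Hx x eps : 0 < eps -> exists N, forall m n, (N <= m)%N -> (N <= n)%N ->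
    normsq (u m x - u n x) < eps ^+ 2.
  move=> e0; have e2 : 0 < eps / 2 by lra.
  have [N hN] := H _ e2; exists N => m n Nm Nn.
  have h1 := ell2_nrm_lt (hN m n Nm Nn).
  have /[!inE]/= sf := valP (u m - u n).
  have h2 : normsq (u m x - u n x) <= psum (fun y => normsq ((u m - u n) y)).
    by have := @psum_ge_seq _ _ _ [:: x] (fun y => normsq_ge0 _) sf isT; rewrite big_seq1.
  by have := le_trans h2 h1; nra.
have sqle (a e : R) : 0 < e -> a ^+ 2 < e ^+ 2 -> `|a| < e.
  by move=> e0 ae; rewrite ltr_norml; apply/andP; split; nra.
have HR x : exists a : R, complex.Re (u n x) @[n --> \oo] --> a.
  apply: cvg_real_cauchy => eps e0; have [N hN] := Hx x _ e0; exists N => n Nn.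
  have := hN N n (leqnn _) Nn; rewrite /normsq.
  case: (u N x) (u n x) => [a b] [c d] /= h; apply: sqle => //.
  by have := sqr_ge0 (b - d); lra.
have HI x : exists a : R, complex.Im (u n x) @[n --> \oo] --> a.
  apply: cvg_real_cauchy => eps e0; have [N hN] := Hx x _ e0; exists N => n Nn.
  have := hN N n (leqnn _) Nn; rewrite /normsq.
  case: (u N x) (u n x) => [a b] [c d] /= h; apply: sqle => //.
  by have := sqr_ge0 (a - c); lra.
pose l x : C := (sval (cid (HR x)) +i* sval (cid (HI x)))%C.
have cvl n x : normsq (u n x - u m x) @[m --> \oo] --> normsq (u n x - l x).
  have -> : (fun m => normsq (u n x - u m x)) = (fun m =>
     (complex.Re (u n x) - complex.Re (u m x)) * (complex.Re (u n x) - complex.Re (u m x))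
   + (complex.Im (u n x) - complex.Im (u m x)) * (complex.Im (u n x) - complex.Im (u m x))).
    by apply/funext => m; rewrite /normsq; case: (u n x) (u m x) => [? ?] [? ?].
  have -> : normsq (u n x - l x) =
     (complex.Re (u n x) - complex.Re (l x)) * (complex.Re (u n x) - complex.Re (l x))
   + (complex.Im (u n x) - complex.Im (l x)) * (complex.Im (u n x) - complex.Im (l x)).
    by rewrite /normsq; case: (u n x) (l x) => [? ?] [? ?].
  have r : (complex.Re (u n x) - complex.Re (u m x)) @[m --> \oo] -->
           (complex.Re (u n x) - complex.Re (l x)).
    by apply: cvgB; [exact: cvg_cst|exact: (svalP (cid (HR x)))].
  have i : (complex.Im (u n x) - complex.Im (u m x)) @[m --> \oo] -->
           (complex.Im (u n x) - complex.Im (l x)).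
    by apply: cvgB; [exact: cvg_cst|exact: (svalP (cid (HI x)))].
  by apply: cvgD; apply: cvgM.
have bnd eps : 0 < eps -> exists N, forall n, (N <= n)%N -> forall s : seq G, uniq s ->
    \sum_(x <- s) normsq (u n x - l x) <= eps ^+ 2.
  move=> e0; have [N hN] := H _ e0; exists N => n Nn s us.
  have c := @cvg_seq_sum s (fun x m => normsq (u n x - u m x))
    (fun x => normsq (u n x - l x)) (cvl n).
  apply: (cvgr_to_le c); exists N => // m /= Nm.
  have /[!inE]/= sf := valP (u n - u m).
  apply: le_trans (ell2_nrm_lt (hN n m Nn Nm)).
  exact: (@psum_ge_seq _ _ _ s (fun y => normsq_ge0 _) sf us).
have bnd2 eps : 0 < eps -> exists N, forall n, (N <= n)%N ->
    (\esum_(x in [set: G]) (normsq (u n x - l x))%:E <= (eps ^+ 2)%:E)%E.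
  by move=> /bnd[N hN]; exists N => n Nn; apply: esum_le_seq; exact: hN.
have lP : l \in ell2_pred.
  have [N hN] := bnd2 1 ltr01.
  have dP : (fun x => u N x - l x) \in ell2_pred.
    rewrite inE /= /rsummable; under eq_esum do rewrite ger0_norm ?normsq_ge0//.
    by apply: le_lt_trans (hN N (leqnn _)) _; rewrite ltry.
  have -> : l = (-1) *: (fun x => u N x - l x : C) + (u N : G -> C).
    apply/funext => x; rewrite (_ : (_ + _) x = (-1) * (u N x - l x) + u N x)//.
    by ring.
  by apply: (ell2_submod_closed.2) => //; exact: valP.
exists (Ell2 lP) => eps e0.
have e2 : 0 < eps / 2 by lra.
have [N hN] := bnd2 _ e2; exists N => n Nn.
rewrite /nrm ell2_normE /=.
apply: (@le_lt_trans _ _ (eps / 2)); last by lra.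
have e20 : eps / 2 = Num.sqrt ((eps / 2) ^+ 2) by rewrite sqrtr_sqr ger0_norm// ltW.
rewrite e20 ler_wsqrtr//.
have /[!inE]/= sf := valP (u n - Ell2 lP).
by rewrite -lee_fin -rsummable_pos ?hN// => x; exact: normsq_ge0.
Qed.

End Ell2.
End CSum.

Section GroupVonNeumannAlgebra.
Variables (R : realType) (G : groupType).

Definition ell2_hilbert : hilbert R :=
  @Hilbert R (ell2 R G) (@ell2_dot R G) (@ell2_complete R G).

Lemma ell2_translate_subproof (g : G) (f : ell2 R G) :
  (fun x => f (g^-1 * x)%g) \in @ell2_pred R G.
Proof.
have /[!inE]/= := valP f; rewrite /rsummable.
rewrite (@reindex_esum R G G setT setT (fun x => (g^-1 * x)%g))//.
split=> [//|x y _ _ /mulgI//|x _]; exists (g * x)%g => //.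
by rewrite mulKg.
Qed.

Definition left_translation (g : G) : ell2_hilbert -> ell2_hilbert :=
  fun f => Ell2 (ell2_translate_subproof g f).

(* For a subgroup [K], this is the copy of L(K) inside L(G); [K = setT] gives
   L(G). *)
Definition group_vn (K : set G) : set (ell2_hilbert -> ell2_hilbert) :=
  commutant (commutant [set left_translation g | g in K]).

End GroupVonNeumannAlgebra.

Arguments group_vn R {G} K.

(* Main.v *)
Require Import Defs.
From HB Require Import structures.
From mathcomp Require Import all_boot all_order all_algebra.
From mathcomp Require Import all_classical all_reals all_analysis.
From mathcomp Require Import complex ring lra zify.

Set Implicit Arguments.
Unset Strict Implicit.
Unset Printing Implicit Defensive.

Import Order.TTheory GRing.Theory Num.Theory Num.Def numFieldNormedType.Exports.
Local Open Scope classical_set_scope.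
Local Open Scope ring_scope.

(* Write G = N x| Q. If A in N commutes with q A q^-1, then [A, q A q^-1] and
   [q, A] (when q A q^-1 = A) give loops of length independent of q in the relative
   Cayley graph, and only one edge labelled by q lies in its coset of Q; the linear
   relative isoperimetric inequality therefore confines q to a finite set. A power
   A of an element with finite N-orbit commutes with all its Q-conjugates, so, Q
   being infinite and acting outerly, every nontrivial element of G has an
   infinite orbit under conjugation by N.

   Hence, for P between L(N x| Qm) and L(G), the projection of delta_g onto the
   closure of P delta_1 is 0 or delta_g, which forces P = L(K) for a subgroup K
   containing N x| Qm; maximality of Qm gives that of L(N x| Qm). Twisting the left
   action on l^2(G) by characters of Qm that tend to 1 gives bimodules over
   L(N x| Qm) with almost central vectors; infinite orbits leave no room for central
   ones. Finally N and Q have property (T), hence G does, and for a bimodule of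
   L(G) the unitaries g |-> l(g) r(g)^-1 produce a vector on which l and r agree on
   G; normality extends this to L(G). *)

(** * Geometry of Hilbert spaces *)

(** Relative hyperbolicity enters only through the linear relative isoperimetric inequality, so the
    geometric step is cohomological. A potential that is 1-Lipschitz along the finitely many
    peripheral letters of the relators has a coboundary that is bounded on every relator; linear
    area then bounds it on every loop by a multiple of the length. A truncated word distance inside
    one coset of Q is such a potential, and it jumps by an arbitrarily large amount along an edge
    labelled by a far away q.

    Subalgebras of L(G) are handled through vectors: an element is determined by its value at
    delta_1, so orthogonal projections in l^2(G) decide membership.

    The obstacle at the end is the passage from G to L(G). Combinations of group elements
    approximate x only at the vector delta_1, without control of operator norms, while normality is
    given only as preservation of suprema of directed sets. The errors are therefore cut off by
    positive contractions b_m increasing to 1, after which they tend to 0 in norm; normality is then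
    applied to the b_m alone. *)

Section HilbertGeometry.
Variables (R : realType) (H : hilbert R).
Implicit Types (u v w : H) (T S : H -> H).
Local Notation C := R[i].
Local Notation Re := complex.Re.
Local Notation Im := complex.Im.

(** Estimates and minimization need the order of R, so they use the real part. Nothing is lost: the
    imaginary part is the real part against ['i *: v], see [hdot_rdot]. *)
Definition rdot u v : R := Re (hdot H u v).

Lemma hdotC u v : hdot H v u = ((hdot H u v)^*)%C.
Proof. by rewrite (hermC (hdot H)) expr0 mul1r. Qed.

Lemma rdotC u v : rdot v u = rdot u v.
Proof. by rewrite /rdot hdotC; case: (hdot H u v). Qed.

Lemma Im_hdotC u v : Im (hdot H v u) = - Im (hdot H u v).
Proof. by rewrite hdotC; case: (hdot H u v). Qed.

Lemma hdotZl a u v : hdot H (a *: u) v = a * hdot H u v.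
Proof. exact: linearZl_LR. Qed.

Lemma hdotZr a u v : hdot H u (a *: v) = (a^*)%C * hdot H u v.
Proof. exact: linearZr_LR. Qed.

Lemma hdotDl u v w : hdot H (u + v) w = hdot H u w + hdot H v w.
Proof. exact: linearDl. Qed.

Lemma hdotDr u v w : hdot H w (u + v) = hdot H w u + hdot H w v.
Proof. exact: linearDr. Qed.

Lemma rdotDl u v w : rdot (u + v) w = rdot u w + rdot v w.
Proof. by rewrite /rdot linearDl raddfD. Qed.

Lemma rdotDr u v w : rdot w (u + v) = rdot w u + rdot w v.
Proof. by rewrite !(rdotC _ w) rdotDl. Qed.

Lemma rdotNl u v : rdot (- u) v = - rdot u v.
Proof. by rewrite /rdot linearNl raddfN. Qed.

Lemma rdotNr u v : rdot u (- v) = - rdot u v.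
Proof. by rewrite !(rdotC _ u) rdotNl. Qed.

Lemma rdotBl u v w : rdot (u - v) w = rdot u w - rdot v w.
Proof. by rewrite rdotDl rdotNl. Qed.

Lemma rdotBr u v w : rdot w (u - v) = rdot w u - rdot w v.
Proof. by rewrite rdotDr rdotNr. Qed.

Lemma rdotZl (a : R) u v : rdot (a%:C%C *: u) v = a * rdot u v.
Proof. by rewrite /rdot hdotZl; case: (hdot H u v) => x y /=; ring. Qed.

Lemma rdotZr (a : R) u v : rdot u (a%:C%C *: v) = a * rdot u v.
Proof. by rewrite !(rdotC _ u) rdotZl. Qed.

Lemma rdot0l u : rdot 0 u = 0. Proof. by rewrite /rdot linear0l. Qed.

Lemma rdot0r u : rdot u 0 = 0. Proof. by rewrite rdotC rdot0l. Qed.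

Lemma rdot_il u v : rdot ('i%C *: u) v = - Im (hdot H u v).
Proof. by rewrite /rdot hdotZl; case: (hdot H u v) => x y /=; ring. Qed.

Lemma rdot_ir u v : rdot u ('i%C *: v) = Im (hdot H u v).
Proof. by rewrite rdotC rdot_il Im_hdotC opprK. Qed.

Lemma hdot_rdot u v : hdot H u v = (rdot u v +i* rdot u ('i%C *: v))%C.
Proof. by rewrite rdot_ir /rdot; case: (hdot H u v). Qed.

Lemma Im_hdot_diag u : Im (hdot H u u) = 0.
Proof. by have := Im_hdotC u u; lra. Qed.

Lemma rdot_ge0 u : 0 <= rdot u u.
Proof.
have : 0 <= hdot H u u by exact: dnorm_ge0.
by rewrite lecE /rdot => /andP[].
Qed.

Lemma rdot_eq0 u : rdot u u = 0 -> u = 0.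
Proof.
move=> h; apply/eqP; rewrite -(dnorm_eq0 (hdot H)) eq_complex.
by rewrite Im_hdot_diag eqxx andbT; apply/eqP.
Qed.

Lemma hnorm_ge0 u : 0 <= hnorm u. Proof. exact: sqrtr_ge0. Qed.

Lemma hnorm_sqr u : hnorm u ^+ 2 = rdot u u.
Proof. by rewrite /hnorm /dot_norm sqr_sqrtr// rdot_ge0. Qed.

Lemma hnorm0 : hnorm (0 : H) = 0.
Proof. by apply/eqP; rewrite -sqrf_eq0 hnorm_sqr rdot0l. Qed.

Lemma hnorm_eq0 u : hnorm u = 0 -> u = 0.
Proof. by move=> h; apply: rdot_eq0; rewrite -hnorm_sqr h expr0n. Qed.

Lemma hnorm_le0 u : hnorm u <= 0 -> u = 0.
Proof. by move=> h; apply: hnorm_eq0; apply/eqP; rewrite eq_le h hnorm_ge0. Qed.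

Lemma hnorm_gt0 u : u <> 0 -> 0 < hnorm u.
Proof. by move=> u0; rewrite ltNge; apply/negP => /hnorm_le0. Qed.

Lemma hnorm_small u : (forall e : R, 0 < e -> hnorm u <= e) -> u = 0.
Proof.
move=> h; apply: hnorm_le0; apply/ler_addgt0Pl => e e0.
by rewrite addr0; exact: h.
Qed.

Lemma le_sqr_norm (a b : R) : 0 <= b -> a ^+ 2 <= b ^+ 2 -> a <= b.
Proof.
move=> b0 h; case: (leP 0 a) => a0; last by rewrite (le_trans (ltW a0)).
by rewrite -ler_sqr ?nnegrE.
Qed.

Lemma hnormN u : hnorm (- u) = hnorm u.
Proof.
by apply/eqP; rewrite -(@eqrXn2 _ 2) ?hnorm_ge0// !hnorm_sqr rdotNl rdotNr opprK.
Qed.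

Lemma hnormB u v : hnorm (u - v) = hnorm (v - u).
Proof. by rewrite -hnormN opprB. Qed.

Lemma normsqM (a b : C) : normsq (a * b) = normsq a * normsq b.
Proof. by case: a b => [a b] [c d]; rewrite /normsq /=; ring. Qed.

Lemma normsq_real (a : R) : normsq a%:C%C = a ^+ 2.
Proof. by rewrite /normsq /= expr0n addr0. Qed.

Lemma hnormZ a u : hnorm (a *: u) = Num.sqrt (normsq a) * hnorm u.
Proof.
apply/eqP; rewrite -(@eqrXn2 _ 2) ?hnorm_ge0 ?mulr_ge0 ?sqrtr_ge0 ?hnorm_ge0//.
rewrite exprMn !hnorm_sqr sqr_sqrtr ?normsq_ge0//; apply/eqP.
rewrite /rdot hdotZl hdotZr; have := Im_hdot_diag u.
by case: a (hdot H u u) => [a b] [c d]; rewrite /normsq /= => ->; ring.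
Qed.

Lemma hnormZr (a : R) u : hnorm (a%:C%C *: u) = `|a| * hnorm u.
Proof. by rewrite hnormZ normsq_real sqrtr_sqr. Qed.

Lemma hnorm_i u : hnorm ('i%C *: u) = hnorm u.
Proof. by rewrite hnormZ /normsq /= expr0n expr1n add0r sqrtr1 mul1r. Qed.

Lemma rdot_le u v : rdot u v <= hnorm u * hnorm v.
Proof.
have [->|v0] := pselect (v = 0); first by rewrite rdot0r hnorm0 mulr0.
apply: le_sqr_norm; first by rewrite mulr_ge0 ?hnorm_ge0.
rewrite exprMn !hnorm_sqr.
have vv : 0 < rdot v v by rewrite -hnorm_sqr exprn_gt0// hnorm_gt0.
set t := rdot u v / rdot v v.
have ht : t * rdot v v = rdot u v by rewrite mulfVK ?gt_eqF.
have := rdot_ge0 (u - t%:C%C *: v).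
rewrite !(rdotBl, rdotBr, rdotZl, rdotZr) (rdotC u v) ht => h.
have -> : rdot u v ^+ 2 = t * rdot u v * rdot v v by rewrite mulrAC ht.
by rewrite ler_pM2r//; lra.
Qed.

Lemma rdot_norm_le u v : `|rdot u v| <= hnorm u * hnorm v.
Proof.
by rewrite ler_norml rdot_le andbT lerNl -rdotNl (le_trans (rdot_le _ _))// hnormN.
Qed.

Lemma hnormD u v : hnorm (u + v) <= hnorm u + hnorm v.
Proof.
apply: le_sqr_norm; first by rewrite addr_ge0 ?hnorm_ge0.
rewrite hnorm_sqr !(rdotDl, rdotDr) (rdotC u v) sqrrD !hnorm_sqr.
by have := rdot_le u v; lra.
Qed.

Lemma hnormBD u v : hnorm (u - v) <= hnorm u + hnorm v.
Proof. by rewrite -(hnormN v) hnormD. Qed.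

Lemma hnorm_tri w u v : hnorm (u - v) <= hnorm (u - w) + hnorm (w - v).
Proof. by rewrite -[u - v](subrKA w) hnormD. Qed.

Lemma rdot_separate u v : (forall w, rdot u w = rdot v w) -> u = v.
Proof.
move=> h; apply/eqP; rewrite -subr_eq0; apply/eqP; apply: rdot_eq0.
by rewrite rdotBl h subrr.
Qed.

(** Replacing u by ['i *: u] turns the identity of real parts into that of imaginary parts. *)
Lemma is_adjointP T S :
  (forall a u, T (a *: u) = a *: T u) ->
  (forall u v, rdot (T u) v = rdot u (S v)) -> is_adjoint T S.
Proof.
move=> TZ h u v; have e : Im (hdot H (T u) v) = Im (hdot H u (S v)).
  by have := h ('i%C *: u) v; rewrite TZ !rdot_il => /oppr_inj.
have := h u v; rewrite /rdot.
by case: (hdot H (T u) v) (hdot H u (S v)) e => [a b] [c d] /= -> ->.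
Qed.

Lemma adjoint_rdot T S : is_adjoint T S -> forall u v, rdot (T u) v = rdot u (S v).
Proof. by move=> h u v; rewrite /rdot h. Qed.

Lemma is_adjoint_sym T S : is_adjoint T S -> is_adjoint S T.
Proof. by move=> h u v; rewrite hdotC -h -hdotC. Qed.

Lemma adjoint_unique T S S' : is_adjoint T S -> is_adjoint T S' -> S = S'.
Proof.
move=> h h'; apply/funext => v; apply: rdot_separate => w.
by rewrite !(rdotC w) -(adjoint_rdot h) (adjoint_rdot h').
Qed.

Lemma selfadj_Im T : is_adjoint T T -> forall v, Im (hdot H (T v) v) = 0.
Proof. by move=> h v; have := Im_hdotC (T v) v; rewrite -h; lra. Qed.

Lemma op_leP T S : op_le T S <-> forall v,
  Im (hdot H (T v) v) = Im (hdot H (S v) v) /\ rdot (T v) v <= rdot (S v) v.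
Proof.
split=> h v; have := h v; rewrite lecE /rdot.
  by move=> /andP[/eqP -> ->].
by move=> [-> ->]; rewrite eqxx.
Qed.

Lemma op_le_rdot T S : op_le T S -> forall v, rdot (T v) v <= rdot (S v) v.
Proof. by move=> /op_leP h v; have [] := h v. Qed.

Lemma op_le_selfadj T S : is_adjoint T T -> is_adjoint S S ->
  (forall v, rdot (T v) v <= rdot (S v) v) -> op_le T S.
Proof. by move=> hT hS h; apply/op_leP => v; rewrite !selfadj_Im. Qed.

Lemma op_le_trans S T S' : op_le T S -> op_le S S' -> op_le T S'.
Proof. by move=> h h' v; exact: le_trans (h v) (h' v). Qed.

Section Linear.
Variable T : H -> H.
Hypothesis linT : linear T.

Lemma linop0 : T 0 = 0.
Proof. by have := linT (-1) 0 0; rewrite scaler0 addr0 scaleN1r addNr. Qed.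

Lemma linopD u v : T (u + v) = T u + T v.
Proof. by have := linT 1 u v; rewrite !scale1r. Qed.

Lemma linopZ a u : T (a *: u) = a *: T u.
Proof. by have := linT a u 0; rewrite linop0 !addr0. Qed.

Lemma linopN u : T (- u) = - T u.
Proof. by rewrite -scaleN1r linopZ scaleN1r. Qed.

Lemma linopB u v : T (u - v) = T u - T v.
Proof. by rewrite linopD linopN. Qed.

End Linear.

Lemma bounded_op_pos T : bounded_op T -> exists2 c : R, 0 < c &
  forall v, hnorm (T v) <= c * hnorm v.
Proof.
move=> [_ [c h]]; exists (`|c| + 1) => [|v].
  by have := normr_ge0 c; lra.
apply: le_trans (h v) _; rewrite ler_wpM2r ?hnorm_ge0//.
by have := ler_norm c; lra.
Qed.

(* With t = 1/c, expand 0 <= <A w, w> for w = v - t A v; this replaces the square root of A. *)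
Lemma positive_op_sqr T (c : R) : linear T -> is_adjoint T T -> 0 < c ->
  (forall v, 0 <= rdot (T v) v) -> (forall v, rdot (T v) v <= c * rdot v v) ->
  forall v, hnorm (T v) ^+ 2 <= c * rdot (T v) v.
Proof.
move=> lT sT c0 T0 Tc v; set t := c^-1.
have := T0 (v - t%:C%C *: T v).
rewrite (linopB lT) (linopZ lT) !(rdotBl, rdotBr, rdotZl, rdotZr).
rewrite -(adjoint_rdot sT) (adjoint_rdot sT (T v) v) hnorm_sqr.
have h := Tc (T v) => h2.
have t0 : 0 < t by rewrite invr_gt0.
have h3 : t * (t * rdot (T (T v)) (T v)) <= t * rdot (T v) (T v).
  by rewrite ler_pM2l// /t ler_pdivrMl.
rewrite -ler_pdivrMl// -/t; move: h2 h3.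
rewrite -(adjoint_rdot sT (T v) v).
lra.
Qed.

End HilbertGeometry.

Definition invS (R : realType) (n : nat) : R := n.+1%:R^-1.

Lemma invS_gt0 (R : realType) n : 0 < invS R n.
Proof. by rewrite invr_gt0. Qed.

Lemma invS_lt (R : realType) (e : R) : 0 < e ->
  exists N, forall n, (N <= n)%N -> invS R n < e.
Proof.
move=> e0; exists (Num.bound e^-1) => n Nn.
rewrite /invS invf_plt ?posrE ?ltr0n//.
have /ltW/archi_boundP h : 0 < e^-1 by rewrite invr_gt0.
by apply: lt_le_trans h _; rewrite ler_nat (leq_trans Nn).
Qed.

Lemma eq_of_small (R : realType) (a b k : R) :
  (forall e, 0 < e -> `|a - b| <= e * k) -> a = b.
Proof.
move=> h; apply/eqP; rewrite -subr_eq0 -normr_le0; apply/ler_addgt0Pl => e e0.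
have k1 : 0 < `|k| + 1 by have := normr_ge0 k; lra.
rewrite addr0; apply: le_trans (h (e / (`|k| + 1)) _) _; first by rewrite divr_gt0.
rewrite mulrAC ler_pdivrMr// ler_pM2l//.
by have := ler_norm k; lra.
Qed.

Lemma le_of_small (R : realType) (a b k : R) :
  (forall e, 0 < e -> a <= b + e * k) -> a <= b.
Proof.
move=> h; apply/ler_addgt0Pl => e e0.
have k1 : 0 < `|k| + 1 by have := normr_ge0 k; lra.
apply: le_trans (h (e / (`|k| + 1)) _) _; first by rewrite divr_gt0.
rewrite addrC lerD2r mulrAC ler_pdivrMr// ler_pM2l//.
by have := ler_norm k; lra.
Qed.

(** * Orthogonal projection onto the closure of a subspace *)

Section Projection.
Variables (R : realType) (H : hilbert R).
Implicit Types (u v w : H) (S : set H).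

Definition subspace S : Prop :=
  S 0 /\ forall a u v, S u -> S v -> S (a *: u + v).

Definition hclosure S : set H :=
  [set v | forall e : R, 0 < e -> exists2 s, S s & hnorm (v - s) < e].

Lemma hclosure_orth S v w : hclosure S v -> (forall s, S s -> hdot H w s = 0) ->
  hdot H w v = 0.
Proof.
move=> Sv h.
have key u : (forall s, S s -> rdot u s = 0) -> rdot u v = 0.
  move=> hu; apply: (@eq_of_small _ _ _ (hnorm u)) => e /Sv[s Ss vs].
  rewrite subr0 -[v](subrK s) rdotDr (hu _ Ss) addr0.
  by rewrite (le_trans (rdot_norm_le _ _))// mulrC ler_wpM2r ?hnorm_ge0 ?ltW.
rewrite hdot_rdot key => [|s Ss]; last by rewrite /rdot h.
rewrite rdot_ir -[complex.Im _]opprK -rdot_il key ?oppr0// => s Ss.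
by rewrite rdot_il h//= oppr0.
Qed.

(** First variation: -2r is the derivative at 0 of the quadratic t^2 k - 2tr, which is nonnegative
    up to arbitrarily small errors. Testing t = r / (k + 1) instead of r / k allows k = 0. *)
Lemma minimizing_orth (d k r : R) : 0 <= k ->
  (forall t e, 0 < e -> 2 * t * r <= e + t ^+ 2 * k) -> r = 0.
Proof.
move=> k0 h; have k1 : 0 < k + 1 by lra.
set t := r / (k + 1); have tk : t * (k + 1) = r by rewrite mulfVK ?gt_eqF.
have : 2 * t * r <= t ^+ 2 * k.
  apply: (@le_of_small _ _ _ 1) => e e0; rewrite mulr1 addrC; exact: h.
rewrite -{1}tk => h2; have : t ^+ 2 * (k + 2) <= 0 by nra.
rewrite pmulr_lle0; last lra.
move=> t2; have /eqP : t ^+ 2 = 0 by apply/eqP; rewrite eq_le t2 sqr_ge0.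
by rewrite sqrf_eq0 => /eqP t0; rewrite -tk t0 mul0r.
Qed.

(** S need not be closed, so a minimizing sequence in S converges only to a point p of its closure.
    Orthogonality of v - p to S comes from varying the members of the sequence, which stay in S. *)
Lemma hprojection S v : subspace S ->
  exists p, hclosure S p /\ forall s, S s -> hdot H (v - p) s = 0.
Proof.
move=> [S0 SD].
pose dist s := rdot (v - s) (v - s).
have hD : has_inf [set dist s | s in S].
  split; first by exists (dist 0), 0.
  by exists 0 => _ [s _ <-]; exact: rdot_ge0.
set d := inf [set dist s | s in S].
have dle s : S s -> d <= dist s.
  by move=> Ss; apply: ge_inf; [exact: hD.2|exists s].
have /choice[s hs] (n : nat) : exists s, S s /\ dist s < d + invS R n.
  have [] := inf_adherent (eps := invS R n) _ hD; first exact: invS_gt0.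
  by move=> _ [s Ss <-] h; exists s.
(* Parallelogram law, with the midpoint of s m and s n again at distance at least d. *)
have near m n : hnorm (s m - s n) ^+ 2 <= 2 * (invS R m + invS R n).
  have [Sm dm] := hs m; have [Sn dn] := hs n.
  have Sb : S ((2^-1)%:C%C *: (s m + s n)).
    rewrite -[_ *: _]addr0; apply: (SD) => //.
    by rewrite -[s m]scale1r; exact: SD.
  have := dle _ Sb; move: dm dn; rewrite hnorm_sqr /dist.
  rewrite !(rdotBl, rdotBr, rdotZl, rdotZr, rdotDl, rdotDr).
  rewrite !(rdotC v (s _)) (rdotC (s m) (s n)).
  lra.
have cau (e : R) : 0 < e -> exists N, forall m n, (N <= m)%N -> (N <= n)%N ->
    dot_norm (hdot H) (s m - s n) < e.
  move=> e0; have [N hN] := invS_lt (e := e ^+ 2 / 4) ltac:(nra).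
  exists N => m n Nm Nn; rewrite -/(hnorm _).
  rewrite -ltr_sqr ?nnegrE ?hnorm_ge0 ?ltW//; apply: le_lt_trans (near m n) _.
  have := hN m Nm; have := hN n Nn; lra.
have [p hp] := hcomplete cau.
have pS : hclosure S p.
  move=> e /hp[N hN]; exists (s N); first exact: (hs N).1.
  by rewrite hnormB; exact: hN.
exists p; split=> // w Sw.
have orth u : S u -> rdot (v - p) u = 0.
  move=> Su; apply: (@minimizing_orth d (rdot u u)); first exact: rdot_ge0.
  move=> t e e0.
  have [N1 hN1] := invS_lt (e := e / 2) ltac:(lra).
  have k0 : 0 < 2 * `|t| * hnorm u + 1.
    by have := mulr_ge0 (normr_ge0 t) (hnorm_ge0 u); lra.
  have e2 : 0 < e / 2 / (2 * `|t| * hnorm u + 1) by rewrite !divr_gt0.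
  have [N2 hN2] := hp _ e2.
  set n := maxn N1 N2; have n1 := hN1 n (leq_maxl _ _); have n2 := hN2 n (leq_maxr _ _).
  have [Sn dn] := hs n.
  have : S (t%:C%C *: u + s n) by exact: SD.
  move=> /dle; move: dn; rewrite /dist.
  rewrite !(rdotBl, rdotBr, rdotZl, rdotZr, rdotDl, rdotDr).
  rewrite !(rdotC v _) (rdotC (s n) u) => h1 h2.
  have h3 : 2 * t * (rdot (s n) u - rdot p u) <= e / 2.
    rewrite -rdotBl; apply: le_trans (ler_norm _) _; rewrite !normrM (@ger0_norm _ 2)//.
    have h4 := rdot_norm_le (s n - p) u.
    have h5 : 2 * `|t| * `|rdot (s n - p) u| <= (2 * `|t| * hnorm u) * hnorm (s n - p).
      rewrite -!mulrA ler_pM2l// ler_wpM2l// mulrC; move: h4; rewrite mulrC; exact.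
    apply: le_trans h5 _; move: n2; rewrite -/(hnorm _) ltr_pdivlMr// => h6.
    by apply: ltW; apply: le_lt_trans h6; rewrite mulrC ler_wpM2l ?hnorm_ge0//; lra.
  lra.
rewrite hdot_rdot !orth//.
by have := SD 'i%C w 0 Sw S0; rewrite addr0.
Qed.

Lemma projection_unique (v p p' : H) :
  rdot (v - p) (p - p') = 0 -> rdot (v - p') (p - p') = 0 -> p = p'.
Proof.
move=> h h'; apply/eqP; rewrite -subr_eq0; apply/eqP; apply: rdot_eq0.
have := h'; rewrite -[v - p'](subrKA p) rdotDl h add0r; exact.
Qed.

Lemma hclosureB S u v : subspace S -> hclosure S u -> hclosure S v -> hclosure S (u - v).
Proof.
move=> sS uS vS e e0; have e2 : 0 < e / 2 by lra.
have [s Ss us] := uS _ e2; have [t St vt] := vS _ e2.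
exists (s - t); first by rewrite -scaleN1r addrC; exact: sS.2.
have -> : u - v - (s - t) = (u - s) - (v - t).
  by rewrite !opprB addrACA [RHS]addrACA (addrC (- v)).
by apply: le_lt_trans (hnormBD _ _) _; lra.
Qed.

End Projection.

(** * Monotone limits and inverses of positive operators *)

Section OperatorLimits.
Variables (R : realType) (H : hilbert R).
Implicit Types (u v w : H) (S T X Y B : H -> H) (D : set (H -> H)).

(** The set D is its own index set: this is convergence along the net of its elements, ordered by
    [op_le]. *)
Definition strong_limit D X : Prop :=
  forall v (e : R), 0 < e -> exists2 S, D S &
    forall S', D S' -> op_le S S' -> hnorm (S' v - X v) < e.

Lemma selfadjB S T : is_adjoint S S -> is_adjoint T T ->
  is_adjoint (fun v => S v - T v) (fun v => S v - T v).
Proof. by move=> hS hT u v; rewrite linearBl linearBr /= hS hT. Qed.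

Lemma linearopB S T : linear S -> linear T -> linear (fun v => S v - T v).
Proof.
move=> lS lT a u v; rewrite lS lT scalerBr opprD addrACA; congr (_ + _).
Qed.

(** Vigier's theorem. Above a fixed S0 all differences S' - S lie between 0 and T - S0, hence below
    one constant c, and [positive_op_sqr] bounds the norm of (S' - S) v by the increment of the
    quadratic form at v. That form is monotone and bounded, so S v is Cauchy along D. *)
Lemma monotone_limit D T : (forall S, D S -> bounded_op S) ->
  (forall S, D S -> is_adjoint S S) -> op_directed D -> bounded_op T ->
  (forall S, D S -> op_le S T) ->
  exists X, [/\ bounded_op X, is_adjoint X X, forall S, D S -> op_le S X,
    forall T', (forall S, D S -> op_le S T') -> op_le X T' & strong_limit D X].
Proof.
move=> bD sD [[S0 DS0] dirD] bT DT.
have [c1 c10 h1] := bounded_op_pos bT.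
have [c2 c20 h2] := bounded_op_pos (bD _ DS0).
pose c := c1 + c2; have c0 : 0 < c by rewrite addr_gt0.
have incr S S' v : D S -> D S' -> op_le S0 S -> op_le S S' ->
    hnorm (S' v - S v) ^+ 2 <= c * (rdot (S' v) v - rdot (S v) v).
  move=> DS DS' S0S SS'; rewrite -rdotBl.
  apply: (@positive_op_sqr _ _ (fun v => S' v - S v)) => //.
  - by apply: linearopB; [case: (bD _ DS')|case: (bD _ DS)].
  - by apply: selfadjB; exact: sD.
  - by move=> u; rewrite rdotBl subr_ge0; exact: op_le_rdot.
  move=> u; rewrite rdotBl.
  have a1 := op_le_rdot S0S u; have a2 := op_le_rdot (DT _ DS') u.
  have a3 : rdot (T u) u <= c1 * rdot u u.
    apply: le_trans (rdot_le _ _) _; rewrite -hnorm_sqr expr2 mulrA.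
    by rewrite ler_wpM2r ?hnorm_ge0.
  have a4 : - rdot (S0 u) u <= c2 * rdot u u.
    rewrite -rdotNl; apply: le_trans (rdot_le _ _) _.
    by rewrite hnormN -hnorm_sqr expr2 mulrA ler_wpM2r ?hnorm_ge0.
  by rewrite /c; lra.
have bound S v : D S -> op_le S0 S -> hnorm (S v - S0 v) <= c * hnorm v.
  move=> DS S0S; have h := incr S0 S v DS0 DS (fun _ => lexx _) S0S.
  have := rdot_le (S v - S0 v) v; rewrite rdotBl => h3.
  have [->|n0] := pselect (S v - S0 v = 0); first by rewrite hnorm0 mulr_ge0 ?hnorm_ge0 ?ltW.
  have n1 := hnorm_gt0 n0.
  rewrite -(ler_pM2l n1) -expr2 (le_trans h)// mulrCA ler_pM2l//.
have upper S : D S -> exists2 S', D S' & op_le S S' /\ op_le S0 S'.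
  by move=> DS; exact: dirD.
have lim v : exists l, forall e : R, 0 < e -> exists2 S, D S & op_le S0 S /\
    forall S', D S' -> op_le S S' -> hnorm (S' v - l) < e.
  have hs : has_sup [set rdot (S v) v | S in D].
    split; first by exists (rdot (S0 v) v), S0.
    by exists (rdot (T v) v) => _ [S DS <-]; exact: op_le_rdot (DT _ DS) v.
  set m := sup [set rdot (S v) v | S in D].
  have /choice[s Hs] (n : nat) : exists S, [/\ D S, op_le S0 S &
      m - invS R n < rdot (S v) v].
    have [|_ [S DS <-] h] := sup_adherent (eps := invS R n) _ hs; first exact: invS_gt0.
    have [S' DS' [SS' S0S']] := upper S DS.
    by exists S'; split=> //; exact: lt_le_trans h (op_le_rdot SS' v).
  have close (e : R) : 0 < e -> exists N, forall n S', (N <= n)%N -> D S' ->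
      op_le (s n) S' -> hnorm (S' v - s n v) < e.
    move=> e0; have [N hN] := invS_lt (e := e ^+ 2 / c) ltac:(by rewrite divr_gt0// exprn_gt0).
    exists N => n S' Nn DS' le; have [Dn S0n mn] := Hs n.
    rewrite -ltr_sqr ?nnegrE ?hnorm_ge0 ?ltW//.
    apply: le_lt_trans (incr _ _ v Dn DS' S0n le) _.
    have h3 : rdot (S' v) v <= m by apply: ub_le_sup; [exact: hs.2|exists S'].
    have := hN n Nn; rewrite ltr_pdivlMr// mulrC; apply: le_lt_trans.
    by rewrite ler_pM2l//; lra.
  have [|l hl] := @hcomplete _ H (s^~ v).
    move=> e e0; have [N hN] := close (e / 2) ltac:(lra); exists N => i j Ni Nj.
    have [Di _ _] := Hs i; have [Dj _ _] := Hs j.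
    have [S' DS' [iS jS]] := dirD _ _ Di Dj.
    rewrite -/(hnorm _); apply: le_lt_trans (hnorm_tri (S' v) _ _) _.
    have := hN i S' Ni DS' iS; have := hN j S' Nj DS' jS.
    by rewrite (hnormB (s i v)); lra.
  exists l => e e0.
  have [N hN] := close (e / 2) ltac:(lra); have [N' hN'] := hl (e / 2) ltac:(lra).
  set n := maxn N N'; have [Dn S0n _] := Hs n.
  exists (s n) => //; split=> // S' DS' le.
  apply: le_lt_trans (hnorm_tri (s n v) _ _) _.
  have := hN n S' (leq_maxl _ _) DS' le; have := hN' n (leq_maxr _ _).
  by rewrite -/(hnorm _); lra.
have /choice[X hX] := lim.
have near2 u v (e : R) : 0 < e -> exists2 S, D S & op_le S0 S /\ forall S', D S' -> op_le S S' ->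
    hnorm (S' u - X u) < e /\ hnorm (S' v - X v) < e.
  move=> e0; have [Sa Da [lo1 h3]] := hX u e e0; have [Sb Db [lo2 h4]] := hX v e e0.
  have [Sc Dc [lo3 lo4]] := dirD _ _ Da Db; exists Sc => //.
  split; first exact: op_le_trans lo1 lo3.
  move=> S' DS' lo; split; [apply: h3 => //|apply: h4 => //].
    exact: op_le_trans lo3 lo.
  exact: op_le_trans lo4 lo.
have linX : linear X.
  move=> a u v; apply/eqP; rewrite -subr_eq0; apply/eqP; apply: hnorm_small => e e0.
  set k := Num.sqrt (normsq a); have k0 : 0 <= k by exact: sqrtr_ge0.
  have e1 : 0 < e / (k + 2) by rewrite divr_gt0//; lra.
  have [Sa Da [lo1 hS1]] := near2 u v _ e1.
  have [Sb Db [lo2 hS2]] := hX (a *: u + v) _ e1.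
  have [S' D' [lo3 lo4]] := dirD _ _ Da Db.
  have [h3 h4] := hS1 _ D' lo3; have h5 := hS2 _ D' lo4.
  have [lS' _] := bD _ D'.
  have -> : X (a *: u + v) - (a *: X u + X v) =
     (X (a *: u + v) - S' (a *: u + v)) + (a *: (S' u - X u) + (S' v - X v)).
    by rewrite lS' scalerBr [X in _ = _ + X]addrACA -opprD [RHS]addrA subrK.
  apply: le_trans (hnormD _ _) _; rewrite (hnormB (X _)).
  have h6 := hnormD (a *: (S' u - X u)) (S' v - X v).
  rewrite hnormZ -/k in h6.
  have h7 : k * hnorm (S' u - X u) <= k * (e / (k + 2)) by rewrite ler_wpM2l// ltW.
  have -> : e = k * (e / (k + 2)) + e / (k + 2) + e / (k + 2) by field; rewrite gt_eqF//; lra.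
  by lra.
have bX : bounded_op X.
  split=> //; exists (c + c2) => v; apply: (@le_of_small _ _ _ 1) => e e0.
  have [S DS [lo h3]] := hX v e e0.
  have h4 := h3 S DS (fun _ => lexx _).
  have h5 := bound S v DS lo; have h6 := h2 v.
  have := hnorm_tri (S v) (X v) 0; rewrite !subr0.
  have := hnorm_tri (S0 v) (S v) 0; rewrite !subr0.
  by rewrite (hnormB (X v)); lra.
have sX : is_adjoint X X.
  apply: is_adjointP => [|u v]; first exact: linopZ.
  apply: (@eq_of_small _ _ _ (hnorm v + hnorm u)) => e e0.
  have [S DS [lo h3]] := near2 u v e e0; have [h4 h5] := h3 S DS (fun _ => lexx _).
  have -> : rdot (X u) v - rdot u (X v) =
      rdot (X u - S u) v + rdot u (S v - X v).
    by rewrite rdotBl rdotBr (adjoint_rdot (sD _ DS)); ring.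
  apply: le_trans (ler_normD _ _) _; rewrite mulrDr; apply: lerD.
    apply: le_trans (rdot_norm_le _ _) _; rewrite hnormB ler_wpM2r ?hnorm_ge0//.
    exact: ltW.
  apply: le_trans (rdot_norm_le _ _) _; rewrite mulrC ler_wpM2r ?hnorm_ge0//.
  exact: ltW.
have approx v (e : R) S : D S -> 0 < e -> exists S', [/\ D S', op_le S S' &
    `|rdot (S' v) v - rdot (X v) v| <= e * hnorm v].
  move=> DS e0; have [Sa Da [lo h3]] := hX v e e0.
  have [S' D' [lo1 lo2]] := dirD _ _ DS Da; exists S'; split=> //.
  rewrite -rdotBl; apply: le_trans (rdot_norm_le _ _) _.
  by rewrite ler_wpM2r ?hnorm_ge0// ltW// h3.
exists X; split=> //.
- move=> S DS; apply: op_le_selfadj => // [|v]; first exact: sD.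
  apply: (@le_of_small _ _ _ (hnorm v)) => e e0.
  have [S' [D' lo]] := approx v e S DS e0.
  have := op_le_rdot lo v; rewrite ler_norml => h3 /andP[h4 h5]; lra.
- move=> T' hT'; apply/op_leP => v; split.
    by have /op_leP/(_ v)[<- _] := hT' _ DS0; rewrite !selfadj_Im//; exact: sD.
  apply: (@le_of_small _ _ _ (hnorm v)) => e e0.
  have [S' [D' lo]] := approx v e S0 DS0 e0.
  have := op_le_rdot (hT' _ D') v; rewrite ler_norml => h3 /andP[h4 h5]; lra.
move=> v e e0; have [S DS [_ h]] := hX v e e0.
by exists S.
Qed.

Lemma strong_limit_commute D X B : op_directed D -> strong_limit D X ->
  bounded_op B -> (forall S, D S -> B \o S = S \o B) -> B \o X = X \o B.
Proof.
move=> [_ dirD] hX bB hB; have [c c0 hc] := bounded_op_pos bB.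
apply/funext => v /=; apply/eqP; rewrite -subr_eq0; apply/eqP.
apply: hnorm_small => e e0.
have e1 : 0 < e / (c + 1) by rewrite divr_gt0//; lra.
have [Sa Da h1] := hX v _ e1; have [Sb Db h2] := hX (B v) _ e1.
have [S DS [lo1 lo2]] := dirD _ _ Da Db.
have h3 := h1 _ DS lo1; have h4 := h2 _ DS lo2.
apply: le_trans (hnorm_tri (B (S v)) _ _) _.
rewrite -(linopB bB.1) -[B (S v)]/((B \o S) v) hB//=.
have := hc (X v - S v); rewrite (hnormB (X v)) => h5.
have h6 : c * hnorm (S v - X v) <= c * (e / (c + 1)) by rewrite ler_pM2l// ltW.
have -> : e = c * (e / (c + 1)) + e / (c + 1) by field; rewrite gt_eqF//; lra.
by lra.
Qed.

(** 1 + Y does not decrease norms, so it is injective and preimages of a convergent sequence are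
    Cauchy. Its range is dense: a vector w orthogonal to the range is orthogonal to w + Y w, which
    forces w = 0. *)
Lemma inverse_one_plus Y : bounded_op Y -> is_adjoint Y Y ->
  (forall v, 0 <= rdot (Y v) v) ->
  exists B, [/\ bounded_op B, is_adjoint B B, forall v, B v + Y (B v) = v &
    forall v, B (v + Y v) = v].
Proof.
move=> bY sY Y0; have [c c0 hc] := bounded_op_pos bY; have [lY _] := bY.
pose A v := v + Y v.
have lA : linear A by move=> a u v; rewrite /A lY scalerDr addrACA.
have Ale v : hnorm v <= hnorm (A v).
  have [->|v0] := pselect (v = 0); first by rewrite hnorm0 hnorm_ge0.
  have n1 := hnorm_gt0 v0.
  rewrite -(ler_pM2r n1) -expr2 hnorm_sqr (le_trans _ (rdot_le _ _))//.
  by rewrite /A rdotDl lerDl.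
have Ainj u v : A u = A v -> u = v.
  move=> e; apply/eqP; rewrite -subr_eq0; apply/eqP; apply: hnorm_le0.
  by rewrite (le_trans (Ale _))// (linopB lA) e subrr hnorm0.
have surj v : exists u, A u = v.
  have sS : subspace (range A).
    split; first by exists 0 => //; exact: (linop0 lA).
    by move=> a _ _ [u _ <-] [w _ <-]; exists (a *: u + w) => //; exact: lA.
  have [p [pS hp]] := hprojection v sS.
  have w0 : v - p = 0.
    apply: rdot_eq0; have : rdot (v - p) (A (v - p)) = 0.
      by rewrite /rdot hp//; exists (v - p).
    rewrite /A rdotDr (rdotC (Y _)).
    by have := Y0 (v - p); have := rdot_ge0 (v - p); lra.
  have {hp}vS : hclosure (range A) v.
    by move/eqP: w0; rewrite subr_eq0 => /eqP ->.
  have /choice[u hu] (n : nat) : exists u, hnorm (v - A u) < invS R n.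
    by have [|_ [u _ <-] h] := vS (invS R n); [exact: invS_gt0|exists u].
  have [|l hl] := @hcomplete _ H u.
    move=> e e0; have [N hN] := invS_lt (e := e / 2) ltac:(lra).
    exists N => m n Nm Nn; rewrite -/(hnorm _).
    apply: le_lt_trans (Ale _) _; rewrite (linopB lA).
    apply: le_lt_trans (hnorm_tri v _ _) _; rewrite (hnormB _ v).
    have := hu m; have := hu n; have := hN m Nm; have := hN n Nn; lra.
  exists l; apply/eqP; rewrite -subr_eq0; apply/eqP; apply: hnorm_small => e e0.
  have [N hN] := invS_lt (e := e / 2) ltac:(lra).
  have e1 : 0 < e / 2 / (1 + c) by rewrite !divr_gt0//; lra.
  have [N' hN'] := hl _ e1; set n := maxn N N'.
  have h3 := hN n (leq_maxl _ _); have h4 := hN' n (leq_maxr _ _).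
  have h5 := hu n; rewrite -/(hnorm _) in h4.
  apply: le_trans (hnorm_tri (A (u n)) _ _) _.
  rewrite (hnormB _ v) -(linopB lA).
  have h6 : hnorm (A (l - u n)) <= (1 + c) * hnorm (l - u n).
    by have := hnormD (l - u n) (Y (l - u n)); have := hc (l - u n); rewrite /A; lra.
  rewrite (hnormB l) in h6; move: h4; rewrite ltr_pdivlMr; lra.
have /choice[B hB] := surj.
have lB : linear B by move=> a u v; apply: Ainj; rewrite hB lA !hB.
have BA v : B (A v) = v by apply: Ainj; rewrite hB.
exists B; split=> //.
  by split=> //; exists 1 => v; rewrite mul1r -{2}(hB v) Ale.
apply: is_adjointP => [|u v]; first exact: linopZ.
by rewrite -{1}(hB v) -{2}(hB u) /A rdotDl rdotDr (adjoint_rdot sY).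
Qed.

End OperatorLimits.

(** * Finite conjugation orbits in relatively hyperbolic semidirect products *)

Section Cochain.
Variables (G : groupType) (psi : G -> int).
Implicit Types (g x : G) (l : rletter G) (u v w : rword G).

Definition letter_cochain g l : int :=
  match l with inl _ => 0 | inr h => psi (g * h)%g - psi g end.

(* The 1-cochain of the relative Cayley graph that is the coboundary of psi on
   the edges labelled by the peripheral subgroup and zero on the other edges *)
Fixpoint cochain g w : int :=
  if w is l :: w' then letter_cochain g l + cochain (g * letter_val l)%g w' else 0.

Lemma word_val_cons l w : word_val (l :: w) = (letter_val l * word_val w)%g.
Proof. by rewrite /word_val big_cons. Qed.

Lemma word_val_nil : word_val ([::] : rword G) = 1%g.
Proof. by rewrite /word_val big_nil. Qed.

Lemma word_val_cat u v : word_val (u ++ v) = (word_val u * word_val v)%g.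
Proof. by rewrite /word_val big_cat. Qed.

Lemma cochain_cat g u v :
  cochain g (u ++ v) = cochain g u + cochain (g * word_val u)%g v.
Proof.
elim: u g => [|l u IH] g /=; first by rewrite word_val_nil mulg1 add0r.
by rewrite IH word_val_cons mulgA addrA.
Qed.

Lemma letter_val_inv l : letter_val (letter_inv l) = (letter_val l)^-1%g.
Proof. by case: l => [[x []]|h] //=; rewrite invgK. Qed.

Lemma word_inv_cons l w : word_inv (l :: w) = word_inv w ++ [:: letter_inv l].
Proof. by rewrite /word_inv /= rev_cons cats1. Qed.

Lemma word_val_inv w : word_val (word_inv w) = (word_val w)^-1%g.
Proof.
elim: w => [|l w IH]; first by rewrite word_val_nil invg1.
rewrite word_inv_cons word_val_cat IH !word_val_cons word_val_nil mulg1.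
by rewrite letter_val_inv invgM.
Qed.

Lemma word_invK : involutive (@word_inv G).
Proof.
move=> w; rewrite /word_inv map_rev revK -map_comp map_id_in// => l _ /=.
by case: l => [[x b]|h] /=; rewrite ?negbK ?invgK.
Qed.

Lemma letter_cochain_inv g l :
  letter_cochain g (letter_inv l) = - letter_cochain (g * (letter_val l)^-1)%g l.
Proof. by case: l => [[x b]|h] /=; rewrite ?oppr0// mulgVK opprB. Qed.

Lemma cochain_inv g w :
  cochain g (word_inv w) = - cochain (g * (word_val w)^-1)%g w.
Proof.
elim: w g => [|l w IH] g /=; first by rewrite oppr0.
rewrite word_inv_cons cochain_cat IH /= addr0 word_val_inv letter_cochain_inv.
by rewrite word_val_cons invgM mulgA mulgVK opprD addrC.
Qed.

Lemma free_product_eq_val (X H : set G) u v :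
  free_product_eq X H u v -> word_val u = word_val v.
Proof.
elim=> {u v} [u|u v _ ->|u v w _ -> _ ->|u u' v v' _ e _ e'|x b _|h k _ _|] //.
- by rewrite !word_val_cat e e'.
- rewrite !word_val_cons word_val_nil mulg1.
  by case: b => /=; rewrite ?mulgV ?mulVg.
- by rewrite !word_val_cons word_val_nil /= !mulg1.
by rewrite word_val_cons word_val_nil mulg1.
Qed.

Lemma free_product_eq_cochain (X H : set G) u v :
  free_product_eq X H u v -> forall g, cochain g u = cochain g v.
Proof.
elim=> {u v} [u|u v _ IH|u v w _ IH _ IH'|u u' v v' e IH _ IH'|x b _|h k _ _|] g //.
- by rewrite IH.
- by rewrite !cochain_cat IH IH' (free_product_eq_val e).
- by rewrite /= !addr0 mulgA; ring.
by rewrite /= mulg1 subrr.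
Qed.

(** A relator is a loop, so the conjugating words [word_inv f] and f run over the same edges in
    opposite directions and cancel. Each factor contributes only the cochain of its relator, read
    from some base point. *)
Lemma relator_product_cochain (X H : set G) (Rel : set (rword G)) (M : nat) :
  (forall r, Rel r -> word_val r = 1%g) ->
  (forall r g, Rel r -> `|cochain g r| <= M%:Z) ->
  forall n w, relator_product X H Rel n w ->
  forall g, `|cochain g w| <= (n * M)%:Z.
Proof.
move=> Rel1 RelM n w; elim=> {n w} [|n f r w _ Rr _ IH] g; first by rewrite normr0.
have [r1 rM] : word_val r = 1%g /\ forall x, `|cochain x r| <= M%:Z.
  case: Rr => Rr; first by split=> [|x]; [exact: Rel1|exact: RelM].
  rewrite -(word_invK r) word_val_inv (Rel1 _ Rr) invg1; split=> // x.
  by rewrite cochain_inv normrN; exact: RelM.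
rewrite !cochain_cat cochain_inv word_val_inv r1 mulg1 mulgVK.
rewrite [X in - _ + X]addrCA addKr.
apply: le_trans (ler_normD _ _) _; rewrite mulSn PoszD; exact: lerD.
Qed.

Lemma cochain_le_size g w :
  (forall x l, l \in w -> `|letter_cochain x l| <= 1) ->
  `|cochain g w| <= (size w)%:Z.
Proof.
elim: w g => [|l w IH] g h; first by rewrite normr0.
rewrite /= -addn1 addnC PoszD; apply: le_trans (ler_normD _ _) _.
apply: lerD; first by apply: h; rewrite mem_head.
by apply: IH => x l' l'w; apply: h; rewrite inE l'w orbT.
Qed.

End Cochain.

Definition peripheral_letters (G : groupType) (w : rword G) : seq G :=
  pmap (fun l : rletter G => if l is inr h then Some h else None) w.

Lemma mem_peripheral_letters (G : groupType) (w : rword G) h :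
  (h \in peripheral_letters w) = ((inr h : rletter G) \in w).
Proof.
rewrite /peripheral_letters; elim: w => [//|[x|k] w IH] //=.
by rewrite !inE IH.
Qed.

Lemma letter_cochain_le1 (G : groupType) (psi : G -> int) (Om : seq G) (w : rword G) :
  (forall x o, o \in Om -> `|psi (x * o)%g - psi x| <= 1) ->
  {subset peripheral_letters w <= Om} ->
  forall x l, l \in w -> `|letter_cochain psi x l| <= 1.
Proof.
move=> hpsi sub x [l|h] lw /=; first by rewrite normr0.
by apply: hpsi; apply: sub; rewrite mem_peripheral_letters.
Qed.

(** Om collects the peripheral letters of the relators, which are finitely many. The potential has
    to be Lipschitz only along Om, whereas the loop w may use arbitrary peripheral letters; this
    freedom is what later isolates the letter q. The new constant is the Dehn constant times the
    maximal relator length. *)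
Lemma hyperbolic_relative_cochain (G : groupType) (H : set G) :
  hyperbolic_relative_to H -> exists (X : set G) (Om : seq G) (c : nat),
  [/\ generates (X `|` H), forall o, o \in Om -> H o &
   forall psi : G -> int, (forall x o, o \in Om -> `|psi (x * o)%g - psi x| <= 1) ->
   forall w, reduced_letters X H w -> word_val w = 1%g ->
     `|cochain psi 1%g w| <= (c * size w)%:Z].
Proof.
move=> [X [Rel [c [_ /finite_seqP[rs Rel_rs] gX Rel1 area]]]].
pose Om := flatten [seq peripheral_letters r | r <- rs].
pose M := \max_(r <- rs) size r.
exists X, Om, (c * M)%N; split=> //.
  move=> o /flattenP[_ /mapP[r rrs ->]]; rewrite mem_peripheral_letters => ro.
  have [|rX _] := Rel1 r; first by rewrite Rel_rs.
  exact: (rX _ ro).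
move=> psi hpsi w rw w1; have [k [u [kw ru wu]]] := area w rw w1.
have := relator_product_cochain (psi := psi) (M := M) _ _ ru 1%g.
rewrite (free_product_eq_cochain _ wu) => h.
have h2 : `|cochain psi 1%g u| <= (k * M)%:Z.
  apply: h => [r /Rel1[]//|r g Rr].
  have rrs : r \in rs by rewrite Rel_rs in Rr.
  have h3 : `|cochain psi g r| <= (size r)%:Z.
    apply: cochain_le_size; apply: letter_cochain_le1 hpsi _ => o oro.
    by apply/flattenP; exists (peripheral_letters r) => //; exact: map_f.
  apply: le_trans h3 _; rewrite lez_nat /M.
  exact: (leq_bigmax_seq (F := size)) rrs isT.
apply: le_trans h2 _; rewrite lez_nat mulnAC leq_mul//.
Qed.

(** * Truncated word distance in a peripheral coset *)

Section BallDistance.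
Variables (G : groupType) (Om : seq G) (a : G).

Fixpoint coset_ball (j : nat) : seq G :=
  if j is j'.+1 then
    coset_ball j' ++ [seq (x * o)%g | x <- coset_ball j', o <- Om]
  else [:: a].

(** [find] returns the length T of the list when no ball contains x. So this is the distance from a
    truncated at T, and unreachable points, such as those of other cosets, also get the value T. *)
Definition ball_dist (T : nat) (x : G) : nat :=
  find (fun j => x \in coset_ball j) (iota 0 T).

Lemma ball_dist_le T x : (ball_dist T x <= T)%N.
Proof. by rewrite /ball_dist -[leqRHS](size_iota 0) find_size. Qed.

Lemma ball_dist_ltP T x : (ball_dist T x < T)%N ->
  x \in coset_ball (ball_dist T x).
Proof.
move=> h; have : has (fun j => x \in coset_ball j) (iota 0 T).
  by rewrite has_find size_iota.
by move=> /(nth_find 0%N); rewrite nth_iota.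
Qed.

Lemma ball_dist_min T x j : x \in coset_ball j -> (ball_dist T x <= j)%N.
Proof.
move=> xj; rewrite leqNgt; apply/negP => h.
have jT : (j < T)%N by exact: leq_trans h (ball_dist_le _ _).
by have := before_find 0%N h; rewrite nth_iota// xj.
Qed.

Lemma ball_dist_base T : ball_dist T a = 0%N.
Proof.
by apply/eqP; rewrite -leqn0; apply: ball_dist_min; rewrite inE.
Qed.

Lemma ball_dist_far T x : (forall j, (j < T)%N -> x \notin coset_ball j) ->
  ball_dist T x = T.
Proof.
move=> h; apply/eqP; rewrite eqn_leq ball_dist_le leqNgt; apply/negP => lt.
by have := h _ lt; rewrite ball_dist_ltP.
Qed.

Lemma ball_dist_step T x o : o \in Om -> (ball_dist T (x * o)%g <= (ball_dist T x).+1)%N.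
Proof.
move=> oOm; case: (ltnP (ball_dist T x) T) => h; last first.
  by rewrite (leq_trans (ball_dist_le _ _))// ltnW.
apply: ball_dist_min; rewrite /= mem_cat; apply/orP; right.
by apply: allpairs_f => //; exact: ball_dist_ltP.
Qed.

Lemma ball_dist_lipschitz T : (forall o, o \in Om -> (o^-1)%g \in Om) ->
  forall x o, o \in Om ->
  `|(ball_dist T (x * o)%g)%:Z - (ball_dist T x)%:Z| <= 1.
Proof.
move=> symOm x o oOm; have h1 := ball_dist_step T x oOm.
have := ball_dist_step T (x * o)%g (symOm _ oOm).
by rewrite mulgK => h2; lia.
Qed.

Lemma coset_ball_sub (P : G -> Prop) : P a ->
  (forall x o, o \in Om -> P x -> P (x * o)%g) -> forall j x, x \in coset_ball j -> P x.
Proof.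
move=> Pa Po; elim=> [|j IH] x /=; first by rewrite inE => /eqP ->.
rewrite mem_cat => /orP[/IH//|/allpairsP[[y o] /= [yj oOm ->]]].
by apply: Po => //; exact: IH.
Qed.

End BallDistance.

Definition infinite_type (T : eqType) : Prop := forall s : seq T, exists x, x \notin s.

Lemma nonelementary_infinite (G : groupType) : ~ elementary G -> infinite_type G.
Proof.
move=> nel s; apply: contrapT => /forallNP h; apply: nel.
exists 1%g, s => x; exists x; last by exists 0%N; left; rewrite mulVg.
by apply/negPn/negP; exact: h.
Qed.

Lemma generates_word (G : groupType) (X H : set G) : generates (X `|` H) ->
  forall g, (forall h, H h -> H h^-1%g) ->
  exists2 w : rword G, reduced_letters X H w & word_val w = g.
Proof.
move=> gX g Hinv; have [n [w [_ + ->]]] := gX g.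
elim: w {n} => [|x w IH] hw; first by exists [::]; rewrite ?word_val_nil ?big_nil.
have [w' [w'X w'1] vw'] := IH (fun s sw => hw s (mem_behead (s := x :: w) sw)).
rewrite big_cons -vw'.
have add l : in_alphabet X H l -> l != inr 1%g -> letter_val l = x ->
    exists2 w0 : rword G, reduced_letters X H w0 & word_val w0 = (x * word_val w')%g.
  move=> lX l1 <-; exists (l :: w'); last exact: word_val_cons.
  split=> [l'|]; first by rewrite inE => /predU1P[->//|/w'X].
  by rewrite inE negb_or eq_sym l1.
have addH : H x -> exists2 w0 : rword G, reduced_letters X H w0 & word_val w0 = (x * word_val w')%g.
  move=> Hx; have [->|x1] := eqVneq x 1%g; first by exists w'; rewrite ?mul1g.
  exact: (add (inr x)).
case: (hw x (mem_head _ _)) => -[Xx|Hx].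
- exact: (add (inl (x, false))).
- exact: addH.
- by apply: (add (inl (x^-1%g, true))) => //=; rewrite invgK.
by apply: addH; rewrite -[x]invgK; exact: Hinv.
Qed.

Lemma reduced_letters_inv (G : groupType) (X H : set G) (w : rword G) :
  (forall h, H h -> H h^-1%g) -> reduced_letters X H w -> reduced_letters X H (word_inv w).
Proof.
move=> Hinv [wX w1]; split=> [l|]; rewrite /word_inv mem_rev.
  move=> /mapP[l' /wX + ->]; case: l' => [[x b]|h] //=; exact: Hinv.
apply/negP => /mapP[[[x b]|h] //= hw [e]].
by move: w1; rewrite -[1%g]invg1 e invgK hw.
Qed.

Lemma size_word_inv (G : groupType) (w : rword G) : size (word_inv w) = size w.
Proof. by rewrite size_rev size_map. Qed.

(** * Infinite orbits under conjugation by N *)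

Section SemidirectICC.
Variables (Q N : groupType) (sigma : group_action Q N).
Local Notation G := (sdprod sigma).
Local Notation GT := (sdprod sigma : groupType).
Local Notation H := (sd_complement sigma).

Definition sd_inl (n : N) : G := (n, 1%g).
Definition sd_inr (q : Q) : G := (1%g, q).

Lemma sd_mulE (g h : G) : (g * h)%g = ((g.1 * sigma g.2 h.1)%g, (g.2 * h.2)%g) :> G.
Proof. by []. Qed.

Lemma sd_invE (g : G) : (g^-1)%g = (sigma g.2^-1%g g.1^-1%g, g.2^-1%g) :> G.
Proof. by []. Qed.

Lemma gactV q x : sigma q x^-1%g = (sigma q x)^-1%g.
Proof. by apply: (@mulgI _ (sigma q x)); rewrite -gactM !mulgV gact_one. Qed.

Lemma gactX q x n : sigma q (x ^+ n)%g = (sigma q x ^+ n)%g.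
Proof. by elim: n => [|n IH]; rewrite ?gact_one// !expgS gactM IH. Qed.

Lemma gact_inj q : injective (sigma q).
Proof.
move=> x y /(congr1 (sigma q^-1%g)).
by rewrite -!gactA mulVg !gact1.
Qed.

Lemma sd_complement_inv (h : G) : H h -> H (h^-1)%g.
Proof. by rewrite /= sd_invE => -[] /= ->; rewrite invg1 gact_one. Qed.

Lemma sd_inl_inv n : ((sd_inl n)^-1)%g = sd_inl n^-1%g.
Proof. by rewrite sd_invE /= invg1 gact1. Qed.

Lemma sd_inr_inv q : ((sd_inr q)^-1)%g = sd_inr q^-1%g.
Proof. by rewrite sd_invE /= invg1 gact_one. Qed.

(** The potential is the truncated distance from A in the coset A Q. The excluded q are those with A
    q in one of the finitely many balls of radius less than T. The letters are symmetrized because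
    the Lipschitz bound needs steps in both directions. *)
Lemma far_potential (Om : seq GT) (A : GT) (T : nat) : (forall o, o \in Om -> H o) ->
  exists F : seq Q, forall q, q \notin F -> exists psi : GT -> int,
  [/\ forall x o, o \in Om -> `|psi (x * o)%g - psi x| <= 1,
      psi A = 0, psi (A * sd_inr q)%g = T &
      forall x : GT, x.1 <> A.1 -> psi x = T].
Proof.
move=> OmH; pose Om2 := Om ++ [seq (o^-1)%g | o <- Om].
have Om2H o : o \in Om2 -> H o.
  rewrite mem_cat => /orP[/OmH//|/mapP[x /OmH hx ->]]; exact: sd_complement_inv.
have symOm o : o \in Om2 -> (o^-1)%g \in Om2.
  rewrite mem_cat => /orP[oO|/mapP[x xO ->]]; rewrite mem_cat.
    by rewrite map_f ?orbT.
  by rewrite invgK xO.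
pose far := flatten [seq coset_ball Om2 A j | j <- iota 0 T].
exists [seq (A^-1 * x)%g.2 | x <- far] => q qF.
have incoset j x : x \in coset_ball Om2 A j -> x.1 = A.1.
  apply: (@coset_ball_sub _ _ _ (fun x : G => x.1 = A.1)) => // y o /Om2H + yA.
  by rewrite sd_mulE /= => ->; rewrite gact_one mulg1.
exists (fun x => (ball_dist Om2 A T x)%:Z); split.
- move=> x o oO; apply: ball_dist_lipschitz => //; by rewrite mem_cat oO.
- by rewrite ball_dist_base.
- congr Posz; apply: ball_dist_far => j jT; apply: contra qF => h.
  apply/mapP; exists (A * sd_inr q)%g; last by rewrite mulKg.
  apply/flattenP; exists (coset_ball Om2 A j) => //.
  by apply: map_f; rewrite mem_iota.
move=> x xA; congr Posz; apply: ball_dist_far => j _.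
by apply/negP => /incoset.
Qed.

Lemma reduced_letters_cat (X : set G) (u v : rword G) :
  reduced_letters X H u -> reduced_letters X H v -> reduced_letters X H (u ++ v).
Proof.
move=> [uX u1] [vX v1]; split=> [l|]; rewrite mem_cat ?negb_or ?u1//.
by move=> /orP[/uX|/vX].
Qed.

Lemma reduced_letters_inr (X : set G) q : q <> 1%g ->
  reduced_letters X H [:: inr (sd_inr q)].
Proof.
move=> q1; split=> [l|]; first by rewrite inE => /eqP ->.
by rewrite inE; apply/eqP => -[e]; apply: q1; rewrite e.
Qed.

Lemma reduced_letters_inr_inv (X : set G) q : q <> 1%g ->
  reduced_letters X H [:: inr ((sd_inr q)^-1)%g].
Proof.
move=> q1; rewrite sd_inr_inv; apply: reduced_letters_inr => e; apply: q1.
by rewrite -[q]invgK e invg1.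
Qed.

Lemma sd_conj_inl q a :
  (sd_inr q * (sd_inl a * (sd_inr q)^-1))%g = sd_inl (sigma q a) :> GT.
Proof.
rewrite sd_inr_inv !sd_mulE /= /sd_inl; congr pair.
  by rewrite gact1 mulg1 mul1g.
by rewrite mul1g mulgV.
Qed.

Lemma sd_inlM a b : (sd_inl a * sd_inl b)%g = sd_inl (a * b)%g :> GT.
Proof. by rewrite sd_mulE /= gact1 mulg1. Qed.

Lemma sd_fst_inr (g : GT) q : (g * sd_inr q)%g.1 = g.1.
Proof. by rewrite sd_mulE /= gact_one mulg1. Qed.

Lemma sd_fst_inrV (g : GT) q : (g * (sd_inr q)^-1)%g.1 = g.1.
Proof. by rewrite sd_inr_inv sd_fst_inr. Qed.

Lemma sd_fst_inl (g : GT) a : (g * sd_inl a)%g.1 = (g.1 * sigma g.2 a)%g.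
Proof. by rewrite sd_mulE. Qed.

(* The loops [a, q a q^-1] and [q, a] have relative length independent of q, but
   their only edge in the coset a Q (resp. Q) is labelled by q; so q is confined
   to a finite set. *)
Lemma commuting_conjugates_trivial : hyperbolic_relative_to H -> infinite_type Q ->
  forall a : N, (forall q, (a * sigma q a)%g = (sigma q a * a)%g) -> a = 1%g.
Proof.
move=> hyp infQ a aC; apply: contrapT => a1.
have [X [Om [c [gX OmH hc]]]] := hyperbolic_relative_cochain hyp.
have [w rw wa] := generates_word gX (sd_inl a) sd_complement_inv.
have rwi := reduced_letters_inv sd_complement_inv rw.
pose Om1 := Om ++ peripheral_letters w.
have Om1H x : x \in Om1 -> H x.
  rewrite mem_cat => /orP[/OmH//|]; rewrite mem_peripheral_letters => xw.
  exact: (rw.1 _ xw).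
(* T exceeds the isoperimetric bound for a loop of length 4|w| + 4 plus the contribution, at most
   |w| each, of its four copies of w. The shorter loop needs less. *)
pose T := ((c * (4 * size w + 4)) + 4 * size w).+1.
have [F1 hF1] := far_potential (sd_inl a) T Om1H.
have [F2 hF2] := far_potential (sd_inl 1%g) T Om1H.
have [q] := infQ (1%g :: F1 ++ F2).
rewrite inE mem_cat !negb_or => /and3P[/eqP q1 /hF1 {hF1} [psi1 [l1 base1 q1T far1]]].
move=> /hF2 {hF2} [psi2 [l2 base2 q2T far2]].
have sw (psi : GT -> int) : (forall x o, o \in Om1 -> `|psi (x * o)%g - psi x| <= 1) ->
    forall x, `|cochain psi x w| <= (size w)%:Z.
  move=> l x; apply: cochain_le_size.
  have := letter_cochain_le1 l.
  move/(_ w).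

  apply. move=> o ow.
  by rewrite mem_cat ow orbT.
have lOm (psi : GT -> int) : (forall x o, o \in Om1 -> `|psi (x * o)%g - psi x| <= 1) ->
    forall x o, o \in Om -> `|psi (x * o)%g - psi x| <= 1.
  by move=> l x o oO; apply: l; rewrite mem_cat oO.
pose u := [:: (inr (sd_inr q) : rletter G)]; pose u' := [:: (inr ((sd_inr q)^-1)%g : rletter G)].
have ru := reduced_letters_inr X q1; have ru' := reduced_letters_inr_inv X q1.
have valu : word_val u = sd_inr q by rewrite word_val_cons word_val_nil mulg1.
have valu' : word_val u' = ((sd_inr q)^-1)%g by rewrite word_val_cons word_val_nil mulg1.
have sa1 : sigma q a <> 1%g by rewrite -(gact_one sigma q) => /gact_inj.
have sai : sigma q (a^-1)%g = ((sigma q a)^-1)%g by exact: gactV.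
(* The longer loop also crosses the coset of [sigma q a]. If that is the coset of a, the second edge
   labelled q could disturb the count; but then q commutes with a, and the loop q a q^-1 a^-1 meets
   Q in its first edge only. *)
have [saa|saa] := pselect (sigma q a = a).
  have rW : reduced_letters X H (u ++ w ++ u' ++ word_inv w).
    by do !apply: reduced_letters_cat.
  have vW : word_val (u ++ w ++ u' ++ word_inv w) = 1%g.
    rewrite !word_val_cat valu valu' word_val_inv wa.
    by rewrite (mulgA (sd_inl a)) (mulgA (sd_inr q)) sd_conj_inl saa mulgV.
  have := hc psi2 (lOm _ l2) _ rW vW.
  rewrite !cochain_cat cochain_inv valu valu' wa /= !addr0.
  rewrite !size_cat /= size_word_inv !mul1g.
  have far3 : psi2 (sd_inr q * sd_inl a)%g = T.
    by rewrite far2// sd_fst_inl /= mul1g saa.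
  rewrite (far2 (_ * _ * _)%g) ?far3; last by rewrite sd_fst_inrV sd_fst_inl /= mul1g saa.
  have -> : psi2 (sd_inr q)%g = T by rewrite -q2T mul1g.
  have -> : psi2 1%g = 0 by rewrite -base2.
  have := sw psi2 l2 (sd_inr q)%g.
  set z := cochain psi2 _ w; set z' := cochain psi2 _ w.
  have := sw psi2 l2 (sd_inr q)%g.
  have : `|z'| <= (size w)%:Z by exact: sw.
  rewrite /T !ler_norml.
  lia.
have rW : reduced_letters X H
    (w ++ u ++ w ++ u' ++ word_inv w ++ u ++ word_inv w ++ u').
  by do !apply: reduced_letters_cat.
have vW : word_val (w ++ u ++ w ++ u' ++ word_inv w ++ u ++ word_inv w ++ u') = 1%g.
  rewrite !word_val_cat valu valu' word_val_inv wa.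
  rewrite (mulgA (sd_inl a) (sd_inr q)^-1%g) (mulgA (sd_inr q) (_ * _)%g) sd_conj_inl.
  rewrite sd_inl_inv sd_conj_inl.
  by rewrite !sd_inlM sai !mulgA aC mulgK mulgV.
have := hc psi1 (lOm _ l1) _ rW vW.
rewrite !cochain_cat !cochain_inv !word_val_inv valu valu' wa /= !addr0.
do 8?rewrite size_cat /=.
rewrite !size_word_inv !mul1g.
have a_nz : (a * sigma q a)%g <> a by rewrite -[RHS]mulg1 => /mulgI.
(* The v_i are the later vertices of the loop. Apart from the first edge labelled q, which starts at
   a, both ends of each edge labelled q or q^-1 lie outside a Q, so psi1 equals T at both and the
   edge contributes 0. *)
set v1 := (sd_inl a * sd_inr q * sd_inl a)%g.
have v1E : v1 = (a * sigma q a, q)%g :> GT.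
  by rewrite /v1 !sd_mulE /= gact1 mulg1 mulg1 mul1g.
set v2 := (v1 / sd_inr q)%g.
have v2E : v2 = sd_inl (a * sigma q a)%g.
  by rewrite /v2 v1E sd_inr_inv sd_mulE /= gact_one mulg1 mulgV.
set v3 := (v2 / sd_inl a)%g.
have v3E : v3 = sd_inl (sigma q a) by rewrite /v3 v2E sd_inl_inv sd_inlM aC mulgK.
set v4 := (v3 * sd_inr q)%g.
have v4E : v4 = (sigma q a, q) :> GT by rewrite /v4 v3E sd_mulE /= gact1 mulg1 mul1g.
set v5 := (v4 / sd_inl a)%g.
have v5E : v5 = sd_inr q :> GT.
  by rewrite /v5 v4E sd_inl_inv sd_mulE /= sai mulgV mulg1.
have e1 : psi1 v1 = T by rewrite far1 ?v1E.
have e2 : psi1 v2 = T by rewrite far1 ?v2E.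
have e3 : psi1 v3 = T by rewrite far1 ?v3E.
have e4 : psi1 v4 = T by rewrite far1 ?v4E.
have e5 : psi1 v5 = T by rewrite far1 ?v5E //=; exact: nesym.
have e6 : psi1 (v5 / sd_inr q)%g = T.
  by rewrite far1 // v5E sd_fst_inrV /=; exact: nesym.
rewrite e1 e2 e3 e4 e5 e6 q1T base1.
have := sw psi1 l1 1%g; have := sw psi1 l1 (sd_inl a * sd_inr q)%g.
have := sw psi1 l1 v3; have := sw psi1 l1 v5.
move: (cochain psi1 1%g w) (cochain psi1 _ w) (cochain psi1 v3 w) (cochain psi1 v5 w).
move=> z1 z2 z3 z4; rewrite /T !ler_norml.
by clear; lia.
Qed.

Definition finite_N_orbit (y : GT) : Prop :=
  exists s : seq GT, forall n, (sd_inl n * y * (sd_inl n)^-1)%g \in s.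

Lemma finite_N_orbitM y z :
  finite_N_orbit y -> finite_N_orbit z -> finite_N_orbit (y * z)%g.
Proof.
move=> [s hs] [t ht]; exists [seq (u * v)%g | u <- s, v <- t] => n.
have -> : (sd_inl n * (y * z) * (sd_inl n)^-1)%g =
   ((sd_inl n * y * (sd_inl n)^-1) * (sd_inl n * z * (sd_inl n)^-1))%g.
  by rewrite !mulgA mulgVK.
exact: allpairs_f.
Qed.

Lemma finite_N_orbitV y : finite_N_orbit y -> finite_N_orbit y^-1%g.
Proof.
move=> [s hs]; exists [seq (u^-1)%g | u <- s] => n.
have -> : (sd_inl n * y^-1 * (sd_inl n)^-1)%g = ((sd_inl n * y * (sd_inl n)^-1)^-1)%g.
  by rewrite !invgM invgK mulgA.
exact: map_f.
Qed.

Lemma finite_N_orbitJ y m : finite_N_orbit y ->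
  finite_N_orbit ((sd_inl m)^-1 * y * sd_inl m)%g.
Proof.
move=> [s hs]; exists s => n; have := hs (n * m^-1)%g.
by rewrite -sd_inlM -sd_inl_inv invgM invgK !mulgA.
Qed.

(** Among the conjugates of a by n^0, ..., n^|s| two coincide, so some n^d with 0 < d <= |s|
    commutes with a. The factorial of |s| is divisible by every such d, which makes k independent of
    n. *)
Lemma finite_N_orbit_power a : finite_N_orbit (sd_inl a) ->
  exists2 k, (0 < k)%N & forall n : N, (n ^+ k * a)%g = (a * n ^+ k)%g.
Proof.
move=> [s hs]; pose k := (size s)`!; exists k; first exact: fact_gt0.
move=> n; pose f i := sd_inl (n ^+ i * a * n ^- i)%g.
have fs i : f i \in s.
  by have := hs (n ^+ i)%g; rewrite sd_inl_inv !sd_inlM.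
have [|u] := boolP (uniq [seq f i | i <- iota 0 (size s).+1]).
  move=> /uniq_leq_size h; have := h s _; rewrite size_map size_iota ltnn => h2.
  by suff : false by []; apply: h2 => x /mapP[i _ ->].
have [i [j [ij js fij]]] : exists i j, [/\ (i < j)%N, (j <= size s)%N & f i = f j].
  apply: contrapT => hn; move/negP: u; apply; rewrite map_inj_in_uniq ?iota_uniq//.
  move=> i j; rewrite !mem_iota !add0n !ltnS /= => hi hj fij.
  case: (ltngtP i j) => // lt; exfalso; apply: hn; first by exists i, j.
  by exists j, i.
have cji : commute (n ^+ (j - i))%g a.
  have e : (n ^+ i * a * n ^- i)%g = (n ^+ j * a * n ^- j)%g.
    by have := congr1 fst fij.
  rewrite -(subnKC (ltnW ij)) expgnDr invgM !mulgA in e.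
  have := mulIg _ _ _ e; rewrite -!mulgA => /mulgI {e}.
  rewrite mulgA => e2; rewrite /commute [in RHS]e2 mulgVK //.
have : (j - i %| k)%N by rewrite dvdn_fact// subn_gt0 ij (leq_trans (leq_subr _ _)).
move=> /dvdnP[d ->]; rewrite mulnC expgnA.
by apply/commute_sym/commuteX; exact: commute_sym.
Qed.

Hypotheses (hyp : hyperbolic_relative_to H) (infQ : infinite_type Q)
  (tfG : torsion_free GT) (outinj : out_injective sigma).

(** Since k serves all n, it serves n = [sigma q a]: the element [sigma q (a ^+ k)] commutes with a,
    hence with [a ^+ k]. The loops kill [a ^+ k], and torsion freeness kills a. *)
Lemma finite_N_orbit_inl a : finite_N_orbit (sd_inl a) -> a = 1%g.
Proof.
move=> /finite_N_orbit_power[k k0 ka].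
have aC q : (a ^+ k * sigma q (a ^+ k) = sigma q (a ^+ k) * a ^+ k)%g.
  by rewrite gactX; apply/commute_sym/commuteX; exact: ka.
have ak : (a ^+ k)%g = 1%g by exact: commuting_conjugates_trivial.
have : sd_inl a = 1%g :> GT.
  apply: (tfG k0); rewrite -[RHS]/(sd_inl 1%g) -ak.
  elim: (k) => [//|i IH]; by rewrite !expgS IH sd_inlM.
by move=> /(congr1 fst).
Qed.

(* The commutators of y with N lie in N and have finite orbits, so y centralizes N. *)
Lemma finite_N_orbit_trivial y : finite_N_orbit y -> y = 1%g.
Proof.
move=> hy.
have yC x : (sigma y.2 x = x ^ y.1)%g.
  have e : ((sd_inl x)^-1 * y * sd_inl x * y^-1)%g =
      sd_inl (x^-1 * (y.1 * sigma y.2 x * y.1^-1))%g.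
    rewrite sd_inl_inv !sd_mulE sd_invE /= /sd_inl; congr pair; last by rewrite mul1g mulg1 mulgV.
    by rewrite !gact1 mul1g mulg1 -gactA mulgV gact1 !mulgA.
  have : (x^-1 * (y.1 * sigma y.2 x * y.1^-1))%g = 1%g.
    apply: finite_N_orbit_inl; rewrite -e; apply: finite_N_orbitM; last exact: finite_N_orbitV.
    exact: finite_N_orbitJ.
  move=> /mulg1_eq; rewrite invgK => ex; rewrite [in RHS]ex.
  by rewrite conjgE !mulgA mulVg mul1g mulgVK.
have y2 : y.2 = 1%g by apply: outinj; exists y.1.
have ey : y = sd_inl y.1 by rewrite /sd_inl -y2; case: (y).
rewrite ey; rewrite ey in hy; by rewrite (finite_N_orbit_inl hy).
Qed.

End SemidirectICC.

(** * Operators on square-summable functions *)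

Section SquareSummable.
Variables (R : realType) (G : groupType).
Local Notation C := R[i].
Local Notation Re := complex.Re.
Local Notation Im := complex.Im.
Local Notation L2 := (ell2_hilbert R G).
Implicit Types (f u v w : L2) (g h k : G) (S T : L2 -> L2).

Definition ell2_val (f : L2) : G -> C := @ell2_fun R G f.
Local Notation "f $[ x ]" := (ell2_val f x) (at level 1, format "f $[ x ]").

Lemma ell2_ext f u : (forall x, f$[x] = u$[x]) -> f = u.
Proof. by move=> h; apply: val_inj; apply/funext. Qed.

Lemma ell2_valD f u x : (f + u)$[x] = f$[x] + u$[x]. Proof. by []. Qed.
Lemma ell2_valN f x : (- f)$[x] = - f$[x]. Proof. by []. Qed.
Lemma ell2_valZ a f x : (a *: f)$[x] = a * f$[x]. Proof. by []. Qed.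
Lemma ell2_val0 x : (0 : L2)$[x] = 0. Proof. by []. Qed.

Lemma hnorm_ell2 f : hnorm f ^+ 2 = psum (fun x => normsq f$[x]).
Proof. by rewrite hnorm_sqr /rdot; have -> : hdot L2 f f = _ := ell2_normE f. Qed.

Lemma bessel_seq f (s : seq G) : uniq s ->
  \sum_(x <- s) normsq f$[x] <= hnorm f ^+ 2.
Proof.
move=> us; rewrite hnorm_ell2; have /[!inE]/= sf := valP f.
by apply: psum_ge_seq => // x; exact: normsq_ge0.
Qed.

(** The value is 0 when F is not square-summable, so operators can be defined before their
    boundedness is known. The lock keeps conversion from unfolding the case distinction. *)
Definition to_ell2 (F : G -> C) : L2 :=
  locked (if pselect (F \in @ell2_pred R G) is left h then Ell2 h else 0).

Section Bounded.
Variables (F : G -> C) (M : R).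
Hypothesis FM : forall s : seq G, uniq s -> \sum_(x <- s) normsq (F x) <= M.

Lemma bounded_ell2_pred : F \in @ell2_pred R G.
Proof.
rewrite inE /= /rsummable; apply: le_lt_trans (ltry M).
apply: esum_le_seq => s us; under eq_bigr do rewrite ger0_norm ?normsq_ge0//.
exact: FM.
Qed.

Lemma to_ell2E x : (to_ell2 F)$[x] = F x.
Proof.
by rewrite /to_ell2 -lock; case: pselect => // h; case: h; exact: bounded_ell2_pred.
Qed.

Lemma hnorm_to_ell2 : hnorm (to_ell2 F) ^+ 2 <= M.
Proof.
rewrite hnorm_ell2 -lee_fin -rsummable_pos => [|x|]; last 2 first.
- exact: normsq_ge0.
- by have /[!inE] := valP (to_ell2 F).
by apply: esum_le_seq => s us; under eq_bigr do rewrite to_ell2E; exact: FM.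
Qed.

End Bounded.

Lemma hnorm_le_seq f (M : R) :
  (forall s : seq G, uniq s -> \sum_(x <- s) normsq f$[x] <= M) ->
  hnorm f ^+ 2 <= M.
Proof.
move=> h; have -> : f = to_ell2 (fun x => f$[x]).
  by apply: ell2_ext => x; rewrite (to_ell2E h).
exact: hnorm_to_ell2.
Qed.

Lemma hnorm_le_bij f u (p : G -> G) : injective p ->
  (forall x, normsq u$[x] <= normsq f$[p x]) -> hnorm u <= hnorm f.
Proof.
move=> ip h; apply: le_sqr_norm; first exact: hnorm_ge0.
apply: hnorm_le_seq => s us.
apply: (@le_trans _ _ (\sum_(x <- s) normsq f$[p x])); first exact: ler_sum.
rewrite -(big_map p xpredT (fun x => normsq f$[x])).
by apply: bessel_seq; rewrite map_inj_uniq.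
Qed.

(** Common source of [rho], [Jconj] and [mulop]: coordinates dominated by those of f along an
    injection of G. *)
Lemma to_ell2_bij f (F : G -> C) (p : G -> G) : injective p ->
  (forall x, normsq (F x) <= normsq f$[p x]) ->
  (forall x, (to_ell2 F)$[x] = F x) /\ hnorm (to_ell2 F) <= hnorm f.
Proof.
move=> ip h.
have hF (s : seq G) : uniq s -> \sum_(x <- s) normsq (F x) <= hnorm f ^+ 2.
  move=> us; apply: (@le_trans _ _ (\sum_(x <- s) normsq f$[p x])); first exact: ler_sum.
  rewrite -(big_map p xpredT (fun x => normsq f$[x])).
  by apply: bessel_seq; rewrite map_inj_uniq.
split=> [x|]; first exact: (to_ell2E hF).
by apply: le_sqr_norm; [exact: hnorm_ge0|exact: hnorm_to_ell2].
Qed.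

Lemma psum_single (a : G -> R) g : (forall x, 0 <= a x) ->
  (forall x, x != g -> a x = 0) -> psum a = a g.
Proof.
move=> a0 ag.
have le (s : seq G) : uniq s -> \sum_(x <- s) a x <= a g.
  move=> us; have [gs|gs] := boolP (g \in s).
    rewrite (bigD1_seq g)//= big1 ?addr0// => x xg; exact: ag.
  rewrite big_seq big1// => x xs; apply: ag.
  by apply: contraNneq gs => <-.
have ls := esum_le_seq le.
have hs : rsummable a.
  rewrite /rsummable; under eq_esum do rewrite ger0_norm//.
  by apply: le_lt_trans ls _; rewrite ltry.
apply/eqP; rewrite eq_le -lee_fin -rsummable_pos// ls /=.
by have := @psum_ge_seq _ _ a [:: g] a0 hs isT; rewrite big_seq1.
Qed.

Lemma rsum_single (a : G -> R) g : (forall x, x != g -> a x = 0) -> rsum a = a g.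
Proof.
move=> ag; rewrite /rsum (@psum_single _ g); last 2 first.
- by move=> x; rewrite le_max lexx orbT.
- by move=> x xg; rewrite ag// maxxx.
rewrite (@psum_single _ g); last 2 first.
- by move=> x; rewrite le_max lexx orbT.
- by move=> x xg; rewrite ag// oppr0 maxxx.
by case: (leP (a g) 0) => h; case: (leP (- a g) 0) => h'; lra.
Qed.

Definition delta g : L2 := to_ell2 (fun x => (x == g)%:R).

Lemma normsq_bool (b : bool) : normsq (b%:R : C) = b%:R.
Proof. by case: b; rewrite /normsq /= ?expr0n ?expr1n /= ?addr0. Qed.

Lemma deltaE g x : (delta g)$[x] = (x == g)%:R.
Proof.
rewrite (@to_ell2E _ 1)// => s us.
under eq_bigr do rewrite normsq_bool.
have [gs|gs] := boolP (g \in s).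
  rewrite (bigD1_seq g)//= eqxx big1 ?addr0// => y yg; by rewrite (negbTE yg).
rewrite big_seq big1 ?ler01// => y ys.
by rewrite (_ : y == g = false)//; apply: contraNF gs => /eqP <-.
Qed.

Lemma hdot_delta f g : hdot L2 f (delta g) = f$[g].
Proof.
rewrite -[LHS]/(ell2_dot f (delta g)) /ell2_dot /csum.
have e x : (f : ell2 R G) x * conjC ((delta g : ell2 R G) x) = f$[x] * (x == g)%:R.
  by rewrite -[(delta g : ell2 R G) x]/((delta g)$[x]) deltaE; case: eqP => _; rewrite ?rmorph1 ?rmorph0.
rewrite !(@rsum_single _ g); first last.
- by move=> x /negbTE xg; rewrite e xg mulr0.
- by move=> x /negbTE xg; rewrite e xg mulr0.
by rewrite !e eqxx mulr1; case: (f$[g]).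
Qed.

Lemma hdot_deltal f g : hdot L2 (delta g) f = ((f$[g])^*)%C.
Proof. by rewrite hdotC hdot_delta. Qed.

Lemma hnorm_delta g : hnorm (delta g) = 1.
Proof.
apply/eqP; rewrite -(@eqrXn2 _ 2) ?hnorm_ge0// hnorm_sqr /rdot hdot_delta deltaE.
by rewrite eqxx expr1n.
Qed.

Local Notation lam := (@left_translation R G).

Lemma lamE g f x : (lam g f)$[x] = f$[(g^-1 * x)%g]. Proof. by []. Qed.

Lemma lam_linear g : linear (lam g).
Proof. by move=> a u v; apply: ell2_ext. Qed.

Lemma lamM g h f : lam g (lam h f) = lam (g * h)%g f.
Proof. by apply: ell2_ext => x; rewrite !lamE invgM mulgA. Qed.

Lemma lam1 f : lam 1%g f = f.
Proof. by apply: ell2_ext => x; rewrite !lamE invg1 mul1g. Qed.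

Lemma lamK g f : lam g^-1%g (lam g f) = f. Proof. by rewrite lamM mulVg lam1. Qed.
Lemma lamVK g f : lam g (lam g^-1%g f) = f. Proof. by rewrite lamM mulgV lam1. Qed.

Lemma lam_delta g h : lam g (delta h) = delta (g * h)%g.
Proof.
apply: ell2_ext => x; rewrite lamE !deltaE; congr (nat_of_bool _)%:R.
by apply/eqP/eqP => [<-|->]; rewrite ?mulVKg ?mulKg.
Qed.

Definition rho g (f : L2) : L2 := to_ell2 (fun x => f$[(x * g)%g]).

Lemma rho_aux g f : (forall x, (rho g f)$[x] = f$[(x * g)%g]) /\
  hnorm (rho g f) <= hnorm f.
Proof. by apply: (@to_ell2_bij _ _ (fun x => x * g)%g) => //; exact: mulIg. Qed.

Lemma rhoE g f x : (rho g f)$[x] = f$[(x * g)%g]. Proof. exact: (rho_aux g f).1. Qed.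

Lemma rho_linear g : linear (rho g).
Proof. by move=> a u v; apply: ell2_ext => x; rewrite !(rhoE, ell2_valD, ell2_valZ). Qed.

Lemma rhoM g h f : rho g (rho h f) = rho (g * h)%g f.
Proof. by apply: ell2_ext => x; rewrite !rhoE mulgA. Qed.

Lemma rho1 f : rho 1%g f = f.
Proof. by apply: ell2_ext => x; rewrite rhoE mulg1. Qed.

Lemma rho_delta g h : rho g (delta h) = delta (h * g^-1)%g.
Proof.
apply: ell2_ext => x; rewrite rhoE !deltaE; congr (nat_of_bool _)%:R.
by apply/eqP/eqP => [<-|->]; rewrite ?mulgK ?mulgVK.
Qed.

Lemma lam_rho g h f : lam g (rho h f) = rho h (lam g f).
Proof. by apply: ell2_ext => x; rewrite lamE !rhoE lamE mulgA. Qed.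

Lemma isometry_rdot T : (forall u v, T (u + v) = T u + T v) ->
  (forall u, hnorm (T u) = hnorm u) -> forall u v, rdot (T u) (T v) = rdot u v.
Proof.
move=> TD Tn u v; have := Tn (u + v) => /(congr1 (fun x => x ^+ 2)).
rewrite !hnorm_sqr TD !(rdotDl, rdotDr) -!hnorm_sqr !Tn.
by rewrite (rdotC u v) (rdotC (T u)); lra.
Qed.

Lemma hnorm_lam g f : hnorm (lam g f) = hnorm f.
Proof.
apply/eqP; rewrite eq_le; apply/andP; split.
  by apply: (@hnorm_le_bij _ _ (fun x => g^-1 * x)%g) => //; exact: mulgI.
rewrite -{1}(lamK g f).
by apply: (@hnorm_le_bij _ _ (fun x => g^-1^-1 * x)%g) => //; exact: mulgI.
Qed.

Lemma hnorm_rho g f : hnorm (rho g f) = hnorm f.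
Proof.
apply/eqP; rewrite eq_le (rho_aux g f).2 /=.
by rewrite -{1}(rho1 f) -(mulVg g) -rhoM (rho_aux _ _).2.
Qed.

Lemma bounded_lam g : bounded_op (lam g).
Proof. by split; [exact: lam_linear|exists 1 => v; rewrite mul1r hnorm_lam]. Qed.

Lemma bounded_rho g : bounded_op (rho g).
Proof. by split; [exact: rho_linear|exists 1 => v; rewrite mul1r hnorm_rho]. Qed.

Lemma isometry_adjoint T S : linear T -> (forall u, hnorm (T u) = hnorm u) ->
  (forall u, T (S u) = u) -> is_adjoint T S.
Proof.
move=> lT Tn TS; apply: is_adjointP => [|u v]; first exact: linopZ.
by rewrite -{1}(TS v) isometry_rdot//; exact: linopD.
Qed.

Lemma lam_adjoint g : is_adjoint (lam g) (lam g^-1%g).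
Proof. by apply: isometry_adjoint; [exact: lam_linear|exact: hnorm_lam|exact: lamVK]. Qed.

Lemma rho_adjoint g : is_adjoint (rho g) (rho g^-1%g).
Proof.
apply: isometry_adjoint; [exact: rho_linear|exact: hnorm_rho|].
by move=> u; rewrite rhoM mulgV rho1.
Qed.

(** The modular conjugation of the trace: it exchanges left and right translations ([J_lam]) and
    sends T delta_1 to the adjoint of T applied to delta_1 ([adjoint_delta1]). *)
Definition Jconj (f : L2) : L2 := to_ell2 (fun x => (f$[x^-1%g]^*)%C).

Lemma normsq_conj (z : C) : normsq (z^*)%C = normsq z.
Proof. by case: z => a b; rewrite /normsq /= sqrrN. Qed.

Lemma J_aux f : (forall x, (Jconj f)$[x] = (f$[x^-1%g]^*)%C) /\
  hnorm (Jconj f) <= hnorm f.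
Proof.
apply: (@to_ell2_bij _ _ (fun x => x^-1)%g) => [|x]; first exact: invg_inj.
by rewrite normsq_conj.
Qed.

Lemma JE f x : (Jconj f)$[x] = (f$[x^-1%g]^*)%C. Proof. exact: (J_aux f).1. Qed.

Lemma JK : involutive Jconj.
Proof.
by move=> f; apply: ell2_ext => x; rewrite !JE invgK; case: (f$[x]) => a b /=; rewrite opprK.
Qed.

Lemma JD u v : Jconj (u + v) = Jconj u + Jconj v.
Proof. by apply: ell2_ext => x; rewrite !(JE, ell2_valD) rmorphD. Qed.

Lemma JZ a u : Jconj (a *: u) = (a^*)%C *: Jconj u.
Proof. by apply: ell2_ext => x; rewrite !(JE, ell2_valZ) rmorphM. Qed.

Lemma hnorm_J f : hnorm (Jconj f) = hnorm f.
Proof.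
by apply/eqP; rewrite eq_le (J_aux f).2 /= -{1}(JK f) (J_aux (Jconj f)).2.
Qed.

Lemma rdot_J u v : rdot (Jconj u) (Jconj v) = rdot u v.
Proof. by apply: isometry_rdot; [exact: JD|exact: hnorm_J]. Qed.

Lemma J_delta g : Jconj (delta g) = delta g^-1%g.
Proof.
apply: ell2_ext => x; rewrite JE !deltaE -(inj_eq invg_inj) invgK.
by case: eqP => _; rewrite ?rmorph1 ?rmorph0.
Qed.

Lemma J_lam g f : Jconj (lam g (Jconj f)) = rho g f.
Proof.
apply: ell2_ext => x; rewrite JE lamE JE rhoE invgM !invgK.
by case: (f$[_]) => a b /=; rewrite opprK.
Qed.

Definition mulop (m : G -> C) (f : L2) : L2 := to_ell2 (fun x => m x * f$[x]).

Section MultiplicationOperator.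
Variable m : G -> C.
Hypothesis m1 : forall x, normsq (m x) <= 1.

Lemma mulop_aux f : (forall x, (mulop m f)$[x] = m x * f$[x]) /\
  hnorm (mulop m f) <= hnorm f.
Proof.
by apply: (@to_ell2_bij _ _ id) => // x; rewrite normsqM ler_piMl ?normsq_ge0.
Qed.

Lemma mulopE f x : (mulop m f)$[x] = m x * f$[x]. Proof. exact: (mulop_aux f).1. Qed.

Lemma bounded_mulop : bounded_op (mulop m).
Proof.
split; last by exists 1 => v; rewrite mul1r (mulop_aux v).2.
by move=> a u v; apply: ell2_ext => x; rewrite !(mulopE, ell2_valD, ell2_valZ); ring.
Qed.

End MultiplicationOperator.

Lemma sum_coordinates (s : seq G) (c : G -> C) x : uniq s ->
  (\sum_(k <- s) c k *: delta k)$[x] = if x \in s then c x else 0.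
Proof.
elim: s => [|k s IH] /=; first by rewrite big_nil.
move=> /andP[ks us]; rewrite big_cons ell2_valD ell2_valZ IH// deltaE inE.
by case: eqP => [->|_] /=; rewrite ?(negbTE ks) ?mulr1 ?addr0 ?mulr0 ?add0r.
Qed.

Definition adj T (f : L2) : L2 := to_ell2 (fun k => hdot L2 f (T (delta k))).

(** Duality: for a finite set s, test T on w, the sum over s of the a k delta_k. If t is the sum of
    the |a k|^2, then t = <f, T w> <= c |f| sqrt t, which bounds t by (c |f|)^2. *)
Lemma adj_aux T (c : R) f : linear T -> 0 < c -> (forall v, hnorm (T v) <= c * hnorm v) ->
  (forall x, (adj T f)$[x] = hdot L2 f (T (delta x))) /\ hnorm (adj T f) <= c * hnorm f.
Proof.
move=> lT c0 hc; pose a k := hdot L2 f (T (delta k)).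
have bnd (s : seq G) : uniq s -> \sum_(x <- s) normsq (a x) <= (c * hnorm f) ^+ 2.
  move=> us; pose w := \sum_(k <- s) a k *: delta k : L2.
  set t := \sum_(x <- s) _.
  have t0 : 0 <= t by apply: sumr_ge0 => x _; exact: normsq_ge0.
  have wt : rdot f (T w) = t.
    rewrite /t /w; elim: (s) => [|k s' IH].
      by rewrite !big_nil (linop0 lT) rdot0r.
    rewrite !big_cons lT rdotDr IH; congr (_ + _).
    rewrite /rdot hdotZr -/(a k) /normsq; case: (a k) => x y /=; ring.
  have w2 : hnorm w ^+ 2 <= t.
    apply: hnorm_le_seq => s' us'; rewrite /t.
    under eq_bigr do rewrite sum_coordinates//.
    rewrite (bigID (mem s)) /= [X in _ + X]big1 ?addr0; last first.
      by move=> x /negbTE ->; rewrite /normsq /= expr0n addr0.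
    rewrite (eq_bigr (fun x => normsq (a x))); last by move=> x ->.
    rewrite -big_filter [leRHS](bigID (mem s')) /= -[X in _ <= X + _]big_filter.
    rewrite (perm_big [seq x <- s | x \in s']).
      by rewrite lerDl; apply: sumr_ge0 => x _; exact: normsq_ge0.
    apply: uniq_perm; rewrite ?filter_uniq// => x.
    by rewrite !mem_filter andbC.
  have h1 : t <= hnorm f * (c * hnorm w).
    rewrite -{1}wt; apply: le_trans (rdot_le _ _) _.
    by rewrite ler_wpM2l ?hnorm_ge0.
  have h2 : hnorm w <= Num.sqrt t by apply: le_sqr_norm; [exact: sqrtr_ge0|rewrite (sqr_sqrtr t0)].
  have h3 : t <= c * hnorm f * Num.sqrt t.
    apply: le_trans h1 _; rewrite mulrA (mulrC _ c) ler_wpM2l//.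
    by rewrite mulr_ge0 ?hnorm_ge0 ?ltW.
  have h4 := sqr_sqrtr t0; have h5 := sqrtr_ge0 t.
  have h6 : 0 <= c * hnorm f by rewrite mulr_ge0 ?hnorm_ge0 ?ltW.
  rewrite -h4 ler_sqr ?nnegrE//.
  have [->//|n0] := eqVneq (Num.sqrt t) 0.
  have p0 : 0 < Num.sqrt t by rewrite lt_neqAle eq_sym n0.
  by rewrite -(ler_pM2r p0) -expr2 h4.
split=> [x|]; first exact: (to_ell2E bnd).
apply: le_sqr_norm; first by rewrite mulr_ge0 ?hnorm_ge0 ?ltW.
exact: hnorm_to_ell2.
Qed.

Lemma adjE T f x : bounded_op T -> (adj T f)$[x] = hdot L2 f (T (delta x)).
Proof.
by move=> bT; have [c c0 hc] := bounded_op_pos bT; apply: (adj_aux f bT.1 c0 hc).1.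
Qed.

Lemma bounded_adj T : bounded_op T -> bounded_op (adj T).
Proof.
move=> bT; have [c c0 hc] := bounded_op_pos bT; split; last first.
  by exists c => v; apply: (adj_aux v bT.1 c0 hc).2.
move=> a u v; apply: ell2_ext => x; rewrite ell2_valD ell2_valZ !adjE//.
by rewrite hdotDl hdotZl.
Qed.

Lemma orth_delta_eq0 f : (forall g, hdot L2 f (delta g) = 0) -> f = 0.
Proof. by move=> h; apply: ell2_ext => x; rewrite -hdot_delta h. Qed.

Lemma eq_on_delta (T S : L2 -> L2) : bounded_op T -> bounded_op S ->
  (forall g, T (delta g) = S (delta g)) -> T = S.
Proof.
move=> bT bS h; apply/funext => v.
pose K := [set w | T w = S w].
have sK : subspace K.
  split; first by rewrite /K /= (linop0 bT.1) (linop0 bS.1).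
  by move=> a u w; rewrite /K /= => hu hw; rewrite bT.1 bS.1 hu hw.
have [p [pK hp]] := hprojection v sK.
have vp : v = p.
  apply/eqP; rewrite -subr_eq0; apply/eqP; apply: orth_delta_eq0 => g.
  by apply: hp; rewrite /K /= h.
rewrite vp {vp hp}.
have [c c0 hc] := bounded_op_pos bT; have [d d0 hd] := bounded_op_pos bS.
apply/eqP; rewrite -subr_eq0; apply/eqP; apply: hnorm_small => e e0.
have e1 : 0 < e / (c + d) by rewrite divr_gt0// addr_gt0.
have [s Ks ps] := pK _ e1.
apply: le_trans (hnorm_tri (T s) _ _) _.
rewrite -(linopB bT.1) Ks -(linopB bS.1) (le_trans (lerD (hc _) (hd _)))//.
rewrite (hnormB s) -mulrDl -ler_pdivlMl ?addr_gt0// mulrC ltW//.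
Qed.

Lemma adj_is_adjoint T : bounded_op T -> is_adjoint T (adj T).
Proof.
move=> bT; apply: is_adjoint_sym; have bA := bounded_adj bT.
have [c c0 hc] := bounded_op_pos bT; have [d d0 hd] := bounded_op_pos bA.
apply: is_adjointP => [|u v]; first exact: linopZ bA.1.
pose K := [set w | hdot L2 (adj T u) w = hdot L2 u (T w)].
have sK : subspace K.
  split; first by rewrite /K /mkset (linop0 bT.1) !linear0r.
  move=> a w w'; rewrite /K /mkset => h h'.
  by rewrite bT.1 !hdotDr !hdotZr h h'.
have [p [pK hp]] := hprojection v sK.
have vp : v = p.
  apply/eqP; rewrite -subr_eq0; apply/eqP; apply: orth_delta_eq0 => g; apply: hp.
  by rewrite /K /mkset hdot_delta adjE.
rewrite vp; apply: (@eq_of_small _ _ _ ((d + c) * hnorm u)) => e e0.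
have [s Ks ps] := pK _ e0.
have es : rdot (adj T u) s = rdot u (T s) by rewrite /rdot Ks.
have -> : rdot (adj T u) p - rdot u (T p) =
    rdot (adj T u) (p - s) - rdot u (T (p - s)).
  by rewrite (linopB bT.1) !rdotBr es; ring.
apply: le_trans (ler_normB _ _) _.
have h1 := rdot_norm_le (adj T u) (p - s); have h2 := rdot_norm_le u (T (p - s)).
have h3 := hd u; have h4 := hc (p - s).
have n1 := hnorm_ge0 u; have n2 := hnorm_ge0 (p - s).
have h5 : hnorm (adj T u) * hnorm (p - s) <= d * hnorm u * e.
  by apply: ler_pM => //; [exact: hnorm_ge0|exact: ltW].
have h6 : hnorm u * hnorm (T (p - s)) <= hnorm u * (c * e).
  by rewrite ler_wpM2l// (le_trans h4)// ler_pM2l// ltW.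
by rewrite mulrA mulrDr; nra.
Qed.

End SquareSummable.

(* Without this, the unifier compares vectors of l^2(G) by unfolding the inner
   product down to real numbers. *)
Opaque ell2_dot to_ell2 delta rho Jconj mulop adj.
Arguments ell2_val : simpl never.
Arguments left_translation : simpl never.

Lemma subB_AC (V : zmodType) (a b c d : V) : a - b - (c - d) = a - c - (b - d).
Proof. by rewrite !opprB addrACA [RHS]addrACA (addrC (- b)). Qed.

(** * Von Neumann algebras of subgroups *)

Section Commutants.
Variables (R : realType) (H : hilbert R).
Implicit Types (A B : set (H -> H)) (S T : H -> H).

Lemma bounded_op_comp S T : bounded_op S -> bounded_op T -> bounded_op (S \o T).
Proof.
move=> bS bT; have [c c0 hc] := bounded_op_pos bS; have [d d0 hd] := bounded_op_pos bT.
split=> [a u v /=|]; first by rewrite bT.1 bS.1.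
exists (c * d) => v /=; apply: le_trans (hc _) _.
by rewrite -mulrA ler_pM2l.
Qed.

Lemma bounded_op_lincomb a S T : bounded_op S -> bounded_op T ->
  bounded_op (fun v => a *: S v + T v).
Proof.
move=> bS bT; have [c c0 hc] := bounded_op_pos bS; have [d d0 hd] := bounded_op_pos bT.
split=> [b u v|].
  rewrite bT.1 bS.1 !scalerDr !scalerA (mulrC a b) -!addrA; congr (_ + _).
  by rewrite addrCA.
exists (Num.sqrt (normsq a) * c + d) => v; apply: le_trans (hnormD _ _) _.
by rewrite hnormZ mulrDl -mulrA lerD// ler_wpM2l ?sqrtr_ge0.
Qed.

Lemma bounded_op_id : bounded_op (@id H).
Proof. by split=> //; exists 1 => v; rewrite mul1r. Qed.

Lemma commutant_anti A B : A `<=` B -> commutant B `<=` commutant A.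
Proof. by move=> AB T [bT h]; split=> // S /AB; exact: h. Qed.

Lemma sub_bicommutant A : A `<=` @bounded_op R H -> A `<=` commutant (commutant A).
Proof. by move=> Ab T AT; split=> [|S [_ hS]]; [exact: Ab|rewrite hS]. Qed.

Lemma commutant_bounded A : commutant A `<=` @bounded_op R H.
Proof. by move=> T []. Qed.

Lemma commutant3 A : A `<=` @bounded_op R H ->
  commutant (commutant (commutant A)) = commutant A.
Proof.
move=> Ab; apply/seteqP; split; last by apply: sub_bicommutant; exact: commutant_bounded.
by apply: commutant_anti; exact: sub_bicommutant.
Qed.

Lemma commutant_comp A S T : commutant A S -> commutant A T -> commutant A (S \o T).
Proof.
move=> [bS hS] [bT hT]; split=> [|X AX]; first exact: bounded_op_comp.
by rewrite -compA hT// compA hS// compA.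
Qed.

Lemma commutant_lincomb A a S T : A `<=` @bounded_op R H ->
  commutant A S -> commutant A T -> commutant A (fun v => a *: S v + T v).
Proof.
move=> Ab [bS hS] [bT hT]; split=> [|X AX]; first exact: bounded_op_lincomb.
apply/funext => v /=; rewrite (Ab X AX).1; congr (_ *: _ + _).
  exact: (congr1 (fun F => F v) (hS X AX)).
exact: (congr1 (fun F => F v) (hT X AX)).
Qed.

Lemma commutant_id A : commutant A id.
Proof. by split; [exact: bounded_op_id|]. Qed.

Lemma commutant_adjoint A T T' : (forall S, A S -> exists2 S', A S' & is_adjoint S S') ->
  commutant A T -> bounded_op T' -> is_adjoint T T' -> commutant A T'.
Proof.
move=> Aadj [bT hT] bT' TT'; split=> // S AS; have [S' AS' SS'] := Aadj S AS.
apply/funext => v /=; apply: rdot_separate => w.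
rewrite !(rdotC w) -(adjoint_rdot TT') -(adjoint_rdot (is_adjoint_sym SS')).
rewrite -(adjoint_rdot (is_adjoint_sym SS')) -(adjoint_rdot TT').
by congr rdot; exact: (esym (congr1 (fun F => F w) (hT S' AS'))).
Qed.

Section VonNeumann.
Variable A : set (H -> H).
Hypothesis vA : von_neumann_algebra A.

Lemma vn_bounded T : A T -> bounded_op T. Proof. by case: vA => h _ _ /h. Qed.

Lemma vn_bicommutant T : bounded_op T ->
  (forall S, commutant A S -> T \o S = S \o T) -> A T.
Proof. by move=> bT h; case: vA => _ _ <-. Qed.

Lemma vn_commute S T : A T -> commutant A S -> S \o T = T \o S.
Proof. by move=> AT [_ h]; exact: h. Qed.

Lemma vn_comp S T : A S -> A T -> A (S \o T).
Proof. by case: vA => _ _ <- AS AT; exact: commutant_comp. Qed.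

Lemma vn_lincomb a S T : A S -> A T -> A (fun v => a *: S v + T v).
Proof. by case: vA => _ _ <- AS AT; apply: commutant_lincomb => //; exact: commutant_bounded. Qed.

Lemma vn_id : A id.
Proof. by case: vA => _ _ <-; exact: commutant_id. Qed.

Lemma vn_zero : A (fun=> 0).
Proof.
have := vn_lincomb (-1) vn_id vn_id; congr (A _); apply/funext => v.
by rewrite scaleN1r addNr.
Qed.

Lemma vn_scale a T : A T -> A (fun v => a *: T v).
Proof.
move=> AT; have := vn_lincomb a AT vn_zero; congr (A _); apply/funext => v.
by rewrite addr0.
Qed.

Lemma vn_add S T : A S -> A T -> A (fun v => S v + T v).
Proof.
move=> AS AT; have := vn_lincomb 1 AS AT; congr (A _); apply/funext => v.
by rewrite scale1r.
Qed.

Lemma vn_sub S T : A S -> A T -> A (fun v => S v - T v).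
Proof.
move=> AS AT; have := vn_lincomb (-1) AT AS; congr (A _); apply/funext => v.
by rewrite scaleN1r addrC.
Qed.

End VonNeumann.

Lemma hclosure_functional (F : H -> R) (c : R) (S : set H) : 0 <= c ->
  (forall u v, F (u - v) = F u - F v) -> (forall u, `|F u| <= c * hnorm u) ->
  (forall s, S s -> F s = 0) -> forall v, hclosure S v -> F v = 0.
Proof.
move=> c0 FB Fc FS v Sv; apply: (@eq_of_small _ _ _ c) => e /Sv[s Ss vs].
rewrite subr0; have := FB v s; rewrite (FS _ Ss) subr0 => <-.
by apply: le_trans (Fc _) _; rewrite mulrC ler_wpM2r// ltW.
Qed.

End Commutants.

(** * Elements of L(K) as vectors supported on K *)

Section GroupAlgebras.
Variables (R : realType) (G : groupType).
Local Notation C := R[i].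
Local Notation L2 := (ell2_hilbert R G).
Local Notation lam := (@left_translation R G).
Local Notation rho := (@rho R G).
Local Notation d1 := (delta R (1%g : G)).
Local Notation "f $[ x ]" := (ell2_val f x) (at level 1, format "f $[ x ]").
Implicit Types (f u v w : L2) (g h k : G) (S T : L2 -> L2) (A P : set (L2 -> L2)) (K : set G).

(** For bounded T this is membership in L(G): see [group_vn_right_invariant], and
    [group_vn_of_support] with K the whole group. It makes T depend only on T delta_1. *)
Definition right_invariant T := forall g v, T (rho g v) = rho g (T v).

Lemma lam_set_bounded K : [set lam g | g in K] `<=` @bounded_op R L2.
Proof. by move=> _ [g _ <-]; exact: bounded_lam. Qed.

Lemma group_vn_bounded K : group_vn R K `<=` @bounded_op R L2.
Proof. exact: commutant_bounded. Qed.

Lemma group_vnE K : commutant (commutant (group_vn R K)) = group_vn R K.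
Proof. by rewrite /group_vn commutant3//; exact: commutant_bounded. Qed.

Lemma lam_group_vn K g : K g -> group_vn R K (lam g).
Proof. by move=> Kg; apply: sub_bicommutant; [exact: lam_set_bounded|exists g]. Qed.

Lemma group_vn_vna K : is_subgroup K -> von_neumann_algebra (group_vn R K).
Proof.
move=> [_ _ KV]; split; [exact: group_vn_bounded| |exact: group_vnE].
move=> T S AT bS TS; apply: commutant_adjoint AT bS TS => X cX.
exists (adj X); last by apply: adj_is_adjoint; exact: commutant_bounded cX.
have bX : bounded_op X by exact: commutant_bounded cX.
apply: commutant_adjoint cX (bounded_adj bX) (adj_is_adjoint bX) => _ [g Kg <-].
by exists (lam g^-1%g); [exists g^-1%g => //; exact: KV|exact: lam_adjoint].
Qed.

Lemma group_vn_sub K K' : K `<=` K' -> group_vn R K `<=` group_vn R K'.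
Proof.
by move=> KK'; apply: commutant_anti; apply: commutant_anti => _ [g /KK' Kg <-]; exists g.
Qed.

Lemma commutant_group_vn K T : bounded_op T ->
  (forall g, K g -> T \o lam g = lam g \o T) -> commutant (group_vn R K) T.
Proof.
move=> bT h; rewrite /group_vn commutant3; last exact: lam_set_bounded.
by split=> // _ [g Kg <-]; exact: h.
Qed.

Lemma rho_commutant K g : commutant (group_vn R K) (rho g).
Proof.
apply: commutant_group_vn => [|h _]; first exact: bounded_rho.
by apply/funext => v /=; rewrite lam_rho.
Qed.

Lemma group_vn_right_invariant K T : group_vn R K T -> right_invariant T.
Proof.
move=> KT g v; have [_ h] := rho_commutant K g.
by rewrite -[RHS]/((rho g \o T) v) h.
Qed.

Lemma group_vn_least P K : von_neumann_algebra P ->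
  (forall g, K g -> P (lam g)) -> group_vn R K `<=` P.
Proof.
move=> vP h; case: (vP) => _ _ <-; apply: commutant_anti; apply: commutant_anti => _ [g Kg <-].
exact: h.
Qed.

Lemma right_invariant_delta T g : right_invariant T ->
  T (delta R g) = rho g^-1%g (T d1).
Proof. by move=> rT; rewrite -rT rho_delta invgK mul1g. Qed.

Lemma adjoint_delta1 T T' : right_invariant T -> is_adjoint T T' ->
  T' d1 = Jconj (T d1).
Proof.
move=> rT TT'; apply: ell2_ext => k.
rewrite JE -hdot_delta (is_adjoint_sym TT') hdot_deltal.
by rewrite (right_invariant_delta k rT) rhoE mul1g.
Qed.

Lemma delta_dense (S : set L2) : subspace S -> (forall g, S (delta R g)) ->
  forall v, hclosure S v.
Proof.
move=> sS h v; have [p [pS hp]] := hprojection v sS.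
suff -> : v = p by [].
by apply/eqP; rewrite -subr_eq0; apply/eqP; apply: orth_delta_eq0 => g; exact: hp.
Qed.

Lemma vn_orbit_subspace A : von_neumann_algebra A -> subspace [set a d1 | a in A].
Proof.
move=> vA; split; first by exists (fun=> 0) => //; exact: vn_zero.
move=> c _ _ [a Aa <-] [b Ab <-]; exists (fun v => c *: a v + b v) => //.
exact: vn_lincomb.
Qed.

(* For T in the commutant of A, <T a d, d> = <T d, a^* d> = <T d, J a d> depends
   continuously on the vector a d; since A' is stable under right translations
   these matrix coefficients determine T x = x T. *)
Lemma vn_mem_of_closure A T : von_neumann_algebra A -> (forall a, A a -> right_invariant a) ->
  bounded_op T -> right_invariant T -> hclosure [set a d1 | a in A] (T d1) -> A T.
Proof.
move=> vA rA bT rT clT; apply: vn_bicommutant => // X cX.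
have bX := commutant_bounded cX.
have crho g : commutant A (rho g).
  split; first exact: bounded_rho.
  by move=> S AS; apply/funext => v /=; rewrite rA.
have key Y : commutant A Y -> hdot L2 (Y (T d1)) d1 = hdot L2 (T (Y d1)) d1.
  move=> cY; have bY := commutant_bounded cY; have [c c0 hc] := bounded_op_pos bY.
  have aT := adj_is_adjoint bT; rewrite aT (adjoint_delta1 rT aT).
  have on_A w : [set a d1 | a in A] w -> hdot L2 (Y w) d1 = hdot L2 (Y d1) (Jconj w).
    move=> [a Aa <-]; have aa := adj_is_adjoint (vn_bounded vA Aa).
    have e : Y (a d1) = a (Y d1) := congr1 (fun F => F d1) (vn_commute Aa cY).
    rewrite e.
    rewrite (aa (Y d1) d1).
    by rewrite (adjoint_delta1 (rA _ Aa) aa).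
  have cont (z : L2) (w : L2) : hnorm z = 1 -> `|rdot (Y w) z| <= c * hnorm w.
    by move=> z1; apply: le_trans (rdot_norm_le _ _) _; rewrite z1 mulr1.
  have JB (u v : L2) : Jconj (u - v) = Jconj u - Jconj v.
    by rewrite JD -scaleN1r JZ rmorphN rmorph1 scaleN1r.
  have Y1 := hc d1; rewrite hnorm_delta mulr1 in Y1.
  have contJ (w : L2) : `|rdot (Y d1) w| <= c * hnorm w.
    by apply: le_trans (rdot_norm_le _ _) _; rewrite ler_wpM2r ?hnorm_ge0.
  have cc : 0 <= c + c by lra.
  rewrite !hdot_rdot; congr (_ +i* _)%C; apply/eqP; rewrite -subr_eq0; apply/eqP.
    apply: (hclosure_functional (F := fun w => rdot (Y w) d1 - rdot (Y d1) (Jconj w)) cc) clT.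
    - by move=> u v; rewrite (linopB bY.1) JB rdotBl rdotBr; exact: subB_AC.
    - move=> u; apply: le_trans (ler_normB _ _) _.
      rewrite mulrDl; apply: lerD; first by apply: cont; exact: hnorm_delta.
      by rewrite -(hnorm_J u) contJ.
    by move=> s hs; rewrite /rdot on_A// subrr.
  apply: (hclosure_functional (F := fun w => rdot (Y w) ('i%C *: d1) -
     rdot (Y d1) ('i%C *: Jconj w)) cc) clT.
  - move=> u v.
    rewrite (linopB bY.1).
    rewrite JB.
    rewrite (scalerBr 'i%C (Jconj u)).
    rewrite rdotBl.
    rewrite rdotBr.
    exact: subB_AC.
  - move=> u; apply: le_trans (ler_normB _ _) _.
    rewrite mulrDl; apply: lerD; first by apply: cont; rewrite hnorm_i hnorm_delta.
    by rewrite -(hnorm_J u) -(hnorm_i (Jconj u)) contJ.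
  by move=> s hs; rewrite !rdot_ir on_A// subrr.
apply: eq_on_delta => [||g]; try exact: bounded_op_comp.
apply: ell2_ext => h /=; rewrite -!hdot_delta.
have -> : delta R h = rho h^-1%g d1 by rewrite rho_delta invgK mul1g.
have -> : delta R g = rho g^-1%g d1 by rewrite rho_delta invgK mul1g.
have e u : hdot L2 u (rho h^-1%g d1) = hdot L2 (rho h u) d1 := esym (rho_adjoint h u d1).
rewrite !e -(rT h (X _)) (rT g^-1%g d1); apply: esym.
exact: (key (rho h \o X \o rho g^-1%g) (commutant_comp (commutant_comp (crho _) cX) (crho _))).
Qed.

(** The indicator function of K is invariant under left translation by K, so multiplication by it
    commutes with L(K); it also fixes delta_1. Hence it fixes T delta_1. *)
Lemma group_vn_support K T k : is_subgroup K -> group_vn R K T -> ~ K k -> (T d1)$[k] = 0.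
Proof.
move=> [K1 KM KV] KT nk.
pose m x : C := if pselect (K x) then 1 else 0.
have m1 x : normsq (m x) <= 1.
  by rewrite /m /normsq; case: pselect => _ /=; rewrite ?expr1n ?expr0n ?addr0.
have mK g x : K g -> m (g * x)%g = m x.
  move=> Kg; rewrite /m; case: pselect => h1; case: pselect => h2 //; exfalso.
    by apply: h2; rewrite -(mulKg g x); apply: KM => //; exact: KV.
  by apply: h1; exact: KM.
have cm : commutant (group_vn R K) (mulop m).
  apply: commutant_group_vn => [|g Kg]; first exact: bounded_mulop.
  apply/funext => v; apply: ell2_ext => x /=.
  by rewrite (mulopE m1) !lamE (mulopE m1) mK//; exact: KV.
have d1m : mulop m d1 = d1.
  apply: ell2_ext => x; rewrite (mulopE m1) deltaE; case: eqP => [->|_]; last by rewrite mulr0.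
  by rewrite /m; case: (pselect (K 1%g)) => [?|//] /=; rewrite mul1r.
have e : mulop m (T d1) = T (mulop m d1) := congr1 (fun F => F d1) (vn_commute KT cm).
rewrite -d1m -e (mulopE m1) /m; case: (pselect (K k)) => [//|?] /=; by rewrite mul0r.
Qed.

(** The projection of T delta_1 onto the closure of L(K) delta_1 is T delta_1 itself: on K the
    coordinates agree because delta_k = lam_k delta_1 lies in the subspace, and off K both vanish.
    Membership then follows from [vn_mem_of_closure]. *)
Lemma group_vn_of_support K T : is_subgroup K -> bounded_op T -> right_invariant T ->
  (forall k, ~ K k -> (T d1)$[k] = 0) -> group_vn R K T.
Proof.
move=> sK bT rT supp; have vK := group_vn_vna sK.
apply: vn_mem_of_closure => //; first by move=> a; exact: group_vn_right_invariant.
have [p [pS hp]] := hprojection (T d1) (vn_orbit_subspace vK).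
suff -> : T d1 = p by [].
apply: ell2_ext => k; have [Kk|nk] := pselect (K k).
  apply/eqP; rewrite -subr_eq0 -ell2_valN -ell2_valD -hdot_delta hp//.
  by exists (lam k); [exact: lam_group_vn|rewrite lam_delta mulg1].
rewrite supp// -hdot_delta hdotC (hclosure_orth pS) ?rmorph0// => _ [a Ka <-].
by rewrite hdot_deltal (group_vn_support sK Ka nk) rmorph0.
Qed.

Lemma ell2_infinite_orbit f (O : set G) (c : R) : (forall x, O x -> normsq f$[x] = c) ->
  (forall s : seq G, exists2 x, O x & x \notin s) -> c = 0.
Proof.
move=> Oc Oinf.
have [x0 Ox0 _] := Oinf [::]; have c0 : 0 <= c by rewrite -(Oc _ Ox0) normsq_ge0.
have long n : exists s : seq G, [/\ uniq s, size s = n & forall x, x \in s -> O x].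
  elim: n => [|n [s [us ss Os]]]; first by exists [::].
  have [x Ox xs] := Oinf s; exists (x :: s); split => /=; rewrite ?xs ?us ?ss//.
  by move=> y; rewrite inE => /predU1P[->|/Os].
apply/eqP; rewrite eq_le c0 andbT; apply: contrapT => /negP; rewrite -ltNge => cp.
have [s [us ss Os]] := long (Num.bound (hnorm f ^+ 2 / c)).
have := bessel_seq f us; rewrite big_seq (eq_bigr (fun=> c)); last by move=> x /Os/Oc.
rewrite -big_seq big_const_seq count_predT iter_addr_0 ss leNgt => /negP; apply.
have : 0 <= hnorm f ^+ 2 / c by rewrite divr_ge0 ?sqr_ge0.
by move=> /archi_boundP; rewrite ltr_pdivrMr// mulr_natl.
Qed.

(** * Algebras between L(K) and L(G) *)

Section Intermediate.
Variables (N K : set G).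
Hypotheses (sK : is_subgroup K) (NK : N `<=` K)
  (NV : forall n, N n -> N n^-1%g)
  (normalN : forall n g, N n -> N (g^-1 * n * g)%g)
  (iccN : forall y, (exists s : seq G, forall n, N n -> (n * y * n^-1)%g \in s) -> y = 1%g).

(* The projection of delta_g onto the closure of P delta_1 is invariant under
   x |-> n x (g^-1 n g)^-1, whose orbits are the N-conjugacy classes translated by g. *)
Lemma projection_delta P g : von_neumann_algebra P -> group_vn R K `<=` P ->
  P `<=` group_vn R setT ->
  hclosure [set a d1 | a in P] (delta R g) \/
  forall a, P a -> (a d1)$[g] = 0.
Proof.
move=> vP KP PG; set S := [set a d1 | a in P].
have sS : subspace S by exact: vn_orbit_subspace.
have [p [pS hp]] := hprojection (delta R g) sS.
have rP a : P a -> right_invariant a by move=> /PG; exact: group_vn_right_invariant.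
(* tau n fixes delta_g. It also preserves P delta_1, because on delta_1 the right translation agrees
   with left translation by the inverse and can be absorbed into P. So it fixes the projection p. *)
pose tau n (f : L2) := rho (g^-1 * n * g)%g (lam n f).
have tau_norm n f : hnorm (tau n f) = hnorm f by rewrite hnorm_rho hnorm_lam.
have tauD n u v : tau n (u + v) = tau n u + tau n v.
  by rewrite /tau (linopD (lam_linear n)) (linopD (rho_linear _)).
have tauB n u v : tau n (u - v) = tau n u - tau n v.
  by rewrite /tau (linopB (lam_linear n)) (linopB (rho_linear _)).
have tau_delta n : tau n (delta R g) = delta R g.
  rewrite /tau lam_delta rho_delta; congr delta.
  by rewrite !invgM invgK !mulgA mulgK mulgV mul1g.
have tauS n s : N n -> S s -> S (tau n s).
  move=> Nn [a Pa <-]; exists (lam n \o a \o lam (g^-1 * n * g)^-1%g).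
    apply: (vn_comp vP).
      by apply: (vn_comp vP) Pa; apply: KP; apply: lam_group_vn; exact: NK.
    by apply: KP; apply: lam_group_vn; apply: NK; apply: NV; exact: normalN.
  rewrite /= lam_delta mulg1 /tau -lam_rho -(rP _ Pa); congr (lam n (a _)).
  by rewrite rho_delta mul1g.
have tau_hS n v : N n -> hclosure S v -> hclosure S (tau n v).
  move=> Nn vS e /vS[s Ss vs]; exists (tau n s); first exact: tauS.
  by rewrite -tauB tau_norm.
have tauK n f : tau n (tau n^-1%g f) = f.
  rewrite /tau lam_rho rhoM lamM mulgV lam1.
  have -> : (g^-1 * n * g * (g^-1 * n^-1 * g))%g = 1%g.
    by rewrite -!mulgA mulVKg mulVKg mulVg.
  exact: rho1.
have rdotS s : S s -> rdot (delta R g - p) s = 0 by move=> Ss; rewrite /rdot hp.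
have rdot_hS v : hclosure S v -> rdot (delta R g - p) v = 0.
  by move=> vS; rewrite /rdot (hclosure_orth vS hp).
have p_inv n : N n -> tau n p = p.
  move=> Nn.
  have hB := hclosureB sS pS (tau_hS _ _ Nn pS).
  apply: esym; apply: (@projection_unique _ _ (delta R g)); first exact: rdot_hS.
  have -> : delta R g - tau n p = tau n (delta R g - p) by rewrite tauB tau_delta.
  rewrite -[p - tau n p](tauK n) isometry_rdot => [|u v|u]; [|exact: tauD|exact: tau_norm].
  by apply: rdot_hS; apply: (tau_hS) hB; exact: NV.
have pE : p = p$[g] *: delta R g.
  apply: ell2_ext => x; rewrite ell2_valZ deltaE.
  have [->|xg] := eqVneq x g; first by rewrite mulr1.
  rewrite mulr0.
  pose O := [set (n * (x * g^-1) * n^-1 * g)%g | n in N].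
  have : normsq p$[x] = 0.
    apply: (@ell2_infinite_orbit p O).
      move=> _ [n Nn <-]; rewrite -{1}(p_inv n Nn) /tau rhoE lamE.
      congr (normsq (p$[_])).
      by rewrite !mulgA mulVg mul1g mulgK !mulgVK.
    move=> s; apply: contrapT => /forall2NP h.
    have : (x * g^-1)%g = 1%g.
      apply: iccN; exists [seq (y * g^-1)%g | y <- s] => n Nn.
      apply/mapP; exists (n * (x * g^-1) * n^-1 * g)%g; last by rewrite mulgK.
      have [hO|/negP/negPn//] := h (n * (x * g^-1) * n^-1 * g)%g.
      by exfalso; apply: hO; exists n.
    by move=> /divg1_eq e; move: xg; rewrite e eqxx.
  rewrite /normsq; case: (p$[x]) => a b /= /eqP.
  by rewrite paddr_eq0 ?sqr_ge0// !sqrf_eq0 => /andP[/eqP -> /eqP ->].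
have [c0|c0] := eqVneq (p$[g]) 0.
  right=> a Pa; have := hp _ (ex_intro2 _ _ a Pa erefl).
  by rewrite pE c0 scale0r subr0 hdot_deltal => /eqP; rewrite conjC_eq0 => /eqP.
left; move=> e e0.
have k0 : 0 < Num.sqrt (normsq (p$[g])^-1) + 1 by have := sqrtr_ge0 (normsq (p$[g])^-1); lra.
have [s Ss ps] := pS _ (divr_gt0 e0 k0).
exists ((p$[g])^-1 *: s).
  by rewrite -[_ *: s]addr0; apply: sS.2 => //; exact: sS.1.
have -> : delta R g - (p$[g])^-1 *: s = (p$[g])^-1 *: (p - s).
  rewrite scalerBr; congr (_ - _).
  by rewrite [X in _ = _ *: X]pE scalerA mulVf// scale1r.
rewrite hnormZ; have n0 := hnorm_ge0 (p - s); have n1 := sqrtr_ge0 (normsq (p$[g])^-1).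
rewrite ltr_pdivlMr// mulrC in ps; apply: le_lt_trans ps.
by rewrite ler_wpM2r//; lra.
Qed.

(** L consists of the g with lam_g in P. If g is outside L, then delta_g is not in the closure of P
    delta_1, since otherwise [vn_mem_of_closure] would put lam_g in P; the dichotomy then makes
    every a delta_1 vanish at g. *)
Lemma intermediate_vn P : von_neumann_algebra P -> group_vn R K `<=` P ->
  P `<=` group_vn R setT ->
  exists L, [/\ is_subgroup L, K `<=` L & P = group_vn R L].
Proof.
move=> vP KP PG; exists [set g | P (lam g)].
have sL : is_subgroup [set g | P (lam g)].
  split=> [|x y Px Py|x Px] /=.
  - by rewrite (_ : lam 1%g = id); [exact: vn_id|apply/funext => v; exact: lam1].
  - rewrite (_ : lam (x * y)%g = lam x \o lam y); first exact: vn_comp.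
    by apply/funext => v; rewrite /= lamM.
  case: vP => _ h _; apply: (h (lam x)) => //; [exact: bounded_lam|exact: lam_adjoint].
have rP a : P a -> right_invariant a by move=> /PG; exact: group_vn_right_invariant.
split=> //; first by move=> g Kg; apply: KP; exact: lam_group_vn.
apply/seteqP; split; last by apply: group_vn_least.
move=> a Pa; apply: group_vn_of_support => //; [exact: vn_bounded Pa|exact: rP|].
move=> g nPg; have [clg|h] := projection_delta g vP KP PG; last exact: h.
exfalso; apply: nPg; apply: (@vn_mem_of_closure P (lam g) vP rP).
- exact: bounded_lam.
- by move=> h v; rewrite lam_rho.
by rewrite lam_delta mulg1.
Qed.

End Intermediate.

End GroupAlgebras.

(** * Maximality of L(N x| K) for a maximal subgroup K of Q *)

Section MaximalSubgroup.
Variables (R : realType) (Q N : groupType) (sigma : group_action Q N).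
Local Notation GT := (sdprod sigma : groupType).

Lemma sd_over_subgroup (K : set Q) : is_subgroup K -> is_subgroup (sd_over sigma K).
Proof.
move=> [K1 KM KV]; split=> [|x y|x]; first exact: K1.
- by move=> Kx Ky; exact: KM.
- by move=> Kx; exact: KV.
Qed.

Lemma rip_icc : rip R sigma -> ~ elementary Q ->
  forall y : GT, finite_N_orbit y -> y = 1%g.
Proof.
move=> [_ [_ hyp] tf [out _]] nel y; apply: finite_N_orbit_trivial => //.
exact: nonelementary_infinite.
Qed.

(** A subgroup containing N is the preimage of its trace L' on Q, by the factorization g = n q;
    maximality of K is applied to L'. *)
Lemma sd_over_maximal (K : set Q) (L : set GT) : maximal_subgroup K -> is_subgroup L ->
  sd_over sigma K `<=` L -> L = sd_over sigma K \/ L = setT.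
Proof.
move=> [[K1 KM KV] _ Kmax] [L1 LM LV] KL.
have split_g (g : GT) : g = (sd_inl sigma g.1 * sd_inr sigma g.2)%g.
  by rewrite sd_mulE /= gact1 mulg1 mul1g; case: g.
have Linl n : L (sd_inl sigma n) by exact: KL.
pose L' : set Q := [set q | L (sd_inr sigma q)].
have LE (g : GT) : L g <-> L' g.2.
  split=> [Lg|L'g]; last by rewrite (split_g g); exact: LM.
  rewrite /L' /= -[sd_inr sigma g.2](mulKg (sd_inl sigma g.1)) -split_g.
  by apply: LM => //; exact: LV.
have sL' : is_subgroup L'.
  split=> [|x y Lx Ly|x Lx]; rewrite /L' /=.
  - exact: L1.
  - have -> : sd_inr sigma (x * y)%g = (sd_inr sigma x * sd_inr sigma y)%g.
      by rewrite sd_mulE /= gact_one mulg1.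
    exact: LM.
  by rewrite -sd_inr_inv; exact: LV.
have KL' : K `<=` L' by move=> q Kq; apply: KL.
case: (Kmax _ sL' KL') => e; [left|right]; apply/seteqP; split=> g //.
- by move=> /LE; rewrite e.
- by move=> Kg; apply: KL.
by move=> _; apply/LE; rewrite e.
Qed.

Lemma maximal_group_vn (K : set Q) : rip R sigma -> ~ elementary Q ->
  maximal_subgroup K ->
  maximal_vn_subalgebra (group_vn R (sd_over sigma K)) (group_vn R [set: GT]).
Proof.
move=> hrip nel Kmax; have sK := sd_over_subgroup (let: And3 h _ _ := Kmax in h).
split.
- exact: group_vn_vna.
- by apply: group_vn_vna; split.
- exact: group_vn_sub.
move=> [P [vP [KP nPK] [PG nGP]]].
have [L [sL KL eP]] : exists L : set GT,
    [/\ is_subgroup L, sd_over sigma K `<=` L & P = group_vn R L].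
  apply: (@intermediate_vn R GT [set g : GT | g.2 = 1%g]) vP KP PG => //.
  - by move=> g /= g2; rewrite /sd_over /= g2; case: Kmax => -[].
  - by move=> g /= ->; rewrite invg1.
  - by move=> n g /= ->; rewrite mulg1 mulVg.
  by move=> y [s hs]; apply: (rip_icc hrip nel); exists s => n; exact: hs.
case: (sd_over_maximal Kmax sL KL) => eL.
  by apply: nPK; rewrite eP eL.
by apply: nGP; rewrite eP eL.
Qed.

End MaximalSubgroup.

(** * Bimodules twisted by a character *)

Section NormalMaps.
Variables (R : realType) (H : hilbert R).
Implicit Types (D M : set (H -> H)) (S T X Y : H -> H).

(** Normality takes suprema inside M on the source and among all bounded operators on the target.
    The two notions agree because the strong limit of D commutes with the commutant of M and so lies
    in M. *)
Lemma op_lub_bounded M D X : von_neumann_algebra M -> D `<=` M ->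
  (forall S, D S -> is_adjoint S S) -> op_directed D -> op_lub M D X ->
  op_lub (@bounded_op R H) D X.
Proof.
move=> vM DM sD dD [MX ubX lubX].
have bD S : D S -> bounded_op S by move=> /DM; exact: vn_bounded.
have [Y [bY _ ubY lubY limY]] := monotone_limit bD sD dD (vn_bounded vM MX) ubX.
have MY : M Y.
  apply: vn_bicommutant => // B cB; apply: esym.
  apply: strong_limit_commute limY (commutant_bounded cB) _ => // S /DM MS.
  exact: (vn_commute MS cB).
split=> // [|T bT ubT]; first exact: vn_bounded MX.
exact: op_le_trans (lubX _ MY ubY) (lubY _ ubT).
Qed.

(** On quadratic forms pi is a change of variable with inverse pi', hence an order isomorphism. U
    and V are plain bijections, so that the antilinear [Jconj] is covered as well as the unitary
    twist. *)
Lemma op_lub_transport D X (pi pi' : (H -> H) -> (H -> H)) (U V : H -> H) :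
  (forall S, bounded_op S -> bounded_op (pi S)) ->
  (forall S, bounded_op S -> bounded_op (pi' S)) ->
  (forall S v, bounded_op S -> hdot H (pi S v) v = hdot H (S (V v)) (V v)) ->
  (forall S v, bounded_op S -> hdot H (pi' S v) v = hdot H (S (U v)) (U v)) ->
  cancel V U -> cancel U V -> D `<=` @bounded_op R H ->
  op_lub (@bounded_op R H) D X -> op_lub (@bounded_op R H) (pi @` D) (pi X).
Proof.
move=> bpi bpi' piE pi'E VU UV bD [bX ubX lubX]; split; first exact: bpi.
  by move=> _ [S DS <-] v; rewrite !piE//; [exact: ubX|exact: bD].
move=> T bT ubT v; rewrite piE//.
have h : op_le X (pi' T).
  apply: lubX => [|S DS w]; first exact: bpi'.
  have := ubT _ (ex_intro2 _ _ S DS erefl) (U w).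
  by rewrite piE ?pi'E ?UV//; exact: bD.
by have := h (V v); rewrite pi'E// VU.
Qed.

End NormalMaps.

Section TwistedCorrespondence.
Variables (R : realType) (G : groupType) (K : set G) (m : G -> R[i]).
Local Notation C := R[i].
Local Notation L2 := (ell2_hilbert R G).
Local Notation lam := (@left_translation R G).
Local Notation rho := (@rho R G).
Local Notation Jconj := (@Jconj R G).
Local Notation d1 := (delta R (1%g : G)).
Local Notation "f $[ x ]" := (ell2_val f x) (at level 1, format "f $[ x ]").
Implicit Types (f u v w : L2) (S T X Y : L2 -> L2).
Hypotheses (sK : is_subgroup K) (mm : forall x, normsq (m x) = 1)
  (mK : forall k x, K k -> m (k * x)%g = m k * m x).

Let mc x : C := ((m x)^*)%C.

Let m_le x : normsq (m x) <= 1. Proof. by rewrite mm. Qed.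
Let mc_le x : normsq (mc x) <= 1. Proof. by rewrite normsq_conj mm. Qed.

Let mcm x : mc x * m x = 1.
Proof.
have := mm x; rewrite /mc; case: (m x) => a b; rewrite /normsq /= => e.
by apply/eqP; rewrite eq_complex /=; apply/andP; split; apply/eqP; lra.
Qed.

Let mmc x : m x * mc x = 1. Proof. by rewrite mulrC mcm. Qed.

Local Notation D := (mulop m).
Local Notation D' := (mulop mc).

Let DK : cancel D D'.
Proof. by move=> f; apply: ell2_ext => x; rewrite (mulopE mc_le) (mulopE m_le) mulrA mcm mul1r. Qed.

Let D'K : cancel D' D.
Proof. by move=> f; apply: ell2_ext => x; rewrite (mulopE m_le) (mulopE mc_le) mulrA mmc mul1r. Qed.

Let bD : bounded_op D. Proof. exact: bounded_mulop. Qed.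
Let bD' : bounded_op D'. Proof. exact: bounded_mulop. Qed.

Let normD f : hnorm (D f) = hnorm f.
Proof.
apply/eqP; rewrite eq_le (mulop_aux m_le f).2 /=.
by rewrite -{1}(DK f) (mulop_aux mc_le (D f)).2.
Qed.

Let adjD : is_adjoint D D'.
Proof. by apply: isometry_adjoint => //; exact: bD.1. Qed.

(** Conjugation by the unitary [mulop m]; on lam_k with k in K it is multiplication by the character
    value m k. *)
Definition twist_left T : L2 -> L2 := D \o T \o D'.

(** The standard right action on l^2(G): taking adjoints reverses products, and conjugating by J
    makes the map linear again. It sends lam_k to right translation by k^-1. *)
Definition twist_right T : L2 -> L2 := Jconj \o adj T \o Jconj.

Lemma twist_left_bounded T : bounded_op T -> bounded_op (twist_left T).
Proof. by move=> bT; exact: bounded_op_comp bD (bounded_op_comp bT bD'). Qed.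

Lemma adj_adjoint T S : bounded_op T -> is_adjoint T S -> adj T = S.
Proof. by move=> bT TS; apply: adjoint_unique (adj_is_adjoint bT) TS. Qed.

Lemma J_bounded T : bounded_op T -> bounded_op (Jconj \o T \o Jconj).
Proof.
move=> bT; have [c c0 hc] := bounded_op_pos bT; split=> [a u v /=|].
  rewrite JD JZ bT.1 JD JZ; congr (_ *: _ + _).
  by case: a => a b /=; rewrite opprK.
by exists c => v /=; rewrite hnorm_J -(hnorm_J v); exact: hc.
Qed.

Lemma twist_right_bounded T : bounded_op T -> bounded_op (twist_right T).
Proof. by move=> bT; apply: J_bounded; exact: bounded_adj. Qed.

Lemma twist_left_form S v : bounded_op S ->
  hdot L2 (twist_left S v) v = hdot L2 (S (D' v)) (D' v).
Proof. by move=> _; rewrite -[LHS]/(hdot L2 (D (S (D' v))) v) adjD. Qed.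

Lemma untwist_form S v : bounded_op S ->
  hdot L2 ((D' \o S \o D) v) v = hdot L2 (S (D v)) (D v).
Proof.
by move=> _; rewrite -[LHS]/(hdot L2 (D' (S (D v))) v) (is_adjoint_sym adjD).
Qed.

Lemma hdot_J u v : hdot L2 (Jconj u) v = hdot L2 (Jconj v) u.
Proof.
have re w z : rdot (Jconj w) z = rdot (Jconj z) w by rewrite -rdot_J JK rdotC.
rewrite (hdot_rdot (Jconj u) v) (hdot_rdot (Jconj v) u) (re u v); congr (_ +i* _)%C.
rewrite (re u ('i%C *: v)) (JZ 'i%C v).
have -> : (('i : C)^*)%C = - 'i%C by apply/eqP; rewrite eq_complex /= oppr0 !eqxx.
by rewrite scaleNr rdotNl rdot_il opprK rdot_ir.
Qed.

Lemma twist_right_form S v : bounded_op S ->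
  hdot L2 (twist_right S v) v = hdot L2 (S (Jconj v)) (Jconj v).
Proof.
move=> bS; rewrite -[LHS]/(hdot L2 (Jconj (adj S (Jconj v))) v) hdot_J.
by rewrite -(adj_is_adjoint bS (Jconj v) (Jconj v)).
Qed.

Let vK : von_neumann_algebra (group_vn R K). Proof. exact: group_vn_vna. Qed.

Let bM T : group_vn R K T -> bounded_op T. Proof. exact: commutant_bounded. Qed.

Lemma twist_left_normal : normal_star_map (group_vn R K) twist_left.
Proof.
split.
- by move=> x /bM; exact: twist_left_bounded.
- by move=> a x y _ _; apply/funext => w; rewrite /twist_left /= bD.1.
- by apply/funext => w; exact: D'K.
- move=> x y _ _ xy u v; rewrite -[LHS]/(hdot L2 (D (x (D' u))) v) adjD xy.
  by rewrite (is_adjoint_sym adjD).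
move=> E x EM sE dE lub; apply: op_lub_transport (fun S => D' \o S \o D) D D' _ _ _ _ _ _ _ _.
- exact: twist_left_bounded.
- by move=> S bS; exact: bounded_op_comp bD' (bounded_op_comp bS bD).
- exact: twist_left_form.
- exact: untwist_form.
- exact: D'K.
- exact: DK.
- by move=> S /EM/bM.
exact: op_lub_bounded vK EM sE dE lub.
Qed.

Lemma adj_lincomb a S T : bounded_op S -> bounded_op T ->
  adj (fun v => a *: S v + T v) = (fun v => (a^*)%C *: adj S v + adj T v).
Proof.
move=> bS bT; apply/funext => v; apply: ell2_ext => x.
rewrite ell2_valD ell2_valZ (adjE _ _ (bounded_op_lincomb a bS bT)) !adjE//.
by rewrite hdotDr hdotZr.
Qed.

Lemma adj_comp S T : bounded_op S -> bounded_op T -> adj (S \o T) = adj T \o adj S.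
Proof.
move=> bS bT; apply: adj_adjoint; first exact: bounded_op_comp.
by move=> u v /=; rewrite (adj_is_adjoint bS) (adj_is_adjoint bT).
Qed.

Lemma adj_id : adj (@id L2) = id.
Proof. by apply: adj_adjoint; first exact: bounded_op_id. Qed.

Lemma twist_right_normal : normal_star_map (group_vn R K) twist_right.
Proof.
split.
- by move=> x /bM; exact: twist_right_bounded.
- move=> a x y /bM bx /bM y_b; apply/funext => w.
  rewrite /twist_right adj_lincomb//= JD JZ; congr (_ *: _ + _).
  by case: a => a b /=; rewrite opprK.
- by apply/funext => w; rewrite /twist_right adj_id /= JK.
- move=> x y /bM bx /bM y_b xy; have -> : y = adj x by rewrite (adj_adjoint bx xy).
  have axx : adj (adj x) = x by apply: adj_adjoint; [exact: bounded_adj|exact: is_adjoint_sym (adj_is_adjoint bx)].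
  apply: is_adjointP => [b u|u v]; first exact: (linopZ (twist_right_bounded bx).1).
  rewrite -[LHS]/(rdot (Jconj (adj x (Jconj u))) v) -[RHS]/(rdot u (Jconj (adj (adj x) (Jconj v)))).
  rewrite axx -rdot_J JK -(rdot_J u) JK.
  by rewrite (adjoint_rdot (is_adjoint_sym (adj_is_adjoint bx))).
move=> E x EM sE dE lub; apply: op_lub_transport twist_right Jconj Jconj _ _ _ _ _ _ _ _.
- exact: twist_right_bounded.
- exact: twist_right_bounded.
- exact: twist_right_form.
- exact: twist_right_form.
- exact: JK.
- exact: JK.
- by move=> S /EM/bM.
exact: op_lub_bounded vK EM sE dE lub.
Qed.

Let D_lam k f : K k -> D (lam k f) = m k *: lam k (D f).
Proof.
move=> Kk; apply: ell2_ext => x; rewrite (mulopE m_le) ell2_valZ !lamE (mulopE m_le).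
by rewrite mulrA -mK// mulVKg.
Qed.

Let D'_lam k f : K k -> D' (lam k f) = mc k *: lam k (D' f).
Proof.
move=> Kk; apply: (can_inj DK); rewrite D'K (linopZ bD.1) D_lam// D'K.
by rewrite scalerA mcm scale1r.
Qed.

(** The unitary D rescales each lam_k, so conjugation by D preserves the commutant of L(K), hence
    L(K). This is why the twisted left action still commutes with the right one. *)
Lemma twist_left_group_vn T : group_vn R K T -> group_vn R K (twist_left T).
Proof.
move=> KT; apply: (vn_bicommutant vK); first exact/twist_left_bounded/bM.
move=> S cS; have bS := commutant_bounded cS.
have SL k v : K k -> S (lam k v) = lam k (S v).
  move=> Kk; exact: (congr1 (fun F => F v) (vn_commute (lam_group_vn R Kk) cS)).
have cS' : commutant (group_vn R K) (D' \o S \o D).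
  apply: commutant_group_vn; first exact: bounded_op_comp bD' (bounded_op_comp bS bD).
  move=> k Kk; apply/funext => v /=.
  by rewrite D_lam// (linopZ bS.1) (linopZ bD'.1) SL// D'_lam// scalerA mmc scale1r.
apply/funext => v.
have e : D' (S (D (T (D' v)))) = T (D' (S (D (D' v)))) := congr1 (fun F => F (D' v)) (vn_commute KT cS').
by rewrite /twist_left /= -[in RHS](D'K (S _)) e D'K.
Qed.

Lemma twist_right_commutant T : group_vn R K T ->
  commutant (group_vn R setT) (twist_right T).
Proof.
move=> KT; apply: commutant_group_vn; first exact/twist_right_bounded/bM.
move=> k _; apply/funext => v; rewrite /twist_right /=.
have ra : right_invariant (adj T).
  apply: (@group_vn_right_invariant _ _ K); case: vK => _ h _.
  exact: (h T (adj T) KT (bounded_adj (bM KT)) (adj_is_adjoint (bM KT))).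
have Jl z : Jconj (lam k z) = rho k (Jconj z) by rewrite -J_lam JK.
have Jr z : Jconj (rho k z) = lam k (Jconj z) by rewrite -[z in LHS]JK -Jl JK.
by rewrite Jl ra Jr.
Qed.

Lemma twisted_correspondence : correspondence (group_vn R K) twist_left twist_right.
Proof.
split; [exact: twist_left_normal|exact: twist_right_normal| | |].
- by move=> x y _ _; apply/funext => v; rewrite /twist_left /= DK.
- move=> x y /bM bx /bM y_b; apply/funext => v.
  by rewrite /twist_right (adj_comp bx y_b) /= JK.
move=> x y Mx My.
have h : group_vn R setT (twist_left x) by apply: group_vn_sub (twist_left_group_vn Mx).
exact: (esym (vn_commute h (twist_right_commutant My))).
Qed.

Lemma twist_left_lam k v : K k -> twist_left (lam k) v = m k *: lam k v.
Proof. by move=> Kk; rewrite /twist_left /= D_lam// D'K. Qed.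

Lemma twist_right_lam k v : twist_right (lam k) v = rho k^-1%g v.
Proof.
rewrite /twist_right /= (adj_adjoint (bounded_lam R k) (lam_adjoint k)).
exact: J_lam.
Qed.

Lemma m1_one : m 1%g = 1.
Proof.
case: (sK) => K1 _ _; have := mK 1%g K1; rewrite mulg1 => e.
by rewrite -[LHS]mul1r -(mcm 1%g) -mulrA -e.
Qed.

(** Almost centrality of delta_1 thus depends only on how far the phases move the vectors T
    delta_1. *)
Lemma twist_vacuum T : group_vn R K T ->
  twist_left T d1 - twist_right T d1 = mulop m (T d1) - T d1.
Proof.
move=> KT; have bT := bM KT.
have D'1 : D' d1 = d1.
  apply: ell2_ext => x; rewrite (mulopE mc_le) deltaE.
  case: eqP => [->|_]; last by rewrite mulr0.
  by rewrite mulr1 /mc m1_one rmorph1.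
have -> : twist_left T d1 = mulop m (T d1) by rewrite /twist_left /= D'1.
have -> // : twist_right T d1 = T d1.
rewrite /twist_right /= J_delta invg1.
rewrite (adjoint_delta1 (group_vn_right_invariant KT) (adj_is_adjoint bT)).
exact: JK.
Qed.

(** Centrality makes |eta| constant on K-conjugation orbits, so infinite orbits leave only the
    coordinate at 1. Comparing coordinates at x = k then gives m k eta(1) = eta(1). *)
Lemma twisted_central_vector eta :
  (forall y, (exists s : seq G, forall k, K k -> (k * y * k^-1)%g \in s) -> y = 1%g) ->
  (forall k, K k -> twist_left (lam k) eta = twist_right (lam k) eta) ->
  eta <> 0 -> forall k, K k -> m k = 1.
Proof.
move=> icc central eta0.
have ce k x : K k -> m k * eta$[(k^-1 * x)%g] = eta$[(x * k^-1)%g].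
  move=> Kk; have := central k Kk; rewrite twist_left_lam// twist_right_lam.
  by move=> /(congr1 (fun f => f$[x])); rewrite ell2_valZ lamE rhoE.
have inv y k : K k -> normsq eta$[(k * y * k^-1)%g] = normsq eta$[y].
  by move=> Kk; rewrite -(ce k (k * y)%g Kk) mulKg normsqM mm mul1r.
have supp y : y <> 1%g -> eta$[y] = 0.
  move=> y1; have : normsq eta$[y] = 0.
    apply: (@ell2_infinite_orbit _ _ eta [set (k * y * k^-1)%g | k in K]).
      by move=> _ [k Kk <-]; exact: inv.
    move=> s; apply: contrapT => h; apply: y1; apply: icc; exists s => k Kk.
    by apply: contrapT => ns; apply: h; exists (k * y * k^-1)%g; [exists k|exact/negP].
  rewrite /normsq; case: (eta$[y]) => a b /= /eqP.
  by rewrite paddr_eq0 ?sqr_ge0// !sqrf_eq0 => /andP[/eqP -> /eqP ->].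
have eta1 : eta$[1%g] != 0.
  apply/eqP => e; apply: eta0; apply: ell2_ext => x; rewrite ell2_val0.
  by have [->|] := pselect (x = 1%g); [exact: e|exact: supp].
move=> k Kk; have := ce k k Kk; rewrite mulVg mulgV => e.
by apply: (mulIf eta1); rewrite mul1r.
Qed.

End TwistedCorrespondence.

Section CharacterTwist.
Variables (R : realType) (G : groupType) (K : set G) (theta : G -> R).
Local Notation C := R[i].
Local Notation L2 := (ell2_hilbert R G).
Local Notation "f $[ x ]" := (ell2_val f x) (at level 1, format "f $[ x ]").
Hypotheses (sK : is_subgroup K)
  (thetaK : forall k x, K k -> theta (k * x)%g = theta k + theta x).

Definition phase (t : R) (x : G) : C := (cos (t * theta x) +i* sin (t * theta x))%C.

Lemma phase_norm t x : normsq (phase t x) = 1.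
Proof. by rewrite /normsq /= cos2Dsin2. Qed.

Lemma phaseK t k x : K k -> phase t (k * x)%g = phase t k * phase t x.
Proof.
move=> Kk; rewrite /phase thetaK// mulrDr cosD sinD.
by apply/eqP; rewrite eq_complex /= eqxx /= addrC.
Qed.

(** The quantity 2 - 2 cos (t a) is the squared modulus of exp(i t a) - 1. *)
Lemma cos_near0 (a e : R) : 0 < e -> exists2 t0, 0 < t0 &
  forall t, 0 < t -> t < t0 -> 2 - 2 * cos (t * a) < e.
Proof.
move=> e0; have e2 : 0 < e / 2 by rewrite divr_gt0.
have /cvgrPdist_lt/(_ _ e2) := @continuous_cos R 0.
move=> /nbhs_ballP[d /= d0 hd]; have a1 : 0 < `|a| + 1 by have := normr_ge0 a; lra.
exists (d / (`|a| + 1)) => [|t t0 td]; first by rewrite divr_gt0.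
have : `|0 - t * a| < d.
  rewrite sub0r normrN normrM (gtr0_norm t0); move: td; rewrite ltr_pdivlMr//.
  apply: le_lt_trans; rewrite ler_pM2l//; lra.
move=> /hd /=; rewrite cos0 => /ltr_normlW; lra.
Qed.

(** The phases act as contractions uniformly in t, so convergence on the dense span of the delta_g
    suffices; on delta_g it is [cos_near0]. *)
Lemma phase_mulop_cvg (f : L2) (e : R) : 0 < e -> exists2 t0, 0 < t0 &
  forall t, 0 < t -> t < t0 -> hnorm (mulop (phase t) f - f) < e.
Proof.
have ph_le t x : normsq (phase t x) <= 1 by rewrite phase_norm.
pose S := [set f : L2 | forall e : R, 0 < e -> exists2 t0, 0 < t0 &
  forall t, 0 < t -> t < t0 -> hnorm (mulop (phase t) f - f) < e].
have bD t := bounded_mulop (ph_le t).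
have nD t v : hnorm (mulop (phase t) v) <= hnorm v by exact: (mulop_aux (ph_le t) v).2.
have S_lin a u v : S u -> S v -> S (a *: u + v).
  move=> Su Sv e0 e00; set k := Num.sqrt (normsq a); have k0 : 0 <= k by exact: sqrtr_ge0.
  have e1 : 0 < e0 / (k + 1) by rewrite divr_gt0//; lra.
  have [t1 t10 h1] := Su _ e1; have [t2 t20 h2] := Sv _ e1.
  exists (minr t1 t2) => [|t t0]; first by rewrite lt_min t10.
  rewrite lt_min => /andP[lt1 lt2].
  have -> : mulop (phase t) (a *: u + v) - (a *: u + v) =
     a *: (mulop (phase t) u - u) + (mulop (phase t) v - v).
    by rewrite (bD t).1 (scalerBr a (mulop (phase t) u) u) opprD addrACA.
  apply: le_lt_trans (hnormD _ _) _; rewrite hnormZ -/k.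
  have h3 := h1 t t0 lt1; have h4 := h2 t t0 lt2.
  have h5 : k * hnorm (mulop (phase t) u - u) <= k * (e0 / (k + 1)).
    by rewrite ler_wpM2l// ltW.
  have -> : e0 = k * (e0 / (k + 1)) + e0 / (k + 1) by field; rewrite gt_eqF//; lra.
  exact: ler_ltD.
have S0 : S 0.
  move=> e0 e00; exists 1 => // t _ _.
  by rewrite (linop0 (bD t).1) subrr hnorm0.
have S_delta g : S (delta R g).
  move=> e0 e00; have [t0 t00 ht] := cos_near0 (theta g) (exprn_gt0 2 e00).
  exists t0 => // t tp tt0.
  have -> : mulop (phase t) (delta R g) - delta R g = (phase t g - 1) *: delta R g.
    apply: ell2_ext => x; rewrite ell2_valD ell2_valN ell2_valZ (mulopE (ph_le t)) deltaE.
    by case: eqP => [->|_]; rewrite ?mulr1 ?mulr0 ?subrr.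
  rewrite hnormZ hnorm_delta mulr1 -ltr_sqr ?nnegrE ?sqrtr_ge0 ?ltW// sqr_sqrtr ?normsq_ge0//.
  apply: le_lt_trans (ht t tp tt0); rewrite /normsq /= subr0.
  have := cos2Dsin2 (t * theta g); nra.
move=> e0; have [e3 lt3] : 0 < e / 3 /\ e / 3 + e / 3 + e / 3 = e by split; lra.
have [s Ss fs] := delta_dense (conj S0 S_lin) S_delta f e3.
have [t0 t00 ht] := Ss _ e3; exists t0 => // t tp tt0.
apply: le_lt_trans (hnorm_tri (mulop (phase t) s) _ _) _.
rewrite -(linopB (bD t).1).
apply: le_lt_trans (lerD (nD t _) (hnorm_tri s _ _)) _.
by rewrite (hnormB s f) -lt3 -addrA; exact: ltrD fs (ltrD (ht t tp tt0) fs).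
Qed.

(* The identity bimodule twisted by a character close to 1 has an almost central
   vector, but no central vector since the character is not trivial. *)
Lemma twisted_not_property_T (k0 : G) : K k0 -> theta k0 <> 0 ->
  (forall y, (exists s : seq G, forall k, K k -> (k * y * k^-1)%g \in s) -> y = 1%g) ->
  ~ property_T_vn (group_vn R K).
Proof.
move=> Kk0 tk0 icc [F [eps [finF FM eps0 hT]]].
(* By [twist_vacuum] the finite set F of operators matters only through the vectors x delta_1. *)
have /finite_seqP[s hs] : finite_set [set x (delta R (1%g : G)) | x in F].
  exact: finite_image.
have [t1 t10 ht1] : exists2 t1, 0 < t1 & forall t, 0 < t -> t < t1 ->
    forall v, v \in s -> hnorm (mulop (phase t) v - v) < eps.
  elim: (s) => [|v s' [t1 t10 ht1]]; first by exists 1.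
  have [t2 t20 ht2] := phase_mulop_cvg v eps0.
  exists (minr t1 t2) => [|t t0]; first by rewrite lt_min t10.
  rewrite lt_min => /andP[lt1 lt2] w; rewrite inE => /predU1P[->|ws].
    exact: ht2.
  exact: ht1.
have a0 : 0 < `|theta k0| by rewrite normr_gt0; exact/eqP.
(* The first bound gives almost centrality. The second keeps t |theta k0| in (0, 1], below pi, so
   that its sine is nonzero and the character is not 1 at k0. *)
pose t := minr (t1 / 2) (1 / `|theta k0|).
have tp : 0 < t by rewrite lt_min !divr_gt0.
have tt1 : t < t1 by rewrite gt_min; apply/orP; left; lra.
have corr := twisted_correspondence sK (phase_norm t) (phaseK t).
have [||eta eta0 central] := hT _ _ _ (delta R (1%g : G)) corr.
- exact: hnorm_delta.
- move=> x Fx; rewrite (twist_vacuum sK (phase_norm t) (phaseK t) (FM _ Fx)).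
  apply: ht1 => //; have : [set x (delta R (1%g : G)) | x in F] (x (delta R (1%g : G))) by exists x.
  by rewrite hs.
have := twisted_central_vector (phase_norm t) (phaseK t) icc _ eta0 Kk0.
move=> h; have {h} : phase t k0 = 1.
  by apply: h => k Kk; apply: central; exact: lam_group_vn.
move=> /(congr1 (fun z : C => complex.Im z)) /=.
have tle : t * `|theta k0| <= 1.
  by rewrite -ler_pdivlMr// ge_min lexx orbT.
have pi2 := pi_ge2 R.
have sgt : 0 < sin (t * `|theta k0|).
  by apply: sin_gt0_pi; rewrite mulr_gt0//=; lra.
case: (ler0P (theta k0)) sgt => _ + e; rewrite ?mulrN ?sinN e; lra.
Qed.

End CharacterTwist.

(** * Property (T) of semidirect products *)

Section ClosedSubspaces.
Variables (R : realType) (H : hilbert R).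
Local Notation C := R[i].

Record closed_subspace := ClosedSubspace {
  cs_set : set H;
  cs_subspace : subspace cs_set;
  cs_closed : hclosure cs_set `<=` cs_set
}.

Variable S : closed_subspace.

Definition cs_pred : {pred H} := mem (cs_set S).

Lemma cs_submod : submod_closed cs_pred.
Proof.
have [S0 SD] := cs_subspace S.
split; first by rewrite inE.
by move=> a u v; rewrite !inE; exact: SD.
Qed.

HB.instance Definition _ := GRing.isSubmodClosed.Build _ _ cs_pred cs_submod.

Record cs_vector := CsVector { cs_val :> H; _ : cs_val \in cs_pred }.

HB.instance Definition _ := [isSub for cs_val].
HB.instance Definition _ := [Choice of cs_vector by <:].
HB.instance Definition _ := [SubChoice_isSubLmodule of cs_vector by <:].

Lemma cs_valB u v : cs_val (u - v) = cs_val u - cs_val v.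
Proof. by []. Qed.

Lemma cs_valZ a u : cs_val (a *: u) = a *: cs_val u.
Proof. by []. Qed.

Definition cs_dot (u v : cs_vector) : C := hdot H (cs_val u) (cs_val v).

Lemma cs_zmodl v : zmod_morphism (cs_dot ^~ v).
Proof. by move=> u u'; rewrite /cs_dot cs_valB linearBl. Qed.

Lemma cs_zmodr u : zmod_morphism (cs_dot u).
Proof. by move=> v v'; rewrite /cs_dot cs_valB linearBr. Qed.

Lemma cs_scalel v : scalable_for *%R (cs_dot ^~ v).
Proof. by move=> a u; rewrite /cs_dot cs_valZ hdotZl. Qed.

Lemma cs_scaler u : scalable_for (conjC \; *%R) (cs_dot u).
Proof. by move=> a v; rewrite /cs_dot cs_valZ hdotZr. Qed.

HB.instance Definition _ := isBilinear.Build C cs_vector cs_vector C *%R (conjC \; *%R)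
  cs_dot cs_zmodl cs_zmodr cs_scalel cs_scaler.

Lemma cs_dotC u v : cs_dot u v = (-1) ^+ false * conjC (cs_dot v u).
Proof. by rewrite expr0 mul1r /cs_dot hdotC. Qed.

HB.instance Definition _ := isHermitianSesquilinear.Build C cs_vector false conjC cs_dot
  cs_dotC.

Lemma cs_dot_gt0 u : u != 0 -> 0 < cs_dot u u.
Proof. by move=> u0; rewrite /cs_dot (dnorm_gt0 (hdot H)). Qed.

HB.instance Definition _ := isDotProduct.Build C cs_vector cs_dot cs_dot_gt0.

Lemma cs_complete (u : nat -> cs_vector) :
  (forall eps : R, 0 < eps -> exists N, forall m n, (N <= m)%N -> (N <= n)%N ->
     dot_norm cs_dot (u m - u n) < eps) ->
  exists l, forall eps : R, 0 < eps -> exists N, forall n, (N <= n)%N ->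
     dot_norm cs_dot (u n - l) < eps.
Proof.
move=> cau; have [l hl] := @hcomplete _ H (fun n => cs_val (u n)) cau.
have Sl : l \in cs_pred.
  rewrite inE; apply: cs_closed => e /hl[N hN]; exists (cs_val (u N)).
    by have := valP (u N); rewrite inE.
  by rewrite hnormB; exact: hN.
by exists (CsVector Sl).
Qed.

Definition cs_hilbert : hilbert R := @Hilbert R cs_vector cs_dot cs_complete.

End ClosedSubspaces.

(** Property (T) is stated for unit vectors of a whole Hilbert space; here the representation is
    restricted to S and xi is normalized, whence the factor [hnorm xi] in the hypothesis. *)
Lemma property_T_subspace (R : realType) (Gamma : groupType) (F : set Gamma) (eps : R) :
  (forall (H : hilbert R) (pi : Gamma -> H -> H) (xi : H), unitary_rep pi ->
     hnorm xi = 1 -> (forall g, F g -> hnorm (pi g xi - xi) < eps) ->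
     exists2 eta : H, eta <> 0 & forall g, pi g eta = eta) ->
  forall (H : hilbert R) (pi : Gamma -> H -> H) (S : closed_subspace H) (xi : H),
  unitary_rep pi -> (forall g v, cs_set S v -> cs_set S (pi g v)) -> cs_set S xi -> xi <> 0 ->
  (forall g, F g -> hnorm (pi g xi - xi) < eps * hnorm xi) ->
  exists eta, [/\ cs_set S eta, eta <> 0 & forall g, pi g eta = eta].
Proof.
move=> T H pi S xi [lpi pi1 piM pidot] Spi Sxi xi0 hxi.
have memS (v : cs_vector S) : cs_set S (cs_val v) by have := valP v; rewrite inE.
have Spi' g (v : cs_vector S) : pi g (cs_val v) \in cs_pred S by rewrite inE; exact: Spi.
pose rho g (v : cs_hilbert S) : cs_hilbert S := CsVector (Spi' g v).
have val_inj' (u v : cs_vector S) : cs_val u = cs_val v -> u = v by exact: val_inj.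
have urho : unitary_rep rho.
  split=> [g a u v|v|g h v|g u v]; try apply: val_inj'.
  - exact: lpi.
  - exact: pi1.
  - exact: piM.
  exact: pidot.
have n0 := hnorm_gt0 xi0.
have Sxi1 : (((hnorm xi)^-1)%:C%C *: xi : H) \in cs_pred S.
  rewrite inE -[_ *: _]addr0; have [S0 SD] := cs_subspace S; exact: SD.
have nE (v : cs_hilbert S) : hnorm v = hnorm (cs_val v) by [].
have [||eta eta0 inv] := T (cs_hilbert S) rho (CsVector Sxi1) urho.
- by rewrite nE /= hnormZr gtr0_norm ?invr_gt0// mulVf// gt_eqF.
- move=> g Fg; rewrite nE.
  have -> : cs_val (rho g (CsVector Sxi1) - CsVector Sxi1) =
      ((hnorm xi)^-1)%:C%C *: (pi g xi - xi).
    by rewrite cs_valB /= (linopZ (lpi g)) scalerBr.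
  rewrite hnormZr gtr0_norm ?invr_gt0// ltr_pdivrMl// mulrC; exact: hxi.
exists (cs_val eta); split; first exact: memS.
  by move=> e; apply: eta0; apply: val_inj'.
by move=> g; have /(congr1 (@cs_val _ _ S)) := inv g.
Qed.

Section Invariants.
Variables (R : realType) (H : hilbert R).

Definition invariants (I : Type) (pi : I -> H -> H) : set H :=
  [set v | forall g, pi g v = v].

Lemma invariants_subspace I (pi : I -> H -> H) : (forall g, linear (pi g)) ->
  subspace (invariants pi).
Proof.
move=> lpi; split=> [g|a u v hu hv g]; first exact: linop0.
by rewrite lpi hu hv.
Qed.

Lemma invariants_closed I (pi : I -> H -> H) : (forall g, linear (pi g)) ->
  (forall g v, hnorm (pi g v) = hnorm v) ->
  hclosure (invariants pi) `<=` invariants pi.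
Proof.
move=> lpi npi v cv g; apply/eqP; rewrite -subr_eq0; apply/eqP.
apply: hnorm_small => e e0; have [s hs vs] := cv (e / 2) ltac:(lra).
have := hnorm_tri (pi g s) (pi g v) v.
rewrite -(linopB (lpi g)) npi hs (hnormB s); lra.
Qed.

Definition orthogonal_complement (S : set H) : set H :=
  [set v | forall s, S s -> hdot H v s = 0].

Lemma orthogonal_subspace S : subspace (orthogonal_complement S).
Proof.
split=> [s _|a u v hu hv s Ss]; first exact: linear0l.
by rewrite hdotDl hdotZl hu// hv// mulr0 addr0.
Qed.

Lemma orthogonal_closed S :
  hclosure (orthogonal_complement S) `<=` orthogonal_complement S.
Proof.
move=> v cv s Ss; rewrite hdotC (hclosure_orth cv) ?rmorph0// => w hw.
by rewrite hdotC hw// rmorph0.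
Qed.

Lemma unitary_rep_norm (G : groupType) (pi : G -> H -> H) : unitary_rep pi ->
  forall g v, hnorm (pi g v) = hnorm v.
Proof. by move=> [_ _ _ h] g v; rewrite /hnorm /dot_norm h. Qed.

End Invariants.

(** Split xi as x0 + x1 with x0 its projection onto the N-invariant vectors. The orthogonal
    complement has no nonzero invariant vector, so property (T) of Gamma, acting through f, forces
    x1 to be small. The N-invariants are stable under Q because N is normal, and x0 is almost
    Q-invariant, so property (T) of Q applies to it. *)
Lemma property_T_sdprod (R : realType) (Gamma Q N : groupType) (sigma : group_action Q N)
    (f : {multiplicative Gamma -> N}) : range f = setT ->
  property_T_group R Gamma -> property_T_group R Q ->
  property_T_group R (sdprod sigma).
Proof.
move=> fsurj [F1 [e1 [finF1 e10 T1]]] [F2 [e2 [finF2 e20 T2]]].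
pose i1 g : (sdprod sigma : groupType) := sd_inl sigma (f g).
pose i2 q : (sdprod sigma : groupType) := sd_inr sigma q.
(* D is tuned so that eps = e2 e1 / D gives |x1| <= e2 / D and eps + 2 |x1| <= e2 (1 - |x1|) <= e2
   |x0|; the equality behind it is [hD]. *)
pose D := e1 + 2 + e2; have D0 : 0 < D by rewrite /D; lra.
exists (i1 @` F1 `|` i2 @` F2), (e2 * e1 / D); split.
- by rewrite finite_setU; split; exact: finite_image.
- by rewrite divr_gt0// mulr_gt0.
move=> H pi xi upi xi1 hxi; have npi := unitary_rep_norm upi.
have [lpi pi1 piM pidot] := upi.
have i1M x y : i1 (x * y)%g = (i1 x * i1 y)%g.
  by rewrite /i1 gmulfM -sd_inlM.
have f1 : f 1%g = 1%g by apply: (@mulgI _ (f 1%g)); rewrite -gmulfM !mulg1.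
have i11 : i1 1%g = 1%g by rewrite /i1 f1.
have i2M x y : i2 (x * y)%g = (i2 x * i2 y)%g.
  by rewrite /i2 /sd_inr sd_mulE /= gact_one mulg1.
have rep1 : unitary_rep (fun g => pi (i1 g)).
  split=> [g|v|g h v|g u v]; [exact: lpi| |by rewrite i1M piM|exact: pidot].
  by rewrite i11 pi1.
have rep2 : unitary_rep (fun q => pi (i2 q)).
  split=> [g|v|g h v|g u v]; [exact: lpi|exact: pi1|by rewrite i2M piM|exact: pidot].
pose VN := invariants (fun n => pi (sd_inl sigma n)).
have lN n : linear (pi (sd_inl sigma n)) by exact: lpi.
have VNsub : subspace VN by exact: invariants_subspace.
have VNcl : hclosure VN `<=` VN by apply: invariants_closed => // n v; exact: npi.
pose S0 := ClosedSubspace VNsub VNcl.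
pose S1 := ClosedSubspace (orthogonal_subspace VN) (@orthogonal_closed _ _ VN).
have [x0 [/VNcl Sx0 orth]] := hprojection xi VNsub.
pose x1 := xi - x0; have Sx1 : cs_set S1 x1 by [].
have inv1 g v : cs_set S1 v -> cs_set S1 (pi (i1 g) v).
  move=> Sv s Ss; have <- : pi (i1 g) s = s by exact: Ss.
  by rewrite pidot Sv.
have inv2 q v : cs_set S0 v -> cs_set S0 (pi (i2 q) v).
  move=> Sv n; rewrite -piM.
  have -> : (sd_inl sigma n * i2 q)%g = (i2 q * sd_inl sigma (sigma q^-1%g n))%g.
    rewrite /i2 !sd_mulE /=; congr pair; last by rewrite mul1g mulg1.
    by rewrite gact1 mul1g mulg1 -gactA mulgV gact1.
  by rewrite piM Sv.
have small : e1 * hnorm x1 <= e2 * e1 / D.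
  have [->|x10] := pselect (x1 = 0); first by rewrite hnorm0 mulr0 divr_ge0 ?mulr_ge0 ?ltW.
  rewrite leNgt; apply/negP => lt.
  have [g Fg|eta [S1eta eta0 etainv]] := property_T_subspace T1 rep1 inv1 Sx1 x10.
    (* x0 is fixed by N, so x1 and xi are displaced by the same vector. *)
    have -> : pi (i1 g) x1 - x1 = pi (i1 g) xi - xi.
      by rewrite /x1 (linopB (lpi _)) [pi _ x0]Sx0 opprB addrA subrK.
    by apply: lt_trans lt; apply: hxi; left; exists g.
  apply: eta0; apply: rdot_eq0; rewrite /rdot S1eta// => n.
  by have : range f n by [rewrite fsurj]; move=> [g _ <-]; exact: etainv.
have a1 : hnorm x1 <= e2 / D.
  by rewrite -(ler_pM2l e10) (le_trans small)// mulrCA mulrA.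
have hD : e2 * e1 / D + 2 * (e2 / D) + e2 * (e2 / D) = e2.
  by rewrite /D; field; rewrite gt_eqF// /D in D0 *; lra.
have x0n : 1 - hnorm x1 <= hnorm x0.
  have := hnormD x1 x0; rewrite /x1 subrK xi1; lra.
have lt1 : e2 / D < 1 by rewrite ltr_pdivrMr// mul1r /D; lra.
have x00 : x0 <> 0 by move=> e; move: x0n; rewrite e hnorm0; lra.
have [q Fq|eta [S0eta eta0 etainv]] := property_T_subspace T2 rep2 inv2 (Sx0 : cs_set S0 x0) x00.
  have h1 : hnorm (pi (i2 q) xi - xi) < e2 * e1 / D by apply: hxi; right; exists q.
  have e : pi (i2 q) x0 - x0 = (pi (i2 q) xi - xi) - (pi (i2 q) x1 - x1).
    by rewrite -subB_AC -(linopB (lpi _)) /x1 !subKr.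
  rewrite e; apply: le_lt_trans (hnormBD _ _) _.
  have h2 := hnormBD (pi (i2 q) x1) x1; rewrite npi in h2.
  have h3 : e2 * hnorm x1 <= e2 * (e2 / D) by rewrite ler_pM2l.
  have h4 : e2 * (1 - hnorm x1) <= e2 * hnorm x0 by rewrite ler_pM2l.
  lra.
exists eta => // -[n q].
have -> : (n, q) = (sd_inl sigma n * i2 q)%g :> sdprod sigma.
  by rewrite sd_mulE /= gact1 mulg1 mul1g.
by rewrite piM [pi (i2 q) eta]etainv; exact: S0eta.
Qed.

(** * Property (T) of the von Neumann algebra of a property (T) group *)

Definition half_pow (R : realType) (n : nat) : R := 2^-1 ^+ n.

Lemma half_pow_gt0 (R : realType) n : 0 < half_pow R n.
Proof. by rewrite exprn_gt0// invr_gt0. Qed.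

Lemma half_powS (R : realType) n : half_pow R n.+1 = half_pow R n / 2.
Proof. by rewrite /half_pow exprS mulrC. Qed.

Lemma half_pow_lt (R : realType) (e : R) : 0 < e ->
  exists N, forall n, (N <= n)%N -> half_pow R n < e.
Proof.
move=> e0; have [N hN] := invS_lt e0; exists N => n Nn; apply: le_lt_trans (hN n Nn).
rewrite /half_pow /invS exprVn lef_pV2 ?posrE ?exprn_gt0// -natrX ler_nat.
exact: ltn_expl.
Qed.

(** * Order properties of the resolvents (1 + Y)^-1 *)

Section Resolvents.
Variables (R : realType) (H : hilbert R).
Implicit Types (u v w : H) (S T X Y B : H -> H).

Definition positive_op T : Prop := forall v, 0 <= rdot (T v) v.

Definition is_resolvent Y B : Prop :=
  [/\ bounded_op B, is_adjoint B B, forall v, B v + Y (B v) = v &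
      forall v, B (v + Y v) = v].

Lemma resolvent_positive Y B : positive_op Y -> is_resolvent Y B -> positive_op B.
Proof.
move=> Y0 [_ _ hB _] v; rewrite -{2}(hB v) rdotDr (rdotC (Y _)).
by rewrite addr_ge0 ?rdot_ge0.
Qed.

Lemma resolvent_le1 Y B v : positive_op Y -> is_resolvent Y B ->
  rdot (B v) v <= rdot v v.
Proof.
move=> Y0 [_ _ hB _]; have := rdot_ge0 (Y (B v)); have := Y0 (B v).
have e := hB v; move: e; set u := B v => e; rewrite -e.
rewrite !(rdotDl, rdotDr) (rdotC (Y u) u); lra.
Qed.

(** Expand the form of 1 + Y at u - w >= 0 in the sense of positivity, where u = B v and w = B' v,
    and replace Y by the larger Y' in the term at w: what remains is <B v, v> - <B' v, v>. *)
Lemma resolvent_antitone Y Y' B B' : positive_op Y -> is_adjoint Y Y ->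
  linear Y -> (forall v, rdot (Y v) v <= rdot (Y' v) v) ->
  is_resolvent Y B -> is_resolvent Y' B' -> forall v, rdot (B' v) v <= rdot (B v) v.
Proof.
move=> Y0 sY lY YY' [_ _ hB _] [_ _ hB' _] v.
have := Y0 (B v - B' v); have := rdot_ge0 (B v - B' v); have := YY' (B' v).
have e := hB v; have e' := hB' v; move: e e'; set u := B v; set w := B' v => e e'.
have e1 : rdot u v = rdot u u + rdot (Y u) u by rewrite -{1}e rdotDr (rdotC (Y u) u).
have e2 : rdot w v = rdot w w + rdot (Y' w) w by rewrite -{1}e' rdotDr (rdotC (Y' w) w).
have e3 : rdot w v = rdot u w + rdot (Y u) w.
  by rewrite -{1}e rdotDr (rdotC u w) (rdotC (Y u) w).
have e4 : rdot (Y w) u = rdot (Y u) w by rewrite (adjoint_rdot sY) rdotC.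
rewrite (linopB lY) !(rdotBl, rdotBr) (rdotC u w) e4; lra.
Qed.

(** With u = B v, the form of B - (1 - Y) at v is |Y u|^2 + <Y (Y u), Y u>. *)
Lemma resolvent_lower Y B v : positive_op Y -> is_adjoint Y Y -> linear Y ->
  is_resolvent Y B -> rdot v v - rdot (Y v) v <= rdot (B v) v.
Proof.
move=> Y0 sY lY [_ _ hB _]; have := Y0 (Y (B v)); have := rdot_ge0 (Y (B v)).
have e := hB v; move: e; set u := B v => e.
have e1 : rdot (Y v) v = rdot (Y u) v + rdot (Y u) (Y u) + rdot (Y (Y u)) (Y u).
  rewrite -{1}e (linopD lY) rdotDl (adjoint_rdot sY (Y u)) -{2}e (linopD lY) rdotDr.
  by rewrite (rdotC (Y (Y u))) addrA.
have e2 : rdot v v = rdot u v + rdot (Y u) v by rewrite -{1}e rdotDl.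
by rewrite e1 e2; lra.
Qed.

(** In operator terms, c y^2 <= Y implies y B y <= 1/c. For w = B (y v), the number <y w, v> = |w|^2
    + <Y w, w> is at least c |y w|^2, and Cauchy-Schwarz then gives |y w| <= |v| / c. *)
Lemma resolvent_sandwich Y B y (c : R) v : is_adjoint y y -> 0 < c ->
  (forall w, c * hnorm (y w) ^+ 2 <= rdot (Y w) w) -> is_resolvent Y B ->
  rdot (B (y v)) (y v) <= c^-1 * hnorm v ^+ 2.
Proof.
move=> sy c0 hc [_ _ hB _]; have e := hB (y v); move: e; set w := B (y v) => e.
have e1 : rdot w (y v) = rdot w w + rdot (Y w) w.
  by rewrite -[X in rdot w X = _]e rdotDr (rdotC (Y w) w).
have e2 : rdot w (y v) = rdot (y w) v by rewrite (adjoint_rdot sy).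
have h1 := hc w; have h2 := rdot_ge0 w; have h3 := rdot_le (y w) v.
have a0 := hnorm_ge0 (y w); have v0 := hnorm_ge0 v.
have h4 : c * hnorm (y w) ^+ 2 <= hnorm (y w) * hnorm v by lra.
have h5 : hnorm (y w) <= c^-1 * hnorm v.
  have [->|n0] := eqVneq (hnorm (y w)) 0; first by rewrite mulr_ge0// invr_ge0 ltW.
  have p0 : 0 < hnorm (y w) by rewrite lt_neqAle eq_sym n0.
  by rewrite ler_pdivlMl// -(ler_pM2l p0) mulrCA -expr2.
rewrite e2; apply: le_trans h3 _; rewrite expr2 mulrA; exact: ler_wpM2r.
Qed.

Lemma resolvent_commute Y B X : bounded_op X -> linear Y -> is_resolvent Y B ->
  X \o Y = Y \o X -> X \o B = B \o X.
Proof.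
move=> bX lY [_ _ hB hB'] XY; apply/funext => v /=.
have e : Y (X (B v)) = X (Y (B v)) := esym (congr1 (fun F => F (B v)) XY).
by rewrite -[LHS]hB' e -(linopD bX.1) hB.
Qed.

End Resolvents.

(** * Cutting off a sequence that is small at one vector *)

Section SmallSelfAdjoint.
Variables (R : realType) (H : hilbert R) (M : set (H -> H)) (d : H).
Local Notation q := (half_pow R).
Implicit Types (u v w : H) (S T X : H -> H).
Hypothesis vM : von_neumann_algebra M.
Variable y : nat -> H -> H.
Hypotheses (My : forall n, M (y n)) (sy : forall n, is_adjoint (y n) (y n))
  (small : forall n, hnorm (y n d) <= q n).

(** This is the sum over n < k of 2^n y_n^2. The weight grows, so that the resolvents tame y_n, but
    more slowly than |y_n d|^2 <= 4^-n decays, so that the form at d stays below 2. *)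
Fixpoint weighted_sum (k : nat) (v : H) : H :=
  if k is k'.+1 then (q k')^-1%:C%C *: y k' (y k' v) + weighted_sum k' v else 0.

Lemma weighted_sumM k : M (weighted_sum k).
Proof.
elim: k => [|k IH]; first exact: (vn_zero vM).
exact: (vn_lincomb vM _ (vn_comp vM (My k) (My k)) IH).
Qed.

Lemma weighted_sum_form k v : rdot (weighted_sum k.+1 v) v =
  (q k)^-1 * hnorm (y k v) ^+ 2 + rdot (weighted_sum k v) v.
Proof. by rewrite /= rdotDl rdotZl (adjoint_rdot (sy k)) -hnorm_sqr. Qed.

Lemma weighted_sum_mono k n v : (k <= n)%N ->
  rdot (weighted_sum k v) v <= rdot (weighted_sum n v) v.
Proof.
elim: n => [|n IH]; first by rewrite leqn0 => /eqP ->.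
rewrite leq_eqVlt => /predU1P[->//|/IH h]; apply: le_trans h _.
by rewrite weighted_sum_form lerDr mulr_ge0 ?sqr_ge0// invr_ge0 ltW ?half_pow_gt0.
Qed.

Lemma weighted_sum_positive k : positive_op (weighted_sum k).
Proof. by move=> v; apply: le_trans (weighted_sum_mono v (leq0n k)); rewrite rdot0l. Qed.

Lemma weighted_sum_selfadj k : is_adjoint (weighted_sum k) (weighted_sum k).
Proof.
apply: is_adjointP => [a u|u v]; first exact: (linopZ (vn_bounded vM (weighted_sumM k)).1).
elim: k => [|k IH] /=; first by rewrite rdot0l rdot0r.
by rewrite rdotDl rdotDr rdotZl rdotZr IH !(adjoint_rdot (sy k)).
Qed.

Lemma weighted_sum_trace k : rdot (weighted_sum k d) d <= 2 - 2 * q k.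
Proof.
elim: k => [|k IH]; first by rewrite rdot0l /half_pow expr0; lra.
rewrite weighted_sum_form half_powS.
have q0 := half_pow_gt0 R k.
have : (q k)^-1 * hnorm (y k d) ^+ 2 <= q k.
  by rewrite ler_pdivrMl// -expr2 lerXn2r ?nnegrE ?hnorm_ge0// ltW.
lra.
Qed.

Let W m k v : H := (q m)%:C%C *: weighted_sum k v.

Let MW m k : M (W m k). Proof. exact: (vn_scale vM _ (weighted_sumM k)). Qed.

Let bW m k : bounded_op (W m k). Proof. exact: (vn_bounded vM (MW m k)). Qed.

Let W_form m k v : rdot (W m k v) v = q m * rdot (weighted_sum k v) v.
Proof. exact: rdotZl. Qed.

Let W_pos m k : positive_op (W m k).
Proof.
move=> v; rewrite W_form mulr_ge0 ?weighted_sum_positive//.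
by rewrite ltW ?half_pow_gt0.
Qed.

Let W_sa m k : is_adjoint (W m k) (W m k).
Proof.
apply: is_adjointP => [a u|u v]; first exact: (linopZ (bW m k).1).
by rewrite /W rdotZl rdotZr (adjoint_rdot (weighted_sum_selfadj k)).
Qed.

(* A noncommutative Egorov theorem: b_m is the infimum over k of the resolvents
   (1 + 2^-m sum_(n < k) 2^n y_n^2)^-1. Multiplying by b_m makes the y_n tend to 0
   in norm, while b_m increases to 1 because the sums have trace at most 2. *)
Lemma small_cutoff : exists b : nat -> H -> H,
  [/\ forall m, M (b m) /\ is_adjoint (b m) (b m),
      forall m v, 0 <= rdot (b m v) v <= rdot v v,
      forall m v, rdot (b m v) v <= rdot (b m.+1 v) v,
      forall m n v, hnorm (b m (y n v)) ^+ 2 <= q n / q m * hnorm v ^+ 2 &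
      forall m, rdot d d - rdot (b m d) d <= 2 * q m].
Proof.
have /choice[B hB] (p : nat * nat) : exists B, is_resolvent (W p.1 p.2) B.
  have [B [h1 h2 h3 h4]] := inverse_one_plus (bW p.1 p.2) (W_sa p.1 p.2) (W_pos p.1 p.2).
  by exists B.
have Bdec m k n v : (k <= n)%N -> rdot (B (m, n) v) v <= rdot (B (m, k) v) v.
  move=> kn; apply: (resolvent_antitone (@W_pos m k) (W_sa m k) (bW m k).1 _ (hB (m, k)) (hB (m, n))).
  by move=> w; rewrite !W_form ler_pM2l ?half_pow_gt0//; exact: weighted_sum_mono.
have Bm m k v : rdot (B (m, k) v) v <= rdot (B (m.+1, k) v) v.
  apply: (resolvent_antitone (@W_pos m.+1 k) (W_sa m.+1 k) (bW m.+1 k).1 _ (hB (m.+1, k)) (hB (m, k))).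
  move=> w; rewrite !W_form half_powS; have := weighted_sum_positive k w.
  have := half_pow_gt0 R m; nra.
(* The resolvents decrease in k, while [monotone_limit] takes increasing families bounded above.
   Their negatives increase and are bounded by 0, and b_m is minus the limit. *)
pose E m := [set (fun v => - B (m, k) v) | k in [set: nat]].
have bE m S : E m S -> bounded_op S.
  move=> [k _ <-]; have [bB _ _ _] := hB (m, k).
  have [c c0 hc] := bounded_op_pos bB.
  split; last by exists c => v; rewrite hnormN.
  by move=> a u v; rewrite bB.1 opprD scalerN.
have sE m S : E m S -> is_adjoint S S.
  move=> [k _ <-]; have [bB sB _ _] := hB (m, k).
  by move=> u v; rewrite linearNl linearNr /= sB.
have bzero : bounded_op (fun _ : H => 0 : H) by exact: (vn_bounded vM (vn_zero vM)).
have szero : is_adjoint (fun _ : H => 0 : H) (fun=> 0).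
  by move=> u v; rewrite linear0l linear0r.
have E_le m k n : (k <= n)%N -> op_le (fun v => - B (m, k) v) (fun v => - B (m, n) v).
  move=> kn; apply: op_le_selfadj => [||v]; [by apply: (sE m); exists k|by apply: (sE m); exists n|].
  by rewrite !rdotNl lerN2; exact: Bdec.
have dE m : op_directed (E m).
  split; first by exists (fun v => - B (m, 0%N) v), 0%N.
  move=> _ _ [k _ <-] [n _ <-]; exists (fun v => - B (m, maxn k n) v); first by exists (maxn k n).
  by split; apply: E_le; rewrite ?leq_maxl ?leq_maxr.
have E0 m S : E m S -> op_le S (fun=> 0).
  move=> ES; apply: op_le_selfadj => [||v]; [exact: sE ES|exact: szero|].
  move: ES => [k _ <-]; rewrite rdot0l rdotNl oppr_le0.
  exact: resolvent_positive (@W_pos m k) (hB (m, k)) v.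
have /choice[X hX] m := monotone_limit (bE m) (sE m) (dE m) bzero (E0 m).
have bX m : bounded_op (X m) by case: (hX m).
have sX m : is_adjoint (X m) (X m) by case: (hX m).
have ubX m k v : rdot (X m v) v >= - rdot (B (m, k) v) v.
  have [_ _ h _ _] := hX m; rewrite -rdotNl.
  by apply: (op_le_rdot (h (fun v => - B (m, k) v) _)); exists k.
have lubX m T v : (forall k, op_le (fun v => - B (m, k) v) T) -> rdot (X m v) v <= rdot (T v) v.
  have [_ _ _ h _] := hX m => hT; apply: (op_le_rdot (h T _)).
  by move=> _ [k _ <-]; exact: hT.
exists (fun m v => - X m v).
have b_sa m : is_adjoint (fun v => - X m v) (fun v => - X m v).
  by move=> u v; rewrite linearNl linearNr /= sX.
have b_bd m : bounded_op (fun v => - X m v).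
  have [c c0 hc] := bounded_op_pos (bX m).
  split; last by exists c => v; rewrite hnormN.
  by move=> a u v; rewrite (bX m).1 opprD scalerN.
have b_range m v : 0 <= rdot (- X m v) v <= rdot v v.
  rewrite rdotNl oppr_ge0; apply/andP; split.
    have := lubX m (fun=> 0) v; rewrite rdot0l; apply => k.
    by apply: E0; exists k.
  have := ubX m 0%N v; have := resolvent_le1 v (@W_pos m 0%N) (hB (m, 0%N)); lra.
split=> //.
- move=> m; split=> //; apply: (vn_bicommutant vM) => // S cS; apply/funext => v /=.
  have bS := commutant_bounded cS.
  suff e : S \o X m = X m \o S.
    by rewrite (linopN bS.1); congr (- _); exact: (esym (congr1 (fun F => F v) e)).
  have [_ _ _ _ lim] := hX m; apply: (strong_limit_commute (dE m) lim bS).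
  move=> _ [k _ <-]; apply/funext => w /=; rewrite (linopN bS.1); congr (- _).
  have e2 := resolvent_commute bS (bW m k).1 (hB (m, k)) (vn_commute (MW m k) cS).
  exact: (congr1 (fun F => F w) e2).
- move=> m v; rewrite !rdotNl lerN2; apply: lubX => k.
  apply: op_le_selfadj => [||w]; [by apply: (sE m.+1); exists k|exact: sX|].
  by rewrite rdotNl; have := ubX m k w; have := Bm m k w; lra.
- move=> m n v.
  have h1 : hnorm (- X m (y n v)) ^+ 2 <= 1 * rdot (- X m (y n v)) (y n v).
    apply: (@positive_op_sqr _ _ (fun v => - X m v)) => //; first exact: (b_bd m).1.
      by move=> w; case/andP: (b_range m w).
    by move=> w; rewrite mul1r; case/andP: (b_range m w).
  rewrite mul1r in h1; apply: le_trans h1 _; rewrite rdotNl.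
  (* b_m lies below every B (m, k). The index n.+1 is the first whose sum contains y_n^2, with
     coefficient 2^(n - m), so the sandwich bound gives 2^(m - n). *)
  apply: (@le_trans _ _ (rdot (B (m, n.+1) (y n v)) (y n v))).
    by have := ubX m n.+1 (y n v); lra.
  have qn := half_pow_gt0 R n; have qm := half_pow_gt0 R m.
  have -> : q n / q m = (q m / q n)^-1 by rewrite invf_div.
  apply: resolvent_sandwich (sy n) _ _ (hB (m, n.+1)); first by rewrite divr_gt0.
  move=> w; rewrite W_form weighted_sum_form /= mulrDr [X in _ <= X + _]mulrA lerDl.
  by rewrite mulr_ge0 ?(ltW qm)//; exact: weighted_sum_positive.
(* By [resolvent_lower] the defect of B (m, k) at d is at most 2^-m times the form of the weighted
   sum, so at most 2 q m uniformly in k; this passes to the limit. *)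
move=> m; rewrite rdotNl opprK; apply: (@le_of_small _ _ _ (hnorm d)) => e e0.
have [_ _ _ _ lim] := hX m; have [S ES hS] := lim d e e0.
have := hS S ES (fun _ => lexx _); move: ES => [k _ <-] => lt.
have h1 : `|rdot (- B (m, k) d - X m d) d| <= e * hnorm d.
  by apply: le_trans (rdot_norm_le _ _) _; rewrite ler_wpM2r ?hnorm_ge0// ltW.
move: h1; rewrite ler_norml rdotBl rdotNl => /andP[h1 h2].
have h3 := resolvent_lower d (@W_pos m k) (W_sa m k) (bW m k).1 (hB (m, k)).
rewrite W_form in h3; have h4 := weighted_sum_trace k.
have qk := half_pow_gt0 R k; have qm := half_pow_gt0 R m.
have h5 : q m * rdot (weighted_sum k d) d <= q m * 2 by rewrite ler_pM2l//; lra.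
lra.
Qed.

End SmallSelfAdjoint.

(** * Positivity and convergence for normal maps *)

Section NormalMapTheory.
Variables (R : realType) (H K : hilbert R) (M : set (H -> H)).
Variable pi : (H -> H) -> (K -> K).
Hypotheses (vM : von_neumann_algebra M) (npi : normal_star_map M pi).
Implicit Types (S T A B : H -> H) (v : H) (w : K).

Lemma nm_bounded T : M T -> bounded_op (pi T).
Proof. by case: npi => h _ _ _ _; exact: h. Qed.

Lemma nm_lincomb a S T w : M S -> M T ->
  pi (fun v => a *: S v + T v) w = a *: pi S w + pi T w.
Proof. by case: npi => _ h _ _ _ MS MT; rewrite h. Qed.

Lemma nm_id : pi id = id. Proof. by case: npi. Qed.

Lemma nm_adjoint S T : M S -> M T -> is_adjoint S T -> is_adjoint (pi S) (pi T).
Proof. by case: npi => _ _ _ h _; exact: h. Qed.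

Lemma nm_scalar a w : pi (fun v => a *: v) w = a *: w.
Proof.
have -> : (fun v : H => a *: v) = (fun v => (a - 1) *: id v + id v).
  by apply/funext => v; rewrite scalerBl scale1r subrK.
by rewrite nm_lincomb ?nm_id /= ?scalerBl ?scale1r ?subrK//; exact: vn_id.
Qed.

Lemma nm_zero w : pi (fun=> 0) w = 0.
Proof.
have -> : (fun _ : H => 0 : H) = (fun v => 0 *: v) by apply/funext => v; rewrite scale0r.
by rewrite nm_scalar scale0r.
Qed.

Lemma nm_scale a T w : M T -> pi (fun v => a *: T v) w = a *: pi T w.
Proof.
move=> MT; have -> : (fun v => a *: T v) = (fun v => a *: T v + (fun=> 0) v).
  by apply/funext => v; rewrite addr0.
by rewrite nm_lincomb ?nm_zero ?addr0//; exact: vn_zero.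
Qed.

Lemma nm_add S T w : M S -> M T -> pi (fun v => S v + T v) w = pi S w + pi T w.
Proof.
move=> MS MT; have -> : (fun v => S v + T v) = (fun v => 1 *: S v + T v).
  by apply/funext => v; rewrite scale1r.
by rewrite nm_lincomb// scale1r.
Qed.

Lemma nm_sub S T w : M S -> M T -> pi (fun v => S v - T v) w = pi S w - pi T w.
Proof.
move=> MS MT; have -> : (fun v => S v - T v) = (fun v => (-1) *: T v + S v).
  by apply/funext => v; rewrite scaleN1r addrC.
by rewrite nm_lincomb// scaleN1r addrC.
Qed.

(* Normality for the two-element directed set {A, B} already gives positivity. *)
Lemma nm_le A B : M A -> M B -> is_adjoint A A -> is_adjoint B B -> op_le A B ->
  op_le (pi A) (pi B).
Proof.
move=> MA MB sA sB AB; case: npi => _ _ _ _ h.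
have [||||_ ub _] := h [set S | S = A \/ S = B] B.
- by move=> _ [->|->].
- by move=> _ [->|->].
- split; first by exists A; exact: or_introl erefl.
  have BB : op_le B B by move=> v; exact: lexx.
  by move=> S T [->|->] [->|->]; exists B => //; exact: or_intror erefl.
- by split=> // [S [->|->]//|T _ hT]; apply: hT; exact: or_intror erefl.
by apply: ub; exists A => //; exact: or_introl erefl.
Qed.

Lemma selfadj_scalar (c : R) : is_adjoint (fun v : H => c%:C%C *: v) (fun v => c%:C%C *: v).
Proof.
apply: is_adjointP => [a u|u v]; first by rewrite !scalerA mulrC.
by rewrite rdotZl rdotZr.
Qed.

Lemma nm_form_le A (c : R) : M A -> is_adjoint A A ->
  (forall v, rdot (A v) v <= c * rdot v v) -> forall w, rdot (pi A w) w <= c * rdot w w.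
Proof.
move=> MA sA Ac w.
have Mc : M (fun v => c%:C%C *: v) by have := vn_scale vM c%:C%C (vn_id vM).
have le : op_le A (fun v => c%:C%C *: v).
  by apply: op_le_selfadj => // [|v]; [exact: selfadj_scalar|rewrite rdotZl].
by have := op_le_rdot (nm_le MA Mc sA (selfadj_scalar c) le) w; rewrite nm_scalar rdotZl.
Qed.

(** Stated for any factorization of pi A into U followed by its adjoint V, so that it serves the
    multiplicative left action and the antimultiplicative right action alike. *)
Lemma nm_norm_le A (c : R) (U V : K -> K) w : M A -> is_adjoint A A ->
  (forall v, rdot (A v) v <= c * hnorm v ^+ 2) -> is_adjoint U V ->
  V (U w) = pi A w -> hnorm (U w) ^+ 2 <= c * hnorm w ^+ 2.
Proof.
move=> MA sA Ac UV VU; rewrite hnorm_sqr (adjoint_rdot UV) VU rdotC hnorm_sqr.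
by apply: nm_form_le => // v; rewrite -hnorm_sqr.
Qed.

(** Normality says that the identity is the least upper bound of the increasing operators pi (b m).
    Their strong limit is a least upper bound too, so it is the identity, and order convergence
    becomes strong convergence. *)
Lemma nm_converge (b : nat -> H -> H) : (forall m, M (b m) /\ is_adjoint (b m) (b m)) ->
  (forall m v, 0 <= rdot (b m v) v <= rdot v v) ->
  (forall m v, rdot (b m v) v <= rdot (b m.+1 v) v) ->
  op_lub M (range b) id ->
  forall w (e : R), 0 < e -> exists m0, forall m, (m0 <= m)%N -> hnorm (pi (b m) w - w) < e.
Proof.
move=> Mb b01 bS lub w e e0.
have mono m n : (m <= n)%N -> op_le (b m) (b n).
  elim: n => [|n IH]; first by rewrite leqn0 => /eqP ->; move=> v; exact: lexx.
  rewrite leq_eqVlt => /predU1P[->|/IH h]; first by move=> v; exact: lexx.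
  apply: op_le_trans h _; apply: op_le_selfadj => [||v]; [exact: (Mb n).2|exact: (Mb n.+1).2|exact: bS].
have Db : op_directed (range b).
  split; first by exists (b 0%N), 0%N.
  move=> _ _ [m _ <-] [n _ <-]; exists (b (maxn m n)); first by exists (maxn m n).
  by split; apply: mono; rewrite ?leq_maxl ?leq_maxr.
have pmono m n : (m <= n)%N -> op_le (pi (b m)) (pi (b n)).
  by move=> mn; apply: nm_le; [exact: (Mb m).1|exact: (Mb n).1|exact: (Mb m).2|exact: (Mb n).2|exact: mono].
have DM : range b `<=` M by move=> _ [m _ <-]; exact: (Mb m).1.
have sb S : range b S -> is_adjoint S S by move=> [m _ <-]; exact: (Mb m).2.
have plub : op_lub (@bounded_op R K) (pi @` range b) id.
  by case: (npi) => _ _ pid _ h; rewrite -pid; exact: h.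
have bP (S : K -> K) : (pi @` range b) S -> bounded_op S.
  by move=> [_ [m _ <-] <-]; apply: nm_bounded; exact: (Mb m).1.
have sP (S : K -> K) : (pi @` range b) S -> is_adjoint S S.
  by move=> [_ [m _ <-] <-]; apply: nm_adjoint; [exact: (Mb m).1|exact: (Mb m).1|exact: (Mb m).2].
have dP : op_directed (pi @` range b).
  split; first by exists (pi (b 0%N)), (b 0%N) => //; exists 0%N.
  move=> _ _ [_ [m _ <-] <-] [_ [n _ <-] <-]; exists (pi (b (maxn m n))).
    by exists (b (maxn m n)) => //; exists (maxn m n).
  by split; apply: pmono; rewrite ?leq_maxl ?leq_maxr.
have [_ ubid leastid] := plub.
have [X [bX sX ubX lubX lim]] := monotone_limit bP sP dP (@bounded_op_id R K) ubid.
have sid : is_adjoint (@id K) id by [].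
have Xid (v : K) : X v = v.
  have h1 := op_le_rdot (lubX _ ubid); have h2 := op_le_rdot (leastid _ bX ubX).
  have eq (v' : K) : rdot (v' - X v') v' = 0.
    by rewrite rdotBl; have := h1 v'; have := h2 v'; rewrite /=; lra.
  have := @positive_op_sqr _ _ (fun v : K => v - X v) 1 _ _ _ _ _ v.
  rewrite eq mulr0 => h; apply/eqP; rewrite eq_sym -subr_eq0; apply/eqP; apply: hnorm_eq0.
  apply/eqP; rewrite -sqrf_eq0 eq_le sqr_ge0 andbT; apply: h => //.
  - by apply: (linearopB (S := id)) => //; exact: bX.1.
  - exact: (selfadjB (S := id)).
  - by move=> v'; rewrite eq.
  by move=> v'; rewrite eq mul1r rdot_ge0.
have [S [_ [m _ <-] <-] hS] := lim w e e0; exists m => n mn.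
have := hS (pi (b n)) _ (pmono _ _ mn); rewrite Xid; apply.
by exists (b n) => //; exists n.
Qed.

End NormalMapTheory.

(** * The cutoffs increase to the identity *)

Section CutoffLub.
Variables (R : realType) (H : hilbert R) (M : set (H -> H)) (d : H).
Local Notation q := (half_pow R).
Hypotheses (vM : von_neumann_algebra M)
  (cyclic : forall S : set H, subspace S -> (forall T, commutant M T -> S (T d)) ->
     forall v, hclosure S v).
Variable b : nat -> H -> H.
Hypotheses (Mb : forall m, M (b m) /\ is_adjoint (b m) (b m))
  (b01 : forall m v, 0 <= rdot (b m v) v <= rdot v v)
  (bd : forall m, rdot d d - rdot (b m d) d <= 2 * q m).

Lemma cutoff_defect m v : hnorm (v - b m v) ^+ 2 <= rdot v v - rdot (b m v) v.
Proof.
rewrite -rdotBl -[leRHS]mul1r; apply: (@positive_op_sqr _ _ (fun v => v - b m v)) => //.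
- by apply: (linearopB (S := id)) => //; exact: (vn_bounded vM (Mb m).1).1.
- by apply: (selfadjB (S := id)) => //; exact: (Mb m).2.
- by move=> w; rewrite rdotBl subr_ge0; case/andP: (b01 m w).
by move=> w; rewrite rdotBl mul1r; case/andP: (b01 m w) => h1 h2; lra.
Qed.

Lemma cutoff_contract m v : hnorm (v - b m v) <= hnorm v.
Proof.
apply: le_sqr_norm; first exact: hnorm_ge0.
by apply: le_trans (cutoff_defect m v) _; rewrite hnorm_sqr; case/andP: (b01 m v) => h1 h2; lra.
Qed.

(** The operators 1 - b_m are contractions commuting with the commutant of M. They tend to 0 at d by
    [bd], hence at every T d with T in the commutant, and these vectors span a dense subspace. *)
Lemma cutoff_strong v (e : R) : 0 < e ->
  exists m0, forall m, (m0 <= m)%N -> hnorm (v - b m v) < e.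
Proof.
have lb m : linear (b m) by exact: (vn_bounded vM (Mb m).1).1.
pose V := [set v | forall e : R, 0 < e -> exists m0, forall m, (m0 <= m)%N -> hnorm (v - b m v) < e].
have sV : subspace V.
  split; first by move=> e1 e10; exists 0%N => m _; rewrite (linop0 (lb m)) subrr hnorm0.
  move=> a u w Vu Vw e1 e10; set k := Num.sqrt (normsq a); have k0 : 0 <= k by exact: sqrtr_ge0.
  have e2 : 0 < e1 / (k + 1) by rewrite divr_gt0//; lra.
  have [m1 h1] := Vu _ e2; have [m2 h2] := Vw _ e2; exists (maxn m1 m2) => m.
  rewrite geq_max => /andP[/h1 l1 /h2 l2].
  have -> : a *: u + w - b m (a *: u + w) = a *: (u - b m u) + (w - b m w).
    by rewrite lb scalerBr opprD addrACA.
  apply: le_lt_trans (hnormD _ _) _; rewrite hnormZ -/k.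
  have h5 : k * hnorm (u - b m u) <= k * (e1 / (k + 1)) by rewrite ler_wpM2l// ltW.
  have -> : e1 = k * (e1 / (k + 1)) + e1 / (k + 1) by field; rewrite gt_eqF//; lra.
  lra.
have Vd T : commutant M T -> V (T d).
  move=> cT e1 e10; have bT := commutant_bounded cT; have [c c0 hc] := bounded_op_pos bT.
  have e2 : 0 < (e1 / c) ^+ 2 / 2 by rewrite divr_gt0// exprn_gt0// divr_gt0.
  have [m0 hm0] := half_pow_lt e2; exists m0 => m /hm0 qm.
  have -> : T d - b m (T d) = T (d - b m d).
    rewrite (linopB bT.1); congr (_ - _).
    exact: (esym (congr1 (fun F => F d) (vn_commute (Mb m).1 cT))).
  apply: le_lt_trans (hc _) _; rewrite -ltr_pdivlMl// mulrC.
  rewrite -ltr_sqr ?nnegrE ?hnorm_ge0// ?divr_ge0 ?(ltW e10) ?(ltW c0)//.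
  by apply: le_lt_trans (cutoff_defect m d) _; have := bd m; lra.
move=> e0; have e2 : 0 < e / 2 by lra.
have [s Vs vs] := cyclic sV Vd v e2; have [m0 hm0] := Vs _ e2; exists m0 => m /hm0 h.
have -> : v - b m v = (v - s - b m (v - s)) + (s - b m s).
  by rewrite (linopB (lb m)) addrACA -opprD !subrK.
apply: le_lt_trans (hnormD _ _) _; have := cutoff_contract m (v - s); lra.
Qed.

Lemma cutoff_lub : op_lub M (range b) id.
Proof.
split; first exact: vn_id.
  move=> _ [m _ <-]; apply: op_le_selfadj => // [|v]; first exact: (Mb m).2.
  by case/andP: (b01 m v).
move=> T MT hT; apply/op_leP => v; split.
  have /op_leP/(_ v)[<- _] : op_le (b 0%N) T by apply: hT; exists 0%N.
  by rewrite Im_hdot_diag selfadj_Im//; exact: (Mb 0%N).2.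
apply: (@le_of_small _ _ _ (hnorm v)) => e e0.
have [m0 hm0] := cutoff_strong v e0; have h := hm0 m0 (leqnn _).
have /op_le_rdot/(_ v) h2 : op_le (b m0) T by apply: hT; exists m0.
have -> : rdot v v = rdot (b m0 v) v + rdot (v - b m0 v) v by rewrite rdotBl; ring.
apply: lerD h2 _; apply: le_trans (rdot_le _ _) _.
by rewrite ler_wpM2r ?hnorm_ge0// ltW.
Qed.

End CutoffLub.

(** * From a dense set of central elements to the whole algebra *)

Section CentralVector.
Variables (R : realType) (H K : hilbert R) (M : set (H -> H)) (d : H).
Variables (l r : (H -> H) -> (K -> K)) (eta : K).
Local Notation q := (half_pow R).
Hypotheses (vM : von_neumann_algebra M)
  (cyclic : forall S : set H, subspace S -> (forall T, commutant M T -> S (T d)) ->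
     forall v, hclosure S v)
  (tracial : forall x x', M x -> M x' -> is_adjoint x x' -> hnorm (x' d) = hnorm (x d))
  (corr : correspondence M l r).

(** The adjoint is carried along so that the real part of an approximant can be formed and is again
    central for eta. *)
Definition central_pair (x x' : H -> H) : Prop :=
  [/\ M x, M x', is_adjoint x x', l x eta = r x eta & l x' eta = r x' eta].

Hypothesis dense : forall x, M x -> forall e : R, 0 < e ->
  exists a a', central_pair a a' /\ hnorm (a d - x d) < e.

Let nl : normal_star_map M l. Proof. by case: corr. Qed.
Let nr : normal_star_map M r. Proof. by case: corr. Qed.

Let lM x y w : M x -> M y -> l (x \o y) w = l x (l y w).
Proof. by case: corr => _ _ h _ _ Mx My; rewrite h. Qed.

Let rM x y w : M x -> M y -> r (x \o y) w = r y (r x w).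
Proof. by case: corr => _ _ _ h _ Mx My; rewrite h. Qed.

Let lr x y w : M x -> M y -> l x (r y w) = r y (l x w).
Proof.
by case: corr => _ _ _ _ h Mx My; rewrite -[LHS]/((l x \o r y) w) h.
Qed.

Lemma adjoint_comp (S S' T T' : H -> H) : is_adjoint S S' -> is_adjoint T T' ->
  is_adjoint (S \o T) (T' \o S').
Proof. by move=> hS hT u v /=; rewrite hS hT. Qed.

(** The same A = y b b y controls both actions: l(b) l(y) = l(b y) and r(b) r(y) = r(y b), and each
    of them preceded on the left by its adjoint is the image of A. *)
Let bound (b y : H -> H) (c : R) w : M b -> M y -> is_adjoint b b -> is_adjoint y y ->
  (forall v, hnorm (b (y v)) ^+ 2 <= c * hnorm v ^+ 2) ->
  hnorm (l b (l y w)) ^+ 2 <= c * hnorm w ^+ 2 /\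
  hnorm (r b (r y w)) ^+ 2 <= c * hnorm w ^+ 2.
Proof.
move=> Mb My sb sy h; pose A := (y \o b) \o (b \o y).
have Myb := vn_comp vM My Mb; have Mby := vn_comp vM Mb My.
have MA : M A by exact: vn_comp.
have ayb := adjoint_comp sy sb; have aby := adjoint_comp sb sy.
have sA : is_adjoint A A by exact: adjoint_comp ayb aby.
have Ac v : rdot (A v) v <= c * hnorm v ^+ 2.
  rewrite -[A v]/((y \o b) ((b \o y) v)) (adjoint_rdot ayb) -hnorm_sqr; exact: h.
split.
  rewrite -lM//; apply: (nm_norm_le vM nl (A := A)) => //.
    exact: (nm_adjoint nl Mby Myb aby).
  by rewrite -lM.
rewrite -rM//; apply: (nm_norm_le vM nr (A := A)) => //.
  exact: (nm_adjoint nr Myb Mby ayb).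
by rewrite -rM.
Qed.

(* With y_n = s_n - x, where l and r agree on s_n, the vector
   l(b_m) r(b_m) (l(x) - r(x)) eta is the negative of
   r(b_m) l(b_m y_n) eta - l(b_m) r(y_n b_m) eta, which tends to 0 with n; then let b_m
   increase to 1, using normality of l and r. *)
Lemma central_selfadj x : M x -> is_adjoint x x -> l x eta = r x eta.
Proof.
move=> Mx sx.
have /choice[s hs] (n : nat) : exists s, [/\ M s, is_adjoint s s, l s eta = r s eta &
    hnorm (s d - x d) <= q n].
  have [a [a' [[Ma Ma' aa' e1 e2] ax]]] := dense Mx (half_pow_gt0 R n).
  pose h : R[i] := (2^-1)%:C%C.
  have Mha := vn_scale vM h Ma; have Mha' := vn_scale vM h Ma'.
  (* The real part of a. Since x is self-adjoint, the tracial identity makes the adjoint of a as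
     close to x at d as a is, so averaging does not worsen the error. *)
  exists (fun v => h *: a v + h *: a' v); split.
  - exact: (vn_add vM Mha Mha').
  - apply: is_adjointP => [c u|u v].
      exact: (linopZ (vn_bounded vM (vn_add vM Mha Mha')).1).
    rewrite rdotDl rdotDr !rdotZl !rdotZr (adjoint_rdot aa').
    by rewrite (adjoint_rdot (is_adjoint_sym aa')) addrC.
  - rewrite (nm_add nl _ Mha Mha') (nm_add nr _ Mha Mha').
    by rewrite !(nm_scale vM nl) // !(nm_scale vM nr) // e1 e2.
  have Mz := vn_sub vM Ma Mx; have Mz' := vn_sub vM Ma' Mx.
  have zz : is_adjoint (fun v => a v - x v) (fun v => a' v - x v).
    by move=> u v; rewrite linearBl linearBr /= aa' sx.
  have e := tracial Mz Mz' zz.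
  have -> : h *: a d + h *: a' d - x d = h *: ((a d - x d) + (a' d - x d)).
    rewrite -scalerDr addrACA -opprD scalerBr; congr (_ - _).
    rewrite -mulr2n -scaler_nat scalerA -[LHS]scale1r; congr (_ *: _).
    by rewrite /h rmorphV ?unitfE ?pnatr_eq0// rmorph_nat mulVf ?pnatr_eq0.
  rewrite hnormZr ger0_norm ?invr_ge0// ler_pdivrMl//.
  by apply: le_trans (hnormD _ _) _; rewrite e; lra.
pose y n v := s n v - x v.
have My n : M (y n) by have [Ms _ _ _] := hs n; exact: (vn_sub vM Ms Mx).
have sy n : is_adjoint (y n) (y n) by have [_ ss _ _] := hs n; exact: selfadjB.
have small n : hnorm (y n d) <= q n by have [_ _ _ h] := hs n.
have [b [Mb b01 bS bound_b bd]] := small_cutoff vM My sy small.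
have lub := cutoff_lub vM cyclic Mb b01 bd.
pose z := l x eta - r x eta.
have ly n : l (y n) eta - r (y n) eta = - z.
  have [Ms _ e _] := hs n.
  by rewrite (nm_sub nl _ Ms Mx) (nm_sub nr _ Ms Mx) e subB_AC subrr sub0r.
have contr m w : hnorm (l (b m) w) <= hnorm w /\ hnorm (r (b m) w) <= hnorm w.
  have [Mbm sbm] := Mb m.
  have h v : hnorm (b m (id v)) ^+ 2 <= 1 * hnorm v ^+ 2.
    apply: (@le_trans _ _ (1 * rdot (b m v) v)).
      apply: positive_op_sqr => //; first exact: (vn_bounded vM Mbm).1.
        by move=> u; case/andP: (b01 m u).
      by move=> u; rewrite mul1r; case/andP: (b01 m u).
    by rewrite !mul1r hnorm_sqr; case/andP: (b01 m v).
  have [|h1 h2] := bound w Mbm (vn_id vM) sbm _ h; first by [].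
  rewrite !mul1r (nm_id nl) (nm_id nr) /= in h1 h2.
  by split; apply: le_sqr_norm => //; exact: hnorm_ge0.
have kill m : l (b m) (r (b m) z) = 0.
  have [Mbm sbm] := Mb m; have bl := nm_bounded nl Mbm; have br := nm_bounded nr Mbm.
  apply: hnorm_small => e e0.
  have k0 : 0 < hnorm eta ^+ 2 + 1 by have := sqr_ge0 (hnorm eta); lra.
  have qm := half_pow_gt0 R m.
  (* With m fixed, n is taken so large that 2^(m - n) |eta|^2 <= (e / 2)^2. *)
  have e1 : 0 < (e / 2) ^+ 2 * q m / (hnorm eta ^+ 2 + 1).
    by rewrite divr_gt0// mulr_gt0// exprn_gt0// divr_gt0.
  have [n /(_ n (leqnn _)) hn] := half_pow_lt e1.
  have [h1 h2] := bound eta Mbm (My n) sbm (sy n) (bound_b m n).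
  have small2 : q n / q m * hnorm eta ^+ 2 <= (e / 2) ^+ 2.
    rewrite mulrAC ler_pdivrMr//; move: hn; rewrite ltr_pdivlMr// => hn.
    apply: le_trans (ltW hn); rewrite ler_pM2l ?half_pow_gt0//; lra.
  have e2 : 0 <= e / 2 by lra.
  have n1 := le_sqr_norm e2 (le_trans h1 small2).
  have n2 := le_sqr_norm e2 (le_trans h2 small2).
  rewrite -hnormN -(linopN bl.1) -(linopN br.1) -(ly n) (linopB br.1) (linopB bl.1).
  rewrite (lr _ Mbm Mbm).
  apply: le_trans (hnormBD _ _) _.
  have := (contr m (l (b m) (l (y n) eta))).2; have := (contr m (r (b m) (r (y n) eta))).1.
  lra.
(* The equation [kill] says that r(b_m) z and l(b_m) z are orthogonal; both tend to z. *)
have zz : rdot z z = 0.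
  apply: (@eq_of_small _ _ _ (2 * hnorm z)) => e e0.
  have [m1 h1] := nm_converge nl Mb b01 bS lub z e0.
  have [m2 h2] := nm_converge nr Mb b01 bS lub z e0.
  set m := maxn m1 m2; have {}h1 := h1 m (leq_maxl _ _); have {}h2 := h2 m (leq_maxr _ _).
  have [Mbm sbm] := Mb m; have al := nm_adjoint nl Mbm Mbm sbm.
  have k : rdot (r (b m) z) (l (b m) z) = 0.
    by rewrite -(adjoint_rdot al) kill rdot0l.
  rewrite subr0.
  have -> : rdot z z = - rdot (r (b m) z - z) z - rdot (r (b m) z) (l (b m) z - z).
    by rewrite rdotBl rdotBr k; ring.
  apply: le_trans (ler_normB _ _) _; rewrite normrN.
  have n1 := rdot_norm_le (r (b m) z - z) z.
  have n2 := rdot_norm_le (r (b m) z) (l (b m) z - z).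
  have n3 : hnorm (r (b m) z - z) * hnorm z <= e * hnorm z.
    by rewrite ler_wpM2r ?hnorm_ge0// ltW.
  have n4 : hnorm (r (b m) z) * hnorm (l (b m) z - z) <= hnorm z * e.
    by apply: ler_pM; rewrite ?hnorm_ge0//; [exact: (contr m z).2|exact: ltW].
  by rewrite mulrCA mulr2n mulrDl mul1r (mulrC e); lra.
by apply/eqP; rewrite -subr_eq0; apply/eqP; exact: rdot_eq0.
Qed.

(** Apply the self-adjoint case to x + x' and to ['i *: (x - x')], and solve for x. *)
Lemma central_all x x' : M x -> M x' -> is_adjoint x x' -> l x eta = r x eta.
Proof.
move=> Mx Mx' xx'; have x'x := is_adjoint_sym xx'.
have h1 : l (fun v => x v + x' v) eta = r (fun v => x v + x' v) eta.
  apply: central_selfadj; first exact: vn_add.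
  by move=> u v; rewrite hdotDl hdotDr xx' x'x addrC.
have Md := vn_sub vM Mx Mx'.
have h2 : l (fun v => 'i%C *: (x v - x' v)) eta = r (fun v => 'i%C *: (x v - x' v)) eta.
  apply: central_selfadj; first exact: (vn_scale vM 'i%C Md).
  have ic : (('i : R[i])^*)%C = - 'i%C by apply/eqP; rewrite eq_complex /= oppr0 !eqxx.
  move=> u v; rewrite hdotZl hdotZr ic linearBl linearBr /= xx' x'x.
  by rewrite linearBr /= mulNr mulrBr opprB.
rewrite (nm_add nl _ Mx Mx') (nm_add nr _ Mx Mx') in h1.
rewrite !(nm_scale vM nl) // !(nm_scale vM nr) // (nm_sub nl _ Mx Mx') (nm_sub nr _ Mx Mx') in h2.
have i0 : ('i : R[i])%C != 0 by rewrite eq_complex /= oner_eq0 andbF.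
have {}h2 := scalerI i0 h2.
have h3 : l x eta + l x eta = r x eta + r x eta.
  have e (a c : K) : a + a = (a + c) + (a - c) by rewrite addrACA subrr addr0.
  by rewrite (e _ (l x' eta)) h1 h2 -e.
have n2 : (2%:R : R[i]) != 0 by rewrite pnatr_eq0.
by apply: (scalerI n2); rewrite !scaler_nat !mulr2n.
Qed.

End CentralVector.

(** * Bimodules over L(G) as representations of G *)

Section PropertyTGroupAlgebra.
Variables (R : realType) (G : groupType).
Local Notation L2 := (ell2_hilbert R G).
Local Notation lam := (@left_translation R G).
Local Notation d1 := (delta R (1%g : G)).
Local Notation M := (group_vn R [set: G]).

Let vM : von_neumann_algebra M. Proof. by apply: group_vn_vna; split. Qed.

Let Mlam g : M (lam g). Proof. exact: lam_group_vn. Qed.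

Lemma group_vn_property_T : property_T_group R G -> property_T_vn M.
Proof.
move=> [F [eps [finF eps0 T]]]; exists (lam @` F), eps; split=> //.
- exact: finite_image.
- by move=> _ [g _ <-].
move=> K l r xi corr xi1 hxi; have [nl nr lM rM lr] := corr.
have lE x y w : M x -> M y -> l (x \o y) w = l x (l y w).
  by move=> Mx My; rewrite lM.
have rE x y w : M x -> M y -> r (x \o y) w = r y (r x w).
  by move=> Mx My; rewrite rM.
have lrE x y w : M x -> M y -> l x (r y w) = r y (l x w).
  by move=> Mx My; rewrite -[LHS]/((l x \o r y) w) lr.
have lamC g h : lam (g * h)%g = lam g \o lam h.
  by apply/funext => f; rewrite /= lamM.
have lam_id : lam 1%g = id by apply/funext => f; exact: lam1.
have rK g w : r (lam g) (r (lam g^-1%g) w) = w.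
  by rewrite -rE// -lamC mulVg lam_id (nm_id nr).
have lK g w : l (lam g^-1%g) (l (lam g) w) = w.
  by rewrite -lE// -lamC mulVg lam_id (nm_id nl).
have la g := nm_adjoint nl (Mlam g) (Mlam g^-1%g) (@lam_adjoint R G g).
have ra g := nm_adjoint nr (Mlam g) (Mlam g^-1%g) (@lam_adjoint R G g).
pose pi g := l (lam g) \o r (lam g^-1%g).
have upi : unitary_rep pi.
  split=> [g|v|g h v|g u v].
  - exact: (bounded_op_comp (nm_bounded nl (Mlam g)) (nm_bounded nr (Mlam g^-1%g))).1.
  - by rewrite /pi invg1 lam_id (nm_id nl) (nm_id nr).
  - by rewrite /pi /= invgM !lamC lE// rE// (lrE (lam h)).
  rewrite /pi /= (la g) lK.
  by rewrite (is_adjoint_sym (ra g)) rK.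
have inv_eq g eta : pi g eta = eta -> l (lam g) eta = r (lam g) eta.
  by move=> e; rewrite -[in RHS]e /pi /= -lrE// rK.
have [|eta eta0 inv] := T K pi xi upi xi1.
  move=> g Fg.
  have iso w : hnorm (r (lam g) w) = hnorm w.
    apply/eqP; rewrite -(@eqrXn2 _ 2) ?hnorm_ge0// !hnorm_sqr (adjoint_rdot (ra g)).
    by rewrite -{2}[g]invgK rK.
  (* Applying the isometry r(lam_g) to pi g xi - xi gives l(lam_g) xi - r(lam_g) xi, so both almost
     invariance conditions use the same eps. *)
  rewrite -iso (linopB (nm_bounded nr (Mlam g)).1) /pi /= -lrE// rK.
  by apply: hxi; exists g.
exists eta => // x Mx; have bx := vn_bounded vM Mx.
have Madj y : M y -> M (adj y).
  move=> My; have by_ := vn_bounded vM My; case: vM => _ h _.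
  exact: (h _ _ My (bounded_adj by_) (adj_is_adjoint by_)).
have rinv y : M y -> right_invariant y by exact: group_vn_right_invariant.
apply: (@central_all R L2 K M d1 l r eta vM _ _ corr _ x (adj x)) => //.
- move=> S sS cS; apply: delta_dense => // g.
  have -> : delta R g = rho g^-1%g d1 by rewrite rho_delta invgK mul1g.
  by apply: cS; exact: rho_commutant.
- by move=> y y' My _ yy'; rewrite (adjoint_delta1 (rinv _ My) yy') hnorm_J.
- move=> y My e e0.
  (* The elements with central adjoint pair form a subspace containing all lam_g, so their values at
     delta_1 are dense in l^2(G). *)
  pose S := [set a d1 | a in [set a | exists a', central_pair M l r eta a a']].
  have central_lam g : central_pair M l r eta (lam g) (lam g^-1%g).
    split=> //; [exact: lam_adjoint|exact: inv_eq|exact: inv_eq].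
  have sS : subspace S.
    split.
      exists (fun=> 0) => //; exists (fun=> 0); split.
      - exact: vn_zero.
      - exact: vn_zero.
      - by move=> u v; rewrite linear0l linear0r.
      - by rewrite (nm_zero vM nl) (nm_zero vM nr).
      by rewrite (nm_zero vM nl) (nm_zero vM nr).
    move=> c _ _ [a [a' [Ma Ma' aa' e1 e2]] <-] [b [b' [Mb Mb' bb' e3 e4]] <-].
    exists (fun v => c *: a v + b v) => //; exists (fun v => (c^*)%C *: a' v + b' v); split.
    - exact: vn_lincomb.
    - exact: vn_lincomb.
    - move=> u v; rewrite hdotDl hdotDr hdotZl hdotZr aa' bb'; congr (_ * _ + _).
      by case: c => p q /=; rewrite opprK.
    - by rewrite (nm_lincomb nl) // (nm_lincomb nr) // e1 e3.
    by rewrite (nm_lincomb nl) // (nm_lincomb nr) // e2 e4.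
  have Sd g : S (delta R g).
    exists (lam g); first by exists (lam g^-1%g).
    by rewrite lam_delta mulg1.
  have [_ [a [a' aa'] <-] h] := delta_dense sS Sd (y d1) e0.
  by exists a, a'; rewrite hnormB.
- exact: Madj.
exact: adj_is_adjoint.
Qed.

End PropertyTGroupAlgebra.

(** * A real character of a rank one subgroup, extended to a cocycle *)

Section RankOneCharacter.
Variables (R : realType) (Q C : groupType) (K : set Q).
Hypotheses (sK : is_subgroup K) (isoK : subgroup_isog C K) (rk1 : rank_one C)
  (nt : nontrivial C).

(* Write x = p s(x) with s constant on right cosets of K, and evaluate the embedding
   of K into the reals at p. *)
Lemma rank_one_cocycle : exists theta : Q -> R,
  (forall p x, K p -> theta (p * x)%g = theta p + theta x) /\
  exists2 p, K p & theta p <> 0.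
Proof.
have [f [finj fK]] := isoK; have [g [gM ginj]] := rk1; have [K1 KM KV] := sK.
have Kf c : K (f c) by rewrite -fK; exists c.
have /choice[finv hfinv] (p : Q) : exists c, K p -> f c = p.
  have [Kp|nKp] := pselect (K p); last by exists 1%g.
  by move: Kp; rewrite -fK => -[c _ <-]; exists c.
pose phi p : R := ratr (g (finv p)).
have phiM p p' : K p -> K p' -> phi (p * p')%g = phi p + phi p'.
  move=> Kp Kp'; rewrite /phi -rmorphD -gM; congr (ratr (g _)); apply: finj.
  by rewrite gmulfM !hfinv//; exact: KM.
have phi1 : phi 1%g = 0 by have := phiM 1%g 1%g K1 K1; rewrite mulg1; lra.
pose coset (x : Q) : set Q := [set y | K (y * x^-1)%g].
have cosetK p x : K p -> coset (p * x)%g = coset x.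
  move=> Kp; apply/seteqP; split=> y; rewrite /coset /= invgM mulgA => h.
    by rewrite -(mulgVK p (y * x^-1)%g); exact: KM.
  by apply: KM => //; exact: KV.
(* [xget] depends only on the set, so p x and x have the same representative for p in K. *)
pose rep x := xget 1%g (coset x).
have Krep x : K (x * (rep x)^-1)%g.
  have : coset x (rep x) by apply: (@xgetPex _ 1%g (coset x)); exists x; rewrite /coset /= mulgV.
  by move=> /KV; rewrite invgM invgK.
have repK p x : K p -> rep (p * x)%g = rep x by move=> Kp; rewrite /rep cosetK.
pose th x := phi (x * (rep x)^-1)%g.
have thK p x : K p -> th (p * x)%g = phi p + th x.
  by move=> Kp; rewrite /th repK// -mulgA (phiM _ _ Kp (Krep x)).
(* The representative of K itself need not be 1. Subtracting th 1 makes theta agree with phi on K,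
   which turns [thK] into additivity. *)
exists (fun x => th x - th 1%g); split.
  move=> p x Kp; rewrite thK// -{2}[p]mulg1 thK//; lra.
have [c c1] := nt; exists (f c) => //.
rewrite -[f c]mulg1 thK// addrK /phi => /eqP; rewrite fmorph_eq0 => /eqP e.
apply: c1; have -> : c = finv (f c) by apply: finj; rewrite hfinv.
apply: ginj; rewrite e; have := gM 1%g 1%g; rewrite mulg1 => e1.
by apply: (@addrI _ (g 1%g)); rewrite addr0 -e1.
Qed.

End RankOneCharacter.

Theorem theorem4p4 (R : realType) (Q C N : groupType)
    (sigma : group_action Q N) (Qm : set Q)
    (Q_nonelementary : ~ elementary Q)
    (Q_torsion_free : torsion_free Q)
    (Q_lacunary : lacunary_hyperbolic R Q)
    (C_rank_one : rank_one C)
    (C_nontrivial : nontrivial C)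
    (Q_maximal : forall K : set Q, maximal_subgroup K -> subgroup_isog C K)
    (Qm_maximal : maximal_subgroup Qm)
    (NQ_rip : rip R sigma) :
  let M := group_vn R [set: sdprod sigma] in
  let Mm := group_vn R (sd_over sigma Qm) in
  maximal_vn_subalgebra Mm M /\
  (rip_T R sigma ->
     ~ property_T_vn Mm /\ property_T_vn M).
Proof.
move=> M Mm; split; first exact: maximal_group_vn.
move=> [_ QT]; have [sQm _ _] := Qm_maximal; split; last first.
  have [[Gamma [f [_ _ _ GammaT fsurj]]] _ _ _] := NQ_rip.
  by apply: group_vn_property_T; exact: property_T_sdprod fsurj GammaT QT.
have [theta [thetaM [p Qmp thetap]]] :=
  rank_one_cocycle R sQm (Q_maximal _ Qm_maximal) C_rank_one C_nontrivial.
have tM (k x : (sdprod sigma : groupType)) : sd_over sigma Qm k ->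
    theta (k * x)%g.2 = theta k.2 + theta x.2 by exact: thetaM.
apply: (twisted_not_property_T (sd_over_subgroup sigma sQm) tM (k0 := sd_inr sigma p)) => //.
(* Qm contains 1, so N x| Qm contains N, and a finite orbit under the larger group is finite under
   N. *)
move=> y [s hs]; apply: (rip_icc NQ_rip Q_nonelementary); exists s => n.
by apply: hs; case: sQm.
Qed.
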